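(* Assume the weight functions $\hat w^{(n)}:\mathbb R^{d_Z}\to\mathbb R$ are estimated on a data set $\mathbf A$ independent of $(\mathbf X^{(n)},\mathbf Y^{(n)},\mathbf Z^{(n)})$, and that there exists $C>0$ such that $|\hat w^{(n)}(z)|\le C$ for all $n\in\mathbb N$ and $z\in\mathbb R^{d_Z}$. Define $\bar\sigma_n^2=\bar\sigma_{n,P}^2=\mathbb E_P[\hat w^{(n)}(Z)^2\epsilon_P^2\xi_P^2\mid\mathbf A]$. 1. Let $P\in\mathcal P_0$. Assume $A_fA_g=o_P(n^{-1})$, $B_f=o_P(1)$, $B_g=o_P(1)$, that there exists $\eta>0$ with $\mathbb E_P[|\epsilon_P\xi_P|^{2+\eta}]<\infty$, and that $P$-almost surely there exists $c>0$ with $\inf_{n\in\mathbb N}\bar\sigma_n^2\ge c$. Then $\sup_{t\in\mathbb R}|\mathbb P_P(T^{(n)}\le t)-\Phi(t)|\to0$. 2. Let $\mathcal P\subset\mathcal P_0$. Assume $A_fA_g=o_{\mathcal P}(n^{-1})$, $B_f=o_{\mathcal P}(1)$, $B_g=o_{\mathcal P}(1)$, that there exists $\eta>0$ with $\sup_{P\in\mathcal P}\mathbb E_P[|\epsilon_P\xi_P|^{2+\eta}]<\infty$, and that there exists $c>0$ such that for all $P\in\mathcal P$, $P$-almost surely $\inf_{n\in\mathbb N}\bar\sigma_n^2\ge c$. Then $\sup_{P\in\mathcal P}\sup_{t\in\mathbb R}|\mathbb P_P(T^{(n)}\le t)-\Phi(t)|\to0$.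
   Context: Let $X,Y$ be real-valued random variables and $Z$ a random vector in $\mathbb R^{d_Z}$. $\mathcal E_0$ is the set of distributions of $(X,Y,Z)$ absolutely continuous with respect to Lebesgue measure, $\mathcal P_0\subseteq\mathcal E_0$ those under which $X$ and $Y$ are conditionally independent given $Z$. For $P\in\mathcal E_0$: $f_P(z)=\mathbb E_P[X\mid Z=z]$, $g_P(z)=\mathbb E_P[Y\mid Z=z]$, $\epsilon_P=X-f_P(Z)$, $\xi_P=Y-g_P(Z)$, $u_P(z)=\mathbb E_P[\epsilon_P^2\mid Z=z]$, $v_P(z)=\mathbb E_P[\xi_P^2\mid Z=z]$. Data $(x_i,y_i,z_i)$, $i=1,\dots,n$, are i.i.d. copies of $(X,Y,Z)$ forming $(\mathbf X^{(n)},\mathbf Y^{(n)},\mathbf Z^{(n)})$; $\hat f$ is obtained by regressing $\mathbf X^{(n)}$ on $\mathbf Z^{(n)}$ and $\hat g$ by regressing $\mathbf Y^{(n)}$ on $\mathbf Z^{(n)}$. $A_f=\frac1n\sum_i(f_P(z_i)-\hat f(z_i))^2$, $A_g=\frac1n\sum_i(g_P(z_i)-\hat g(z_i))^2$, $B_f=\frac1n\sum_i(f_P(z_i)-\hat f(z_i))^2v_P(z_i)$, $B_g=\frac1n\sum_i(g_P(z_i)-\hat g(z_i))^2u_P(z_i)$. With $R_i^{(n)}=(x_i-\hat f(z_i))(y_i-\hat g(z_i))\hat w^{(n)}(z_i)$, the statistic is $T^{(n)}=\tau_N^{(n)}/\tau_D^{(n)}$, $\tau_N^{(n)}=\frac1{\sqrt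 n}\sum_iR_i^{(n)}$, $\tau_D^{(n)}=\big(\frac1n\sum_i(R_i^{(n)})^2-(\frac1n\sum_rR_r^{(n)})^2\big)^{1/2}$. $\Phi$ is the standard normal distribution function. For a family $\mathcal P$, $V_n=o_{\mathcal P}(W_n)$ means $\sup_{P\in\mathcal P}\mathbb P_P(|V_n/W_n|>\delta)\to0$ for all $\delta>0$; $o_P$ is the case $\mathcal P=\{P\}$. *)

(* Defs.v *)
From HB Require Import structures.
From mathcomp Require Import all_boot all_order all_algebra.
From mathcomp Require Import all_classical all_reals all_analysis.
Set Implicit Arguments. Unset Strict Implicit. Unset Printing Implicit Defensive.
Import Order.TTheory GRing.Theory Num.Theory.
Import numFieldNormedType.Exports.
Local Open Scope classical_set_scope.
Local Open Scope ring_scope.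

Section Boxes.
Variable R : realType.

Definition obox N (a b : 'I_N -> R) : set ('I_N -> R) :=
  [set x | forall j, a j < x j < b j].

Definition boxes N : set (set ('I_N -> R)) :=
  [set B | exists a b, B = obox a b].


Definition box_vol N (a b : 'I_N -> R) : R := \prod_(j < N) Num.max (b j - a j) 0.

Definition lebesgue_null N (S : set ('I_N -> R)) : Prop :=
  forall e : R, 0 < e -> exists a b : nat -> 'I_N -> R,
    S `<=` \bigcup_k obox (a k) (b k) /\
    forall m, \sum_(k < m) box_vol (a k) (b k) <= e.

End Boxes.

(** R^N with the sigma-algebra generated by open boxes (= Borel sets) *)
Notation Rn R N := (g_sigma_algebraType (@boxes R N)).

(** * The observation (X, Y, Z) in R x R x R^{d_Z} = R^{d_Z + 2} *)
Notation Obs R d := (Rn R d.+2).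
Notation Zsp R d := (Rn R d).

Section GCMDefs.
Variable R : realType.

Definition Xo d (o : Obs R d) : R := o ord0.
Definition Yo d (o : Obs R d) : R := o (@Ordinal d.+2 1 isT).
Definition Zo d (o : Obs R d) : Zsp R d := fun j : 'I_d => o (@rshift 2 d j).
Arguments Xo {d}. Arguments Yo {d}. Arguments Zo {d}.

Section OnObs.
Variable d : nat.
Implicit Types P : probability (Obs R d) R.

Definition abs_cont P : Prop :=
  forall S : set (Obs R d), measurable S -> lebesgue_null S -> P S = 0%E.

Definition cond_exp P (h : Obs R d -> R) (f : Zsp R d -> R) : Prop :=
  measurable_fun setT f /\ P.-integrable setT (EFin \o h) /\
  forall B : set (Zsp R d), measurable B ->
    (\int[P]_(o in Zo @^-1` B) (h o)%:E =
     \int[P]_(o in Zo @^-1` B) (f (Zo o))%:E)%E.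

Definition cond_exp_nonneg P (h : Obs R d -> R) (f : Zsp R d -> R) : Prop :=
  measurable_fun setT h /\ measurable_fun setT f /\ (forall z, 0 <= f z) /\
  forall B : set (Zsp R d), measurable B ->
    (\int[P]_(o in Zo @^-1` B) (h o)%:E =
     \int[P]_(o in Zo @^-1` B) (f (Zo o))%:E)%E.

Definition cond_indep P : Prop :=
  forall (B C : set R), measurable B -> measurable C ->
  forall pB pC : Zsp R d -> R,
    cond_exp P (fun o => \1_B (Xo o)) pB ->
    cond_exp P (fun o => \1_C (Yo o)) pC ->
    cond_exp P (fun o => \1_B (Xo o) * \1_C (Yo o)) (fun z => pB z * pC z).

Definition E0 : set (probability (Obs R d) R) := [set P | abs_cont P].
Definition P0 : set (probability (Obs R d) R) := [set P | abs_cont P /\ cond_indep P].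

End OnObs.

Definition Phi (t : R) : R := fine (normal_prob 0 1 `]-oo, t]).

Section Sampling.
Variables (d : nat) (dO : measure_display) (Omega : measurableType dO).
Variables (dA : measure_display) (TA : measurableType dA).
Variables (O : nat -> Omega -> Obs R d) (A : Omega -> TA).

Definition xs i w := Xo (O i w).
Definition ys i w := Yo (O i w).
Definition zs i w := Zo (O i w).

Definition iid_indep (Pr : probability Omega R) (P : probability (Obs R d) R) : Prop :=
  (forall i, measurable_fun setT (O i)) /\ measurable_fun setT A /\
  forall (n : nat) (S : nat -> set (Obs R d)) (B : set TA),
    (forall i, measurable (S i)) -> measurable B ->
    Pr (A @^-1` B `&` \bigcap_(i in `I_n) (O i @^-1` S i)) =
    (Pr (A @^-1` B) * \prod_(i < n) P (S i))%E.

Definition gen_XZ n : set (set Omega) :=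
  [set E | exists i, (i < n)%N /\
     ((exists B : set R, measurable B /\ E = xs i @^-1` B) \/
      (exists B : set (Zsp R d), measurable B /\ E = zs i @^-1` B))].
Definition gen_YZ n : set (set Omega) :=
  [set E | exists i, (i < n)%N /\
     ((exists B : set R, measurable B /\ E = ys i @^-1` B) \/
      (exists B : set (Zsp R d), measurable B /\ E = zs i @^-1` B))].

(** fhat n w : the regression of X^(n) on Z^(n); its fitted values are
    sigma(X^(n), Z^(n))-measurable *)
Definition regression_XZ (fhat : nat -> Omega -> Zsp R d -> R) : Prop :=
  forall n i, (i < n)%N -> forall B : set R, measurable B ->
    <<s gen_XZ n >> ((fun w => fhat n w (zs i w)) @^-1` B).
Definition regression_YZ (ghat : nat -> Omega -> Zsp R d -> R) : Prop :=
  forall n i, (i < n)%N -> forall B : set R, measurable B ->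
    <<s gen_YZ n >> ((fun w => ghat n w (zs i w)) @^-1` B).

Variables (fhat ghat : nat -> Omega -> Zsp R d -> R) (what : nat -> TA -> Zsp R d -> R).

Definition Rres n i w : R :=
  (xs i w - fhat n w (zs i w)) * (ys i w - ghat n w (zs i w)) * what n (A w) (zs i w).

Definition tauN n w : R := (Num.sqrt n%:R)^-1 * \sum_(i < n) Rres n i w.
Definition tauD n w : R :=
  Num.sqrt (n%:R^-1 * \sum_(i < n) (Rres n i w) ^+ 2 - (n%:R^-1 * \sum_(r < n) Rres n r w) ^+ 2).
Definition Tstat n w : R := tauN n w / tauD n w.

Definition A_f (f : Zsp R d -> R) n w : R :=
  n%:R^-1 * \sum_(i < n) (f (zs i w) - fhat n w (zs i w)) ^+ 2.
Definition A_g (g : Zsp R d -> R) n w : R :=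
  n%:R^-1 * \sum_(i < n) (g (zs i w) - ghat n w (zs i w)) ^+ 2.
Definition B_f (f v : Zsp R d -> R) n w : R :=
  n%:R^-1 * \sum_(i < n) (f (zs i w) - fhat n w (zs i w)) ^+ 2 * v (zs i w).
Definition B_g (g u : Zsp R d -> R) n w : R :=
  n%:R^-1 * \sum_(i < n) (g (zs i w) - ghat n w (zs i w)) ^+ 2 * u (zs i w).

(** bar sigma_n^2 = E_P[ what^(n)(Z)^2 eps_P^2 xi_P^2 | A ], as a function of A = a
    (a fresh (X,Y,Z) ~ P independent of A) *)
Definition sigma2 (P : probability (Obs R d) R) (f g : Zsp R d -> R) n (a : TA) : \bar R :=
  (\int[P]_o ((what n a (Zo o)) ^+ 2 * (Xo o - f (Zo o)) ^+ 2 * (Yo o - g (Zo o)) ^+ 2)%:E)%E.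

End Sampling.

Definition littleo_fam {I : Type} {dO : measure_display} {Omega : measurableType dO}
  (fam : set I) (Pr : I -> probability Omega R)
  (V : I -> nat -> Omega -> R) (W : nat -> R) : Prop :=
  forall delta : R, 0 < delta ->
    (fun n => ereal_sup [set Pr P [set w | delta < `|V P n w / W n| ] | P in fam])
      @ \oo --> 0%E.

End GCMDefs.
Arguments Xo {R d}. Arguments Yo {R d}. Arguments Zo {R d}.

(* Main.v *)
Require Import Defs.
From HB Require Import structures.
From mathcomp Require Import all_boot all_order all_algebra.
From mathcomp Require Import all_classical all_reals all_analysis.
From mathcomp Require Import measurable_realfun simple_functions measurable_fun_approximation.
From mathcomp Require Import ring lra.
Set Implicit Arguments. Unset Strict Implicit. Unset Printing Implicit Defensive.
Import Order.TTheory GRing.Theory Num.Theory.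
Import numFieldNormedType.Exports.
Local Open Scope classical_set_scope.
Local Open Scope ring_scope.

(** The residuals are [R_i = (D_i + eps_i) (E_i + xi_i) w_i], where [D_i], [E_i] are the fitting
    errors of the two regressions. By Cauchy-Schwarz the [D_i E_i w_i] contribute at most
    [C sqrt (n A_f A_g)] to the numerator of [T]. Given [X], [Z] and [A], conditional independence
    makes the [D_i w_i xi_i] centred and orthogonal, so that on [B_f <= delta] their normalised sum
    has second moment at most [C^2 delta]; the [E_i w_i eps_i] are symmetric. What remains of the
    numerator is a sum of the [eps_i xi_i w_i], which given [A] are i.i.d. with mean 0 and variance
    [sigma_n^2 (A)]: Lindeberg's replacement method, against a smoothed indicator, compares its
    distribution function with [Phi]. The denominator is handled by a truncated law of large numbers.
    All bounds are non-asymptotic and see the law [P] only through the hypotheses, hence are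
    uniform over a family; the pointwise part is the case of a singleton.

    Conditional distributions given [(A, X, Z)] are never formed: an identity tested on a pi-system of
    cylinder events extends to all functions measurable for the sigma-algebra it generates. *)

(** * Conditioning through pi-systems *)

(** The fits use the whole sample, so the cross terms are not independent. They are orthogonal only
    because, given [A] and all pairs (X, Z), every coefficient D_i w_i is known. The event that B_f
    is at most [delta] is known too, so its indicator may be put inside the coefficients: this turns
    a bound in probability on B_f into a pathwise one, and no moment of the fits is ever needed.
    Only 2 + eta moments of eps xi are given, and eta may be small. Hence the Taylor remainder is
    min(|y|^3, y^2), and the squares in the denominator, which need not have a variance, are
    truncated at a level [K]. The moment hypothesis enters only through the integrability of (eps
    xi)^2 and its tail above [K]. The two parts differ in the variance hypothesis: a random lower
    bound, or a constant one. Both give, for each [rho], a constant [c] that bounds the variance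
    from below outside an event of probability at most [rho]. The limit theorem is therefore proved
    on an event depending on [A], whose complement is charged to the error. *)

Section density_measure.
Context d (T : measurableType d) (R : realType) (mu : {measure set T -> \bar R}).
Variable f : T -> R.

(** The measurability and sign proofs are arguments so that the measure structure can be inferred. *)
Definition density_measure (mf : measurable_fun setT f) (f0 : forall x, 0 <= f x) : set T -> \bar R :=
  fun A => (\int[mu]_(x in A) (f x)%:E)%E.

Hypothesis mf : measurable_fun setT f.
Hypothesis f0 : forall x, 0 <= f x.
Local Notation nu := (density_measure mf f0).

Let density0 : nu set0 = 0%E.
Proof. by rewrite /density_measure integral_set0. Qed.

Let density_ge0 A : (0 <= nu A)%E.
Proof. by apply: integral_ge0 => x _; rewrite lee_fin. Qed.

Let density_sigma_additive : semi_sigma_additive nu.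
Proof.
move=> F mF tF mUF; rewrite /density_measure ge0_integral_bigcup//=.
- by apply: is_cvg_nneseries_cond => n _ _; apply: integral_ge0 => x _; rewrite lee_fin.
- exact/measurable_EFinP/measurable_funTS.
- by move=> x _; rewrite lee_fin.
Qed.

HB.instance Definition _ := isMeasure.Build _ _ _
  nu density0 density_ge0 density_sigma_additive.

Import HBNNSimple.

(** Approximation of [g] from below by simple functions. Its role is to read an identity between the
    integrals of [h * f1] and [h * f2] as an equality of the measures with densities [f1] and [f2],
    to which uniqueness on a pi-system applies. *)
Lemma integral_density (g : T -> R) :
  measurable_fun setT g -> (forall x, 0 <= g x) ->
  (\int[nu]_x (g x)%:E = \int[mu]_x (g x * f x)%:E)%E.
Proof.
move=> mg g0.
have mg' : measurable_fun setT (EFin \o g) by exact/measurable_EFinP.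
pose h := nnsfun_approx measurableT mg'.
have ndh x : nondecreasing_seq (fun n => h n x).
  by move=> a b ab; exact/lefP/nd_nnsfun_approx.
have cvgh x : (h n x)%:E @[n --> \oo] --> (g x)%:E.
  by apply: cvg_nnsfun_approx => // y _; rewrite lee_fin.
have L : (\int[nu]_x (h n x)%:E)%E @[n --> \oo] -->
    (\int[nu]_x (g x)%:E)%E.
  rewrite (_ : (\int[_]_x (g x)%:E)%E =
    (\int[nu]_x (limn (fun n => (h n x)%:E)))%E); last first.
    by apply: eq_integral => x _; apply/esym/cvg_lim.
  apply: cvg_monotone_convergence => //.
  - by move=> n; exact/measurable_EFinP.
  - by move=> n x _; rewrite lee_fin.
  - by move=> x _ a b ab; rewrite lee_fin; exact: ndh.
have L' : (\int[mu]_x (h n x * f x)%:E)%E @[n --> \oo] -->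
    (\int[mu]_x (g x * f x)%:E)%E.
  rewrite (_ : (\int[_]_x (g x * f x)%:E)%E =
    (\int[mu]_x (limn (fun n => (h n x * f x)%:E)))%E); last first.
    apply: eq_integral => x _; apply/esym/cvg_lim => //.
    under eq_fun do rewrite EFinM.
    by rewrite EFinM; apply: cvgeZr.
  apply: cvg_monotone_convergence => //.
  - by move=> n; apply/measurable_EFinP/measurable_funM.
  - by move=> n x _; rewrite lee_fin mulr_ge0.
  - by move=> x _ a b ab; rewrite lee_fin ler_wpM2r// ndh.
suff E n : (\int[nu]_x (h n x)%:E = \int[mu]_x (h n x * f x)%:E)%E.
  by move: L'; rewrite -(funext E); exact: cvg_unique.
have hE t : (h n t)%:E =
    (\sum_(r \in range (h n)) (r * \1_(h n @^-1` [set r]) t)%:E)%E.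
  by rewrite fimfunE fsumEFin.
transitivity (\int[nu]_t
    (\sum_(r \in range (h n)) (r * \1_(h n @^-1` [set r]) t)%:E))%E.
  by apply: eq_integral => t _; exact: hE.
transitivity (\int[mu]_t
    (\sum_(r \in range (h n)) ((f t)%:E * (r * \1_(h n @^-1` [set r]) t)%:E)))%E; last first.
  apply: eq_integral => t _; rewrite mulrC EFinM hE ge0_mule_fsumr// => r.
  exact: nnfun_muleindic_ge0.
rewrite ge0_integral_fsum//; last 2 first.
- by move=> r; exact/measurable_EFinP/measurable_funM.
- by move=> r t _; exact: nnfun_muleindic_ge0.
rewrite ge0_integral_fsum//; last 2 first.
- by move=> r; apply: emeasurable_funM; apply/measurable_EFinP => //; exact: measurable_funM.
- by move=> r t _; apply: mule_ge0; [rewrite lee_fin|exact: nnfun_muleindic_ge0].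
apply: eq_fsbigr => r; rewrite inE => -[t _ rE].
have r0 : 0 <= r by rewrite -rE.
under eq_integral do rewrite EFinM.
rewrite ge0_integralZl//; last exact/measurable_EFinP.
under [RHS]eq_integral do rewrite EFinM muleCA.
rewrite [RHS]ge0_integralZl//; last 2 first.
- by apply: emeasurable_funM; apply/measurable_EFinP.
- by move=> x _; rewrite -EFinM lee_fin mulr_ge0.
congr (_ * _)%E.
rewrite integral_indic// setIT.
rewrite -[LHS]/(\int[mu]_(x in h n @^-1` [set r]) (f x)%:E)%E [LHS]integral_mkcond.
by apply: eq_integral => x _; rewrite -EFinM patchE indicE; case: ifP => _; rewrite ?mulr1 ?mulr0.
Qed.

End density_measure.

Section image_measure.
Context d1 d2 (T1 : measurableType d1) (T2 : measurableType d2) (R : realType).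
Variables (mu : {measure set T1 -> \bar R}) (phi : T1 -> T2).
Hypothesis mphi : measurable_fun setT phi.

(** The push-forward, bundled with a named measurability proof. Along the identity into a coarser
    sigma-algebra it is the restriction of [mu]. *)
Definition image_measure : {measure set T2 -> \bar R} :=
  measure_function_pushforward__canonical__measure_function_Measure mu mphi.

Lemma image_measureE A : image_measure A = mu (phi @^-1` A).
Proof. by []. Qed.

Lemma ge0_integral_image_measure (f : T2 -> \bar R) :
  measurable_fun setT f -> (forall y, 0 <= f y)%E ->
  (\int[image_measure]_y f y = \int[mu]_x f (phi x))%E.
Proof.
by move=> mf f0; rewrite (ge0_integral_pushforward mphi)// => y _; exact: f0.
Qed.

End image_measure.

Section pi_system_integral.
Context d (T : measurableType d) (R : realType) (mu : {measure set T -> \bar R}).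
Variable G : set (set T).
Hypothesis Gm : G `<=` measurable.
Hypothesis GI : setI_closed G.

Let sGm : <<s G >> `<=` (measurable : set (set T)).
Proof. exact: (sub_sigma_algebra2 Gm) || (apply: smallest_sub => //; exact: sigma_algebra_measurable). Qed.

Lemma measurable_fun_g_sigma_id :
  measurable_fun setT (fun x : T => (x : g_sigma_algebraType G)).
Proof. by move=> _ Y mY; rewrite setTI preimage_id; apply: sGm. Qed.

Lemma measurable_fun_g_sigma d' (U : measurableType d') (h : T -> U) :
  measurable_fun setT (h : g_sigma_algebraType G -> U) -> measurable_fun setT h.
Proof. by move=> mh _ Y mY; have := mh measurableT Y mY; exact: sGm. Qed.

(** The measures with densities [f1] and [f2] agree on [G], and the covering sequence [g] makes them
    sigma-finite there, so they agree on the generated sigma-algebra. Restricted to it, they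
    integrate [h] to the same value. *)
Lemma ge0_integral_pi_system (f1 f2 : T -> R) (g : nat -> set T) :
  measurable_fun setT f1 -> measurable_fun setT f2 ->
  (forall x, 0 <= f1 x) -> (forall x, 0 <= f2 x) ->
  (forall k, G (g k)) -> \bigcup_k g k = setT ->
  (forall k, \int[mu]_(x in g k) (f1 x)%:E < +oo)%E ->
  (forall E, G E -> \int[mu]_(x in E) (f1 x)%:E = \int[mu]_(x in E) (f2 x)%:E)%E ->
  forall h : T -> R, measurable_fun setT (h : g_sigma_algebraType G -> R) ->
  (forall x, 0 <= h x) ->
  (\int[mu]_x (h x * f1 x)%:E = \int[mu]_x (h x * f2 x)%:E)%E.
Proof.
move=> mf1 mf2 f10 f20 Gg gT goo f12 h mh h0.
have mhT := measurable_fun_g_sigma mh.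
rewrite -(integral_density mu mf1 f10 mhT h0) -(integral_density mu mf2 f20 mhT h0).
have mhE : measurable_fun setT ((fun x => (h x)%:E) : g_sigma_algebraType G -> \bar R).
  exact/measurable_EFinP.
have hE0 (x : g_sigma_algebraType G) : (0 <= (h x)%:E)%E by rewrite lee_fin.
rewrite -(ge0_integral_image_measure _ measurable_fun_g_sigma_id mhE hE0).
rewrite -(ge0_integral_image_measure _ measurable_fun_g_sigma_id mhE hE0).
apply: eq_measure_integral => A mA _.
exact: (@measure_unique _ R (g_sigma_algebraType G) G g).
Qed.

(** The positive and negative parts of [f] have equal, finite integrals over every member of [G], so
    the nonnegative case applies to them, tested against the positive and the negative part of [h]
    separately. Integrability of [h * f] keeps the four products finite, and they cancel in
    pairs. *)
Lemma integral0_pi_system (f : T -> R) :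
  G setT -> mu.-integrable setT (EFin \o f) ->
  (forall E, G E -> \int[mu]_(x in E) (f x)%:E = 0)%E ->
  forall h : T -> R, measurable_fun setT (h : g_sigma_algebraType G -> R) ->
  mu.-integrable setT (EFin \o (fun x => h x * f x)) ->
  (\int[mu]_x (h x * f x)%:E = 0)%E.
Proof.
move=> GT fi fE h mh hfi.
have mhT := measurable_fun_g_sigma mh.
have mf : measurable_fun setT f by apply/measurable_EFinP/(measurable_int mu).
pose pos (k : T -> R) x := Num.max (k x) 0.
pose neg (k : T -> R) x := Num.max (- k x) 0.
have pn k x : k x = pos k x - neg k x.
  by rewrite /pos /neg; case: (leP (k x)); case: (leP (- k x)) => *; lra.
have pos0 k x : 0 <= pos k x by rewrite /pos le_max lexx orbT.
have neg0 k x : 0 <= neg k x by rewrite /neg le_max lexx orbT.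
have posn k x : pos k x <= `|k x| by rewrite /pos ge_max ler_norm normr_ge0.
have negn k x : neg k x <= `|k x| by rewrite /neg ge_max -normrN ler_norm normr_ge0.
have mpos k : measurable_fun setT k -> measurable_fun setT (pos k).
  by move=> mk; apply: measurable_maxr.
have mneg k : measurable_fun setT k -> measurable_fun setT (neg k).
  by move=> mk; apply: measurable_maxr => //; exact: measurableT_comp.
have mposh : measurable_fun setT (pos h : g_sigma_algebraType G -> R).
  exact: measurable_maxr.
have mnegh : measurable_fun setT (neg h : g_sigma_algebraType G -> R).
  by apply: measurable_maxr => //; exact: measurableT_comp.
have domi (k g : T -> R) : mu.-integrable setT (EFin \o k) ->
    measurable_fun setT g -> (forall x, 0 <= g x <= `|k x|) ->
    mu.-integrable setT (EFin \o g).
  move=> ki mg gk; apply: (le_integrable measurableT _ _ ki); first exact/measurable_EFinP.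
  by move=> x _; rewrite lee_fin; have /andP[g0] := gk x; rewrite (ger0_norm g0).
have ifp : mu.-integrable setT (EFin \o pos f).
  by apply: (domi _ _ fi) => [|x]; [exact: mpos|rewrite pos0 posn].
have ifn : mu.-integrable setT (EFin \o neg f).
  by apply: (domi _ _ fi) => [|x]; [exact: mneg|rewrite neg0 negn].
have E12 E : G E -> (\int[mu]_(x in E) (pos f x)%:E = \int[mu]_(x in E) (neg f x)%:E)%E.
  move=> GE; have mE := Gm GE.
  have := fE _ GE.
  under eq_integral => x _ do rewrite (pn f x).
  have ip : mu.-integrable E (EFin \o pos f) by exact: integrableS ifp.
  have inn : mu.-integrable E (EFin \o neg f) by exact: integrableS ifn.
  have fp := integrable_fin_num mE ip; have fn := integrable_fin_num mE inn.
  rewrite (integralB_EFin mE ip inn) => /eqP.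
  by rewrite sube_eq ?add0e ?fin_num_adde_defr// => /eqP.
have key k : measurable_fun setT (k : g_sigma_algebraType G -> R) ->
    (forall x, 0 <= k x) ->
    (\int[mu]_x (k x * pos f x)%:E = \int[mu]_x (k x * neg f x)%:E)%E.
  move=> mk k0; apply: (@ge0_integral_pi_system _ _ (fun=> setT)) => //.
  - exact: mpos.
  - exact: mneg.
  - by rewrite bigcup_const.
  - move=> _; have /integrableP[_] := ifp; under eq_integral do rewrite /= ger0_norm//.
    exact.
have int4 (k g : T -> R) : measurable_fun setT k -> measurable_fun setT g ->
    (forall x, 0 <= k x <= `|h x|) -> (forall x, 0 <= g x <= `|f x|) ->
    mu.-integrable setT (EFin \o (fun x => k x * g x)).
  move=> mk mg kh gf; apply: (domi _ _ hfi) => [|x]; first exact: measurable_funM.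
  have /andP[k0 kh1] := kh x; have /andP[g0 gf1] := gf x.
  by rewrite mulr_ge0//= normrM ler_pM.
have php x : 0 <= pos h x <= `|h x| by rewrite pos0 posn.
have nhp x : 0 <= neg h x <= `|h x| by rewrite neg0 negn.
have pfp x : 0 <= pos f x <= `|f x| by rewrite pos0 posn.
have nfp x : 0 <= neg f x <= `|f x| by rewrite neg0 negn.
have i1 := int4 _ _ (mpos _ mhT) (mpos _ mf) php pfp.
have i2 := int4 _ _ (mneg _ mhT) (mneg _ mf) nhp nfp.
have i3 := int4 _ _ (mpos _ mhT) (mneg _ mf) php nfp.
have i4 := int4 _ _ (mneg _ mhT) (mpos _ mf) nhp pfp.
transitivity (\int[mu]_x ((pos h x * pos f x - pos h x * neg f x)
   + (neg h x * neg f x - neg h x * pos f x))%:E)%E.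
  by apply: eq_integral => x _; rewrite {1}(pn h x) {1}(pn f x); congr EFin; ring.
rewrite integralD_EFin//; last 2 first.
- exact: (integrableB measurableT i1 i3).
- exact: (integrableB measurableT i2 i4).
rewrite (integralB_EFin measurableT i1 i3) (integralB_EFin measurableT i2 i4).
rewrite (key _ mposh)// (key _ mnegh)//.
by rewrite !subee ?adde0// ?integrable_fin_num.
Qed.

End pi_system_integral.

(** * Integrals over cylinder events of an independent sample *)

Section iid.
Context d1 d2 d3 (Omega : measurableType d1) (TA : measurableType d2)
  (TO : measurableType d3) (R : realType).
Variables (Pr : probability Omega R) (P : probability TO R).
Variables (O : nat -> Omega -> TO) (A : Omega -> TA).
Hypothesis mO : forall i, measurable_fun setT (O i).
Hypothesis mA : measurable_fun setT A.
Hypothesis indep : forall n (S : nat -> set TO) (B : set TA),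
  (forall i, measurable (S i)) -> measurable B ->
  Pr (A @^-1` B `&` \bigcap_(i in `I_n) (O i @^-1` S i)) =
  (Pr (A @^-1` B) * \prod_(i < n) P (S i))%E.

Definition cyl_base n (B : set TA) (S : nat -> set TO) : set Omega :=
  A @^-1` B `&` \bigcap_(k in `I_n) (O k @^-1` S k).

(** Only coordinate [i] is restricted to [C]. The generated sigma-algebra is that of [A], of the
    observations of index below [n] other than [i], and of what [C] reveals about [O i]. With [C =
    [set setT]] nothing of [O i] is revealed; with [C] the events of (X, Z), only Y is hidden. *)
Definition cyl n i (C : set (set TO)) : set (set Omega) :=
  [set E | exists B S, [/\ measurable B, forall k, measurable (S k), C (S i)
     & E = cyl_base n B S]].

Lemma measurable_cyl_base n B S : measurable B -> (forall k, measurable (S k)) ->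
  measurable (cyl_base n B S).
Proof.
move=> mB mS; apply: measurableI; first by rewrite -[X in measurable X]setTI; exact: mA.
apply: bigcap_measurableType => k _; rewrite -[X in measurable X]setTI; exact: mO.
Qed.

Lemma cyl_measurable n i C : cyl n i C `<=` measurable.
Proof. by move=> _ [B [S [mB mS _ ->]]]; exact: measurable_cyl_base. Qed.

Lemma cyl_setI n i C : setI_closed C -> setI_closed (cyl n i C).
Proof.
move=> CI _ _ [B [S [mB mS CS ->]]] [B' [S' [mB' mS' CS' ->]]].
exists (B `&` B'), (fun k => S k `&` S' k); split => //.
- exact: measurableI.
- by move=> k; exact: measurableI.
- exact: CI.
- rewrite /cyl_base; apply/seteqP; split=> [w [[Bw Sw] [Bw' Sw']]|w [[Bw Bw'] Sw]].
    by split=> // k kn; split; [exact: Sw|exact: Sw'].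
  by split; split => // k /Sw[].
Qed.

Lemma cyl_setT n i C : C setT -> cyl n i C setT.
Proof.
move=> CT; exists setT, (fun=> setT); split => //.
by rewrite /cyl_base; apply/seteqP; split.
Qed.

(** Independence in product form. Weighted by the indicator of the constraints at the other places,
    [Pr] is sent by [O i] to a constant multiple of [P]: this is the hypothesis [indep] with an
    arbitrary event at place [i]. *)
Lemma integral_cyl_base n i B S (phi : TO -> R) : (i < n)%N ->
  measurable B -> (forall k, measurable (S k)) ->
  measurable_fun setT phi -> (forall o, 0 <= phi o) ->
  (\int[Pr]_(w in cyl_base n B S) (phi (O i w))%:E =
   (fine (Pr (A @^-1` B)) * \prod_(k < n | k != i :> nat) fine (P (S k)))%:E
     * \int[P]_(o in S i) (phi o)%:E)%E.
Proof.
move=> ltin mB mS mphi phi0.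
set c := (X in X%:E).
have c0 : 0 <= c by rewrite mulr_ge0 ?prodr_ge0 // => *; exact: fine_ge0.
(* The same cylinder with the constraint at [i] removed; that constraint moves into the
   integrand. *)
pose S' k := if k == i then setT else S k.
have mS' k : measurable (S' k) by rewrite /S'; case: ifP.
have mE := measurable_cyl_base n mB mS.
have mE' := measurable_cyl_base n mB mS'.
have mI (E : set Omega) : measurable E -> measurable_fun setT (\1_E : Omega -> R) by [].
have mIS (E : set TO) : measurable E -> measurable_fun setT (\1_E : TO -> R) by [].
have I0 (E : set Omega) w : 0 <= \1_E w :> R by [].
have EE' w : \1_(cyl_base n B S) w = \1_(S i) (O i w) * \1_(cyl_base n B S') w :> R.
  rewrite !indicE -natrM mulnb; congr (nat_of_bool _)%:R.
  apply/idP/andP => [|[]]; rewrite !inE /cyl_base.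
    move=> [Bw Sw]; split; first exact: Sw.
    by split => // k kn; rewrite /S' /preimage/=; case: ifP => // _; exact: Sw.
  move=> Siw [Bw Sw]; split => // k kn; have := Sw _ kn.
  by rewrite /S' /preimage/=; case: ifPn => // /eqP ->.
transitivity (\int[Pr]_w (((phi (O i w) * \1_(S i) (O i w)) * \1_(cyl_base n B S') w))%:E)%E.
  rewrite integral_mkcond; apply: eq_integral => w _.
  rewrite -mulrA -EE' patchE indicE; case: ifP; rewrite ?mulr1 ?mulr0//.
rewrite -(integral_density Pr (mI _ mE') (I0 _)); last 2 first.
- by apply: measurable_funM; [exact: measurableT_comp|apply: measurableT_comp (mIS _ (mS i)) (mO i)].
- by move=> w; rewrite mulr_ge0.
have mg : measurable_fun setT (fun o => (phi o * \1_(S i) o)%:E).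
  by apply/measurable_EFinP/measurable_funM.
have g0 o : (0 <= (phi o * \1_(S i) o)%:E)%E by rewrite lee_fin mulr_ge0.
rewrite -(ge0_integral_image_measure _ (mO i) mg g0).
have mc : measurable_fun [set: TO] (fun=> c) by [].
rewrite (@eq_measure_integral _ _ _ _ (density_measure P mc (fun=> c0))); last first.
  move=> D mD _.
  rewrite -[LHS]/(\int[Pr]_(w in O i @^-1` D) (\1_(cyl_base n B S') w)%:E)%E.
  rewrite integral_indic//; last by rewrite -[X in measurable X]setTI; exact: mO.
  rewrite -[RHS]/(\int[P]_(o in D) c%:E)%E integral_cst//.
  pose S'' k := if k == i then D else S k.
  have mS'' k : measurable (S'' k) by rewrite /S''; case: ifP.
  have -> : cyl_base n B S' `&` O i @^-1` D = cyl_base n B S''.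
    rewrite /cyl_base /S' /S''; apply/seteqP; split=> [w [[Bw Sw] Dw]|w [Bw Sw]].
      split => // k kn; have := Sw _ kn; rewrite /preimage/=; case: ifPn => // /eqP ->//.
    split; last by have := Sw _ ltin; rewrite /preimage/= eqxx.
    by split => // k kn; have := Sw _ kn; rewrite /preimage/=; case: ifPn.
  rewrite [LHS]indep// (bigD1 (Ordinal ltin))//= {1}/S'' eqxx.
  rewrite (eq_bigr (fun k : 'I_n => (fine (P (S k)))%:E)); last first.
    move=> k ki; rewrite /S'' ifN ?fineK ?fin_num_measure//.
  rewrite prodEFin muleCA EFinM fineK; last first.
    by apply: fin_num_measure; rewrite -[X in measurable X]setTI; exact: mA.
  by rewrite muleC.
rewrite integral_density//; last exact/measurable_EFinP.
under eq_integral do rewrite mulrC EFinM.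
rewrite ge0_integralZl//; congr (_ * _)%E.
rewrite [RHS]integral_mkcond; apply: eq_integral => o _.
by rewrite patchE indicE; case: ifP; rewrite ?mulr1 ?mulr0.
Qed.

Lemma integral_obs i (phi : TO -> R) : measurable_fun setT phi -> (forall o, 0 <= phi o) ->
  (\int[Pr]_w (phi (O i w))%:E = \int[P]_o (phi o)%:E)%E.
Proof.
move=> mphi phi0.
have := @integral_cyl_base i.+1 i setT (fun=> setT) phi (leqnn _) measurableT
  (fun=> measurableT) mphi phi0.
have -> : cyl_base i.+1 setT (fun=> setT) = setT by apply/seteqP; split.
rewrite preimage_setT probability_setT/= big1 ?mulr1 ?mul1e//.
by move=> k _; rewrite probability_setT.
Qed.

Lemma integrable_obs i (phi : TO -> R) : P.-integrable setT (EFin \o phi) ->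
  Pr.-integrable setT (EFin \o (phi \o O i)).
Proof.
move=> iphi; have mphi : measurable_fun setT phi.
  by apply/measurable_EFinP/(measurable_int P).
apply/integrableP; split; first by apply/measurable_EFinP; exact: measurableT_comp.
have /integrableP[_] := iphi; rewrite /comp /=.
rewrite (@integral_obs i (fun o => `|phi o|))//.
exact: measurableT_comp.
Qed.

Section cyl_integral.
Variables (n i : nat) (C : set (set TO)).
Hypothesis ltin : (i < n)%N.
Hypothesis Cm : C `<=` measurable.
Hypothesis CI : setI_closed C.
Hypothesis CT : C setT.

(** Lifts an identity tested on [C] from one observation to the sample. By the product formula
    [phi (O i)] and [psi (O i)] have the same integrals over cylinders, and the pi-system argument
    then allows any [h] depending on [A], the other observations and the [C]-part of [O i]. *)
Lemma ge0_integral_cyl (phi psi : TO -> R) (g : nat -> set TO) :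
  measurable_fun setT phi -> measurable_fun setT psi ->
  (forall o, 0 <= phi o) -> (forall o, 0 <= psi o) ->
  (forall k, C (g k)) -> \bigcup_k g k = setT ->
  (forall k, \int[P]_(o in g k) (phi o)%:E < +oo)%E ->
  (forall E, C E -> \int[P]_(o in E) (phi o)%:E = \int[P]_(o in E) (psi o)%:E)%E ->
  forall h : Omega -> R, measurable_fun setT (h : g_sigma_algebraType (cyl n i C) -> R) ->
  (forall x, 0 <= h x) ->
  (\int[Pr]_w (h w * phi (O i w))%:E = \int[Pr]_w (h w * psi (O i w))%:E)%E.
Proof.
move=> mphi mpsi phi0 psi0 Cg gT goo CE h mh h0.
pose gO k := cyl_base n setT (fun j => if j == i then g k else setT).
have mS k j : measurable (if j == i then g k else setT).
  by case: ifP => // _; exact: Cm.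
apply: (ge0_integral_pi_system (mu := Pr) (@cyl_measurable n i C) (cyl_setI CI)
   (f1 := phi \o O i) (f2 := psi \o O i) (g := gO)) => //.
- exact: measurableT_comp.
- exact: measurableT_comp.
- by move=> x; exact: phi0.
- by move=> x; exact: psi0.
- by move=> k; exists setT, (fun j => if j == i then g k else setT); rewrite eqxx; split.
- apply/seteqP; split => // w _.
  have : (\bigcup_k g k) (O i w) by rewrite gT.
  move=> [k _ gk]; exists k => //; split => // j jn; rewrite /preimage/=.
  by case: ifPn => // /eqP ->.
- move=> k; rewrite integral_cyl_base// eqxx.
  have := goo k; have : (0 <= \int[P]_(o in g k) (phi o)%:E)%E.
    by apply: integral_ge0 => o _; rewrite lee_fin.
  by case: (integral _ _ _) => // r _ _; rewrite -EFinM ltry.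
- move=> _ [B [S [mB mgk CS ->]]]; rewrite !integral_cyl_base//.
  by rewrite CE.
Qed.

(** The signed case with conditional mean 0. [phi] is split because the product formula is for
    nonnegative integrands; both parts carry the same constant factor, which comes out of the
    difference. *)
Lemma integral0_cyl (phi : TO -> R) : P.-integrable setT (EFin \o phi) ->
  (forall E, C E -> \int[P]_(o in E) (phi o)%:E = 0)%E ->
  forall h : Omega -> R, measurable_fun setT (h : g_sigma_algebraType (cyl n i C) -> R) ->
  Pr.-integrable setT (EFin \o (fun w => h w * phi (O i w))) ->
  (\int[Pr]_w (h w * phi (O i w))%:E = 0)%E.
Proof.
move=> iphi phiE h mh hphi.
have mphi : measurable_fun setT phi by apply/measurable_EFinP/(measurable_int P).
apply: (integral0_pi_system (mu := Pr) (@cyl_measurable n i C) (cyl_setI CI)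
   (f := phi \o O i)) => //; first exact: cyl_setT.
  exact: integrable_obs.
pose pos x := Num.max (phi x) 0.
pose neg x := Num.max (- phi x) 0.
have pn x : phi x = pos x - neg x.
  by rewrite /pos /neg; case: (leP (phi x)); case: (leP (- phi x)) => *; lra.
have pos0 x : 0 <= pos x by rewrite /pos le_max lexx orbT.
have neg0 x : 0 <= neg x by rewrite /neg le_max lexx orbT.
have mpos : measurable_fun setT pos by apply: measurable_maxr.
have mneg : measurable_fun setT neg.
  by apply: measurable_maxr => //; exact: measurableT_comp.
have ip : P.-integrable setT (EFin \o pos).
  apply: (le_integrable measurableT _ _ iphi); first exact/measurable_EFinP.
  move=> x _; rewrite lee_fin; rewrite ger0_norm//.
  by rewrite /pos ge_max ler_norm normr_ge0.
have inn : P.-integrable setT (EFin \o neg).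
  apply: (le_integrable measurableT _ _ iphi); first exact/measurable_EFinP.
  move=> x _; rewrite lee_fin; rewrite ger0_norm//.
  by rewrite /neg ge_max -normrN ler_norm normr_ge0.
move=> _ [B [S [mB mS CS ->]]].
have mE := measurable_cyl_base n mB mS.
under eq_integral => w _ do rewrite /= pn.
rewrite (integralB_EFin mE); last 2 first.
- by apply: (integrableS measurableT) => //; exact: (integrable_obs i ip).
- by apply: (integrableS measurableT) => //; exact: (integrable_obs i inn).
rewrite !integral_cyl_base//.
have ipS : P.-integrable (S i) (EFin \o pos) by exact: integrableS ip.
have inS : P.-integrable (S i) (EFin \o neg) by exact: integrableS inn.
have := phiE _ CS; under eq_integral => o _ do rewrite pn.
rewrite (integralB_EFin (mS i) ipS inS).
have /fineK <- := integrable_fin_num (mS i) ipS.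
have /fineK <- := integrable_fin_num (mS i) inS.
by rewrite -!EFinM -!EFinB -mulrBr => -[->]; rewrite mulr0.
Qed.

(** With the next two lemmas, the list of what a test function [h] may depend on: the auxiliary
    data, the observations at other places, and functions of [O i] whose preimages lie in [C]. *)
Lemma measurable_cyl_ctx d' (U : measurableType d') (u : TA -> U) : measurable_fun setT u ->
  measurable_fun setT ((u \o A) : g_sigma_algebraType (cyl n i C) -> U).
Proof.
move=> mu _ D mD; rewrite setTI comp_preimage; apply: sub_sigma_algebra.
exists (u @^-1` D), (fun=> setT); split => //.
  by rewrite -[X in measurable X]setTI; exact: mu.
by rewrite /cyl_base; apply/seteqP; split => [w Dw|w []].
Qed.

Lemma measurable_cyl_other d' (U : measurableType d') (u : TO -> U) k :
  (k < n)%N -> k != i -> measurable_fun setT u ->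
  measurable_fun setT ((u \o O k) : g_sigma_algebraType (cyl n i C) -> U).
Proof.
move=> kn ki mu _ D mD; rewrite setTI comp_preimage; apply: sub_sigma_algebra.
exists setT, (fun j => if j == k then u @^-1` D else setT); split => //.
- by move=> j; case: ifP => // _; rewrite -[X in measurable X]setTI; exact: mu.
- by rewrite eq_sym ifN.
rewrite /cyl_base; apply/seteqP; split => [w Dw|w [_ /(_ _ kn)]].
  by split => // j jn; rewrite /preimage/=; case: ifP => // /eqP ->.
by rewrite /preimage/= eqxx.
Qed.

Lemma measurable_cyl_this d' (U : measurableType d') (u : TO -> U) :
  (forall D, measurable D -> C (u @^-1` D)) ->
  measurable_fun setT ((u \o O i) : g_sigma_algebraType (cyl n i C) -> U).
Proof.
move=> mu _ D mD; rewrite setTI comp_preimage; apply: sub_sigma_algebra.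
exists setT, (fun j => if j == i then u @^-1` D else setT); split => //.
- by move=> j; case: ifP => // _; apply/Cm/mu.
- by rewrite eqxx; exact: mu.
rewrite /cyl_base; apply/seteqP; split => [w Dw|w [_ /(_ _ ltin)]].
  by split => // j jn; rewrite /preimage/=; case: ifP => // /eqP ->.
by rewrite /preimage/= eqxx.
Qed.

End cyl_integral.

(** [V] sees nothing of [O k], so their joint law is a product measure and Tonelli's theorem
    applies. The product structure is checked on rectangles, where it is the cylinder identity for
    the indicator of [E] and the constant [P E]. *)
Lemma ge0_integral_past k d' (TV : measurableType d') (V : Omega -> TV)
    (F : TV * TO -> R) :
  measurable_fun setT (V : g_sigma_algebraType (cyl k.+1 k [set setT]) -> TV) ->
  measurable_fun setT F -> (forall x, 0 <= F x) ->
  (\int[Pr]_w (F (V w, O k w))%:E = \int[Pr]_w \int[P]_o (F (V w, o))%:E)%E.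
Proof.
move=> mV mF F0.
have Cm : [set setT] `<=` (measurable : set (set TO)) by move=> _ ->.
have CI : setI_closed [set (setT : set TO)] by move=> _ _ -> ->; rewrite /= setIT.
have mV' : measurable_fun setT V.
  exact: (measurable_fun_g_sigma (@cyl_measurable k.+1 k [set setT]) mV).
pose V' : {RV Pr >-> TV} := HB.pack V (isMeasurableFun.Build _ _ _ _ V mV').
have mVO : measurable_fun setT (fun w => (V w, O k w)).
  exact: measurable_fun_pair.
have mFE : measurable_fun setT (EFin \o F) by exact/measurable_EFinP.
have F0E x : (0 <= (EFin \o F) x)%E by rewrite lee_fin.
rewrite -[LHS](ge0_integral_image_measure Pr mVO mFE F0E).
rewrite (@eq_measure_integral _ _ _ _ (distribution Pr V' \x P)%E); last first.
  move=> D mD _; symmetry.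
  apply: (product_measure_unique (m1 := distribution Pr V') (m2 := P)) => // B E mB mE.
  rewrite image_measureE.
  rewrite (_ : _ @^-1` (B `*` E) = V @^-1` B `&` O k @^-1` E)//.
  have mVB : measurable (V @^-1` B).
    by rewrite -[X in measurable X]setTI; exact (mV' measurableT B mB).
  have mOE : measurable (O k @^-1` E).
    by rewrite -[X in measurable X]setTI; exact: mO.
  have h : measurable_fun setT ((\1_(V @^-1` B) : Omega -> R) :
      g_sigma_algebraType (cyl k.+1 k [set setT]) -> R).
    by apply: measurable_indic; have := mV measurableT B mB; rewrite setTI.
  have mIE : measurable_fun setT (\1_E : TO -> R) by [].
  have := @ge0_integral_cyl k.+1 k [set setT] (leqnn _) Cm CI
    (\1_E) (cst (fine (P E))) (fun=> setT)
    mIE (measurable_cst _) _ _ _ _ _ _ _ h _.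
  rewrite (_ : (\int[Pr]_w (\1_(V @^-1` B) w * \1_E (O k w))%:E)%E =
      Pr (V @^-1` B `&` O k @^-1` E)); last first.
    transitivity (\int[Pr]_w (\1_(V @^-1` B `&` O k @^-1` E) w)%:E)%E.
      by apply: eq_integral => w _; rewrite indicI.
    by rewrite integral_indic ?setIT//; exact: measurableI.
  move=> H; etransitivity; first apply: H; last first.
  - under eq_integral do rewrite mulrC EFinM /=.
    rewrite ge0_integralZl//; last by rewrite lee_fin fine_ge0.
      by rewrite integral_indic// setIT fineK ?fin_num_measure// muleC.
    exact/measurable_EFinP.
  - by [].
  - move=> _ ->; rewrite integral_indic// setIT.
    rewrite -[RHS]/(\int[P]_(o in setT) (fine (P E))%:E)%E integral_cst//.
    transitivity ((fine (P E))%:E * 1)%E; first by rewrite mule1 fineK// fin_num_measure.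
    by congr (_ * _)%E; exact/esym/probability_setT.
  - move=> _; rewrite integral_indic// (le_lt_trans (probability_le1 _ _)) ?ltry//.
    exact: measurableI.
  - by rewrite bigcup_const.
  - by [].
  - by move=> o /=; exact: fine_ge0.
  - by [].
rewrite (fubini_tonelli1 (m1 := distribution Pr V') (m2 := P))//.
rewrite (@ge0_integral_distribution _ _ _ _ _ Pr V')//.
  exact: measurable_fun_fubini_tonelli_F.
by move=> v; apply: integral_ge0 => o _; rewrite lee_fin.
Qed.

End iid.

(** * The standard normal law *)

Section standard_normal.
Context {R : realType}.
Notation mu := (@lebesgue_measure R).

Local Notation phi := (normal_pdf (0 : R) 1).
Local Notation gamma := (normal_prob (0 : R) 1).
Local Notation peak := (normal_peak (1 : R)).

Lemma std_pdfE x : phi x = peak * expR (- (x ^+ 2 / 2)).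
Proof.
by rewrite normal_pdfE ?oner_neq0// /normal_fun subr0 expr1n mulNr.
Qed.

Lemma std_pdf_gt0 x : 0 < phi x.
Proof. by rewrite std_pdfE mulr_gt0 ?expR_gt0 ?normal_peak_gt0 ?oner_neq0. Qed.

Lemma mul_std_pdf_ge0 x : 0 <= x -> 0 <= x * phi x.
Proof. by move=> x0; exact/mulr_ge0/ltW/std_pdf_gt0. Qed.

Lemma std_pdf_even x : phi (- x) = phi x.
Proof. by rewrite !std_pdfE sqrrN. Qed.

Let mphi : measurable_fun setT phi. Proof. exact: measurable_normal_pdf. Qed.

Lemma ge0_integral_std_normal (f : R -> R) : measurable_fun setT f -> (forall x, 0 <= f x) ->
  (\int[gamma]_x (f x)%:E = \int[mu]_x (f x * phi x)%:E)%E.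
Proof.
move=> mf f0; rewrite -(integral_density mu mphi (fun x => ltW (std_pdf_gt0 x)) mf f0).
by apply: eq_measure_integral.
Qed.

Lemma is_derive_std_pdf (x : R) : is_derive x 1 phi (- (x * phi x)).
Proof.
rewrite (_ : phi = fun x => peak * expR (- (x ^+ 2 / 2))); last exact/funext/std_pdfE.
by apply: is_derive_eq; rewrite /GRing.scale/=; field.
Qed.

Lemma cvg_std_pdf : phi x @[x --> +oo] --> (0 : R).
Proof.
rewrite (_ : phi = fun x => peak * expR (- (x ^+ 2 / 2))); last exact/funext/std_pdfE.
rewrite -[X in _ --> X](mulr0 peak); apply: cvgMr.
apply: (cvg_comp (fun x : R => x ^+ 2 / 2) (fun x => expR (- x))); last exact: cvgr_expR.
apply: gt0_cvgMly; first by rewrite invr_gt0.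
exact: cvgr_expr2.
Qed.

(** An antiderivative of [x * phi x] is [- phi], which vanishes at infinity. *)
Lemma integral_tail_std_pdf (t : R) : 0 <= t ->
  (\int[mu]_(x in `[t, +oo[) (x * phi x)%:E = (phi t)%:E)%E.
Proof.
move=> t0.
have cphi : continuous phi by apply: continuous_normal_pdf; exact: oner_neq0.
rewrite (@ge0_continuous_FTC2y _ _ (fun x => - phi x) t 0).
- by rewrite EFinN oppeK add0e.
- by move=> x tx; apply: mulr_ge0; [exact: le_trans tx|exact/ltW/std_pdf_gt0].
- by apply: continuous_subspaceT => x; apply: cvgM => //; exact: cphi.
- by rewrite -[X in _ --> X]oppr0; apply: cvgN; exact: cvg_std_pdf.
- move=> x _; have [dphi _] := is_derive_std_pdf x.
  exact: derivableN.
- by apply: cvgN; apply: cvg_at_right_filter; exact: cphi.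
- move=> x _; rewrite derive1E.
  have dphi := is_derive_std_pdf x.
  by rewrite deriveN ?derive_val ?opprK.
Qed.

(* [K x] is the integral of [k] over [0, x]; exchanging the integrals turns [K x * (x * phi x)]
   into [k t * phi t], because [x * phi x] integrates to [phi t] over [t, +oo[. *)
Lemma integral_layer_std_pdf (k K : R -> R) :
  measurable_fun setT k -> measurable_fun setT K -> (forall t, 0 <= k t) ->
  (forall x, 0 <= x -> (\int[mu]_(t in `[0%R, x]) (k t)%:E = (K x)%:E)%E) ->
  (\int[mu]_(x in `[0%R, +oo[) (K x * (x * phi x))%:E =
   \int[mu]_(t in `[0%R, +oo[) (k t * phi t)%:E)%E.
Proof.
move=> mk mK k0 kK.
pose f (p : R * R) := (if (0 <= p.1) && (p.1 <= p.2) then k p.1 * (p.2 * phi p.2) else 0)%:E.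
have mf : measurable_fun setT f.
  apply/measurable_EFinP; apply: measurable_fun_ifT => //.
    apply: measurable_and; exact: measurable_fun_ler.
  apply: measurable_funM; first exact: measurableT_comp.
  by apply: measurable_funM => //; apply: measurableT_comp.
have f0 p : (0 <= f p)%E.
  rewrite /f; case: ifPn => // /andP[p0 p12]; rewrite lee_fin mulr_ge0//.
  exact/mul_std_pdf_ge0/(le_trans p0).
have intk : (\int[mu]_x \int[mu]_y f (x, y) = \int[mu]_(t in `[0%R, +oo[) (k t * phi t)%:E)%E.
  rewrite [RHS]integral_mkcond; apply: eq_integral => t _.
  rewrite patchE mem_setE in_itv/= andbT; case: ifPn => t0; last first.
    by rewrite integral0_eq// => x _; rewrite /f/= (negbTE t0).
  rewrite EFinM -integral_tail_std_pdf// -ge0_integralZl//; last 3 first.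
  - by apply/measurable_EFinP/measurable_funTS/measurable_funM.
  - move=> x/=; rewrite in_itv/= andbT => tx.
    by rewrite lee_fin; exact/mul_std_pdf_ge0/(le_trans t0).
  - by rewrite lee_fin.
  rewrite [RHS]integral_mkcond; apply: eq_integral => x _.
  by rewrite patchE mem_setE in_itv/= andbT /f/= t0/=; case: ifP.
rewrite -intk (fubini_tonelli (m1 := mu) (m2 := mu) f mf f0) integral_mkcond; apply: eq_integral => x _.
rewrite patchE mem_setE in_itv/= andbT; case: ifPn => x0; last first.
  rewrite integral0_eq// => t _; rewrite /f/=; case: ifPn => // /andP[t0 tx].
  by rewrite (le_trans t0 tx) in x0.
rewrite EFinM -kK// -ge0_integralZr//; last 3 first.
- exact/measurable_EFinP/measurable_funTS.
- by move=> t _; rewrite lee_fin.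
- by rewrite lee_fin; exact: mul_std_pdf_ge0.
rewrite integral_mkcond; apply: eq_integral => t _.
by rewrite patchE mem_setE in_itv/= /f/=; case: ifP.
Qed.

Let cphi : continuous phi.
Proof. by apply: continuous_normal_pdf; exact: oner_neq0. Qed.

Lemma integral_half_std_pdf : (\int[mu]_(x in `[0%R, +oo[) (phi x)%:E = 2^-1%:E)%E.
Proof.
have := @integral_normal_pdf R 0 1; rewrite ge0_symfun_integralT//; last 2 first.
- by move=> x; exact/ltW/std_pdf_gt0.
- by move=> x; rewrite /= std_pdf_even.
rewrite -set_itvcy.
have : (0 <= \int[mu]_(x in `[0%R, +oo[) (phi x)%:E)%E.
  by apply: integral_ge0 => x _; rewrite lee_fin; exact/ltW/std_pdf_gt0.
case: (integral _ _ _) => //= [r _|_].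
  by rewrite -EFinM => -[r2]; congr EFin; lra.
by rewrite mulry gtr0_sg// mul1e.
Qed.

Lemma integral_std_normal_even (f : R -> R) : continuous f -> (forall x, 0 <= f x) ->
  (forall x, f (- x) = f x) ->
  (\int[gamma]_x (f x)%:E = 2%:E * \int[mu]_(x in `[0%R, +oo[) (f x * phi x)%:E)%E.
Proof.
move=> cf f0 fe; rewrite ge0_integral_std_normal//; last exact: continuous_measurable_fun.
rewrite ge0_symfun_integralT//.
- by rewrite -set_itvcy.
- by move=> x; rewrite mulr_ge0//; exact/ltW/std_pdf_gt0.
- by move=> x; apply: cvgM; [exact: cf|exact: cphi].
- by move=> x; rewrite /= std_pdf_even fe.
Qed.

Lemma integral_std_normal_abs : (\int[gamma]_x (`|x|)%:E = (2 * phi 0)%:E)%E.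
Proof.
rewrite integral_std_normal_even//; last 2 first.
- by move=> x; exact: norm_continuous.
- by move=> x; rewrite normrN.
rewrite EFinM -integral_tail_std_pdf//; congr (_ * _)%E.
apply: eq_integral => x; rewrite inE/= in_itv/= andbT => x0.
by rewrite ger0_norm.
Qed.

Lemma integral_std_normal_sqr : (\int[gamma]_x (x ^+ 2)%:E = 1)%E.
Proof.
rewrite integral_std_normal_even//; last 3 first.
- exact: exprn_continuous.
- by move=> x; exact: sqr_ge0.
- by move=> x; rewrite sqrrN.
under eq_integral => x _ do rewrite expr2 -mulrA.
rewrite (@integral_layer_std_pdf (fun=> 1) id)//.
  under eq_integral => x _ do rewrite mul1r.
  by rewrite integral_half_std_pdf -EFinM divff.
move=> x x0; rewrite integral_cst//= mul1e.
by rewrite lebesgue_measure_itv/= lte_fin lt_def x0 andbT; case: eqVneq => [->|]//=; rewrite ?oppr0 ?adde0.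
Qed.

(** One factor of the cube is kept in [x * phi x], so the layer formula applies to [K x = x ^+ 2],
    with density [2 * t]; the tail formula at 0 ends the computation. The value enters the Lindeberg
    bound as the Taylor remainder of the Gaussian increments. *)
Lemma integral_std_normal_cube : (\int[gamma]_x (`|x| ^+ 3)%:E = (4 * phi 0)%:E)%E.
Proof.
rewrite integral_std_normal_even//; last 2 first.
- move=> x; apply: (@continuous_comp _ _ _ (fun z : R => `|z|) (fun z => z ^+ 3)).
    exact: norm_continuous.
  exact: exprn_continuous.
- by move=> x; rewrite normrN.
have -> : (4 * phi 0)%:E = (2%:E * (2%:E * (phi 0)%:E))%E by rewrite -!EFinM; congr EFin; ring.
congr (_ * _)%E.
rewrite -integral_tail_std_pdf// -ge0_integralZl//; last 2 first.
- by apply/measurable_EFinP/measurable_funTS/measurable_funM.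
- move=> x/=; rewrite in_itv/= andbT => x0.
  by rewrite lee_fin; exact: mul_std_pdf_ge0.
transitivity (\int[mu]_(x in `[0%R, +oo[) (x ^+ 2 * (x * phi x))%:E)%E.
  apply: eq_integral => x; rewrite inE/= in_itv/= andbT => x0.
  by rewrite ger0_norm// exprSr mulrA.
(* The absolute value makes the density nonnegative on the whole line, as the layer formula asks; on
   the half-line it changes nothing. *)
rewrite (@integral_layer_std_pdf (fun t => 2 * `|t|) (fun x => x ^+ 2))//.
- apply: eq_integral => x; rewrite inE/= in_itv/= andbT => x0.
  by rewrite ger0_norm// -EFinM mulrA.
- by apply: measurable_funM => //; exact: measurableT_comp.
- move=> x; rewrite le_eqVlt => /predU1P[<-|x0].
    by rewrite set_itv1 integral_set1 expr0n.
  transitivity (\int[mu]_(t in `[0%R, x]) (2 * t)%:E)%E.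
    apply: eq_integral => t; rewrite inE/= in_itv/= => /andP[t0 _].
    by rewrite ger0_norm.
  rewrite (@continuous_FTC2 _ _ (fun t => t ^+ 2))//.
  + by rewrite expr0n/= sube0.
  + by apply: continuous_subspaceT => t; apply: cvgM => //; exact: cvg_cst.
  + split.
    * by move=> t _; exact: exprn_derivable.
    * by apply: cvg_at_right_filter; exact: exprn_continuous.
    * by apply: cvg_at_left_filter; exact: exprn_continuous.
  + by move=> t _; rewrite derive1E exp_derive expr1 /GRing.scale/= mulr1.
Qed.

End standard_normal.

Section standard_normal2.
Context {R : realType}.
Notation mu := (@lebesgue_measure R).

Local Notation phi := (normal_pdf (0 : R) 1).
Local Notation gamma := (normal_prob (0 : R) 1).
Local Notation peak := (normal_peak (1 : R)).

Let mphi : measurable_fun setT phi. Proof. exact: measurable_normal_pdf. Qed.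
Let cphi : continuous phi.
Proof. by apply: continuous_normal_pdf; exact: oner_neq0. Qed.

Lemma integrable_std_normal_id : gamma.-integrable setT (fun x : R => x%:E).
Proof.
apply/integrableP; split; first exact/measurable_EFinP.
by rewrite [ltLHS]integral_std_normal_abs ltry.
Qed.

Lemma integral_std_normal_id : (\int[gamma]_x x%:E = 0)%E.
Proof.
have mpos : measurable_fun setT (fun x : R => Num.max x 0) by exact: measurable_maxr.
have Epos : (\int[gamma]_x (Num.max x 0)%:E = (phi 0)%:E)%E.
  rewrite ge0_integral_std_normal//; last by move=> x; rewrite le_max lexx orbT.
  rewrite -integral_tail_std_pdf// [RHS]integral_mkcond.
  apply: eq_integral => x _; rewrite patchE mem_setE in_itv/= andbT.
  by case: ifPn => [x0|]; [rewrite max_l|rewrite -ltNge => /ltW x0; rewrite max_r// mul0r].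
have ipos : gamma.-integrable setT (fun x => (Num.max x 0)%:E).
  apply/integrableP; split; first exact/measurable_EFinP.
  under eq_integral => x _ do rewrite /= ger0_norm ?le_max ?lexx ?orbT//.
  by rewrite Epos ltry.
have iabs : gamma.-integrable setT (fun x => (`|x|)%:E).
  apply/integrableP; split; first by apply/measurable_EFinP; exact: normr_measurable.
  under eq_integral => x _ do rewrite /= normr_id.
  by rewrite integral_std_normal_abs ltry.
(* x = 2 max(x, 0) - |x|, and both 2 max(x, 0) and |x| have integral [2 * phi 0]. *)
transitivity (\int[gamma]_x ((Num.max x 0)%:E + ((Num.max x 0)%:E - (`|x|)%:E)))%E.
  apply: eq_integral => x _; rewrite -EFinB -EFinD; congr EFin.
  by case: (leP x 0) => x0; [rewrite ler0_norm//; lra|rewrite ger0_norm ?ltW//; lra].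
rewrite integralD//; last exact: integrableB.
rewrite integralB// Epos integral_std_normal_abs -EFinB -EFinD.
by congr EFin; ring.
Qed.

Lemma ge0_integral_affine (G : R -> R) (k m : R) : 0 < k ->
  continuous G -> (forall x, 0 <= G x) ->
  (\int[mu]_x (G (k * x + m) * k)%:E = \int[mu]_x (G x)%:E)%E.
Proof.
move=> k0 cG G0.
pose F (x : R) := k * x + m.
have dF (x : R) : is_derive x 1 F k.
  by apply: is_derive_eq; rewrite /GRing.scale/=; ring.
have F'E : F^`()%classic = cst k.
  by apply/funext => x; rewrite derive1E derive_val.
rewrite (increasing_ge0_integration_by_substitutionT (F := F))//.
- by apply: eq_integral => x _; rewrite F'E.
- by move=> x y xy; rewrite ltrD2r ltr_pM2l.
- by rewrite F'E => x; exact: cvg_cst.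
- by rewrite F'E; exact: is_cvg_cst.
- by rewrite F'E; exact: is_cvg_cst.
- apply: (cvg_comp (fun x => k * x) (fun x => x + m)); last exact: cvg_addrr_Ny.
  by apply/gt0_cvgMrNy.
- apply: (cvg_comp (fun x => k * x) (fun x => x + m)); last exact: cvg_addrr.
  by apply/gt0_cvgMry.
Qed.

(** The law of a sum of independent centred normals. The inner variable is changed to z = (a x + b
    y) / c with c^2 = a^2 + b^2 and the order of integration is exchanged; for fixed z, the
    remaining integrand in x is a multiple of a normal density of mass 1. *)
Lemma integral_std_normal_conv (h : R -> R) (a b s : R) : 0 < a -> 0 < b ->
  continuous h -> (forall x, 0 <= h x) ->
  (\int[gamma]_x \int[gamma]_y (h (s + a * x + b * y))%:E =
   \int[gamma]_z (h (s + Num.sqrt (a ^+ 2 + b ^+ 2) * z))%:E)%E.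
Proof.
move=> a0 b0 ch h0.
set c := Num.sqrt _.
have c0 : 0 < c by rewrite sqrtr_gt0 addr_gt0// exprn_gt0.
have c2 : c ^+ 2 = a ^+ 2 + b ^+ 2 by rewrite sqr_sqrtr// addr_ge0 ?sqr_ge0.
have phi0 x : 0 <= phi x by exact/ltW/std_pdf_gt0.
have ccomp (f g : R -> R) : continuous f -> continuous g -> continuous (f \o g).
  by move=> cf cg x; apply: continuous_comp; [exact: cg|exact: cf].
have caff (u v : R) : continuous (fun x : R => u * x + v).
  by move=> x; apply: cvgD; [apply: cvgM => //; exact: cvg_cst|exact: cvg_cst].
have mh (u v : R) : measurable_fun setT (fun x => h (u + v * x)).
  apply: continuous_measurable_fun; rewrite (_ : (fun x => _) = h \o (fun x => v * x + u)).
    exact: ccomp.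
  by apply/funext => x /=; rewrite addrC.
have inner x : (\int[gamma]_y (h (s + a * x + b * y))%:E =
    \int[mu]_z (h (s + c * z) * (phi ((c * z - a * x) / b) * (c / b)))%:E)%E.
  rewrite ge0_integral_std_normal//.
  rewrite -(@ge0_integral_affine (fun y => h (s + a * x + b * y) * phi y) (c / b) (- (a * x / b))).
  - apply: eq_integral => z _; congr EFin.
    rewrite (_ : s + a * x + b * (c / b * z + - (a * x / b)) = s + c * z); last first.
      by field; exact: lt0r_neq0.
    rewrite (_ : c / b * z + - (a * x / b) = (c * z - a * x) / b); last first.
      by field; exact: lt0r_neq0.
    by ring.
  - by rewrite divr_gt0.
  - have chy : continuous (fun y => h (s + a * x + b * y)).
      rewrite (_ : (fun y => _) = h \o (fun y => b * y + (s + a * x))).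
        exact: (ccomp _ _ ch (caff _ _)).
      by apply/funext => t /=; rewrite addrC.
    by move=> y; apply: cvgM; [exact: chy|exact: cphi].
  - by move=> y; rewrite mulr_ge0.
under eq_integral => x _ do rewrite inner.
pose f (p : R * R) := (h (s + c * p.2) * (phi ((c * p.2 - a * p.1) / b) * (c / b)))%:E.
have mf : measurable_fun setT f.
  apply/measurable_EFinP; apply: measurable_funM.
    exact: (measurableT_comp (mh s c)).
  apply: measurable_funM => //; apply: measurableT_comp => //.
  by apply: measurable_funM => //; apply: measurable_funB; exact: measurable_funM.
have cb0 : 0 < c / b by rewrite divr_gt0.
have f0 p : (0 <= f p)%E.
  by rewrite lee_fin mulr_ge0// mulr_ge0// ltW.
rewrite (fubini_tonelli (m1 := gamma) (m2 := mu) f mf f0).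
rewrite [RHS]ge0_integral_std_normal//.
apply: eq_integral => z _.
have mg : measurable_fun setT
    (fun x => h (s + c * z) * (phi ((c * z - a * x) / b) * (c / b))).
  apply: measurable_funM => //; apply: measurable_funM => //; apply: measurableT_comp => //.
  by apply: measurable_funM => //; apply: measurable_funB => //; exact: measurable_funM.
have g0 x : 0 <= h (s + c * z) * (phi ((c * z - a * x) / b) * (c / b)).
  by rewrite mulr_ge0// mulr_ge0// ltW.
rewrite /f/= (ge0_integral_std_normal mg g0).
transitivity (\int[mu]_x ((h (s + c * z) * phi z)%:E *
    (phi (c / b * x + - (a * z / b)) * (c / b))%:E))%E; last first.
  rewrite ge0_integralZl//; last 3 first.
  - apply/measurable_EFinP; apply: measurable_funM => //; apply: measurableT_comp => //.
    by apply: measurable_funD => //; exact: measurable_funM.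
  - by move=> x _; rewrite lee_fin mulr_ge0// ltW.
  - by rewrite lee_fin mulr_ge0.
  by rewrite (ge0_integral_affine _ cb0 cphi phi0) integral_normal_pdf mule1.
apply: eq_integral => x _; rewrite -EFinM /f/=; congr EFin.
(* Invariance of the two-dimensional normal density under an orthogonal map: the quadratic exponents
   agree because b^2 = c^2 - a^2. *)
suff key : phi ((c * z - a * x) / b) * phi x = phi z * phi (c / b * x + - (a * z / b)).
  have E (h1 p1 p2 p3 p4 k : R) : p1 * p2 = p3 * p4 -> h1 * (p1 * k) * p2 = h1 * p3 * (p4 * k).
    by move=> E; rewrite mulrA mulrAC -[h1 * p1 * p2]mulrA E; ring.
  exact: E.
rewrite !std_pdfE.
rewrite mulrACA -expRD [RHS]mulrACA -expRD; congr (_ * expR _).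
have -> : c / b * x + - (a * z / b) = (c * x - a * z) / b.
  by field; exact: lt0r_neq0.
suff H : ((c * z - a * x) / b) ^+ 2 + x ^+ 2 = z ^+ 2 + ((c * x - a * z) / b) ^+ 2 by lra.
have b20 : b ^+ 2 != 0 by rewrite expf_neq0// lt0r_neq0.
rewrite !expr_div_n; apply: (mulIf b20); rewrite !mulrDl !divfK//.
have -> : b ^+ 2 = c ^+ 2 - a ^+ 2 by rewrite c2; ring.
ring.
Qed.

Lemma PhiE (t : R) : gamma `]-oo, t] = (Phi t)%:E.
Proof. by rewrite /Phi fineK// fin_num_measure. Qed.

Lemma Phi_bound (t : R) : 0 <= Phi t <= 1.
Proof. by rewrite -!lee_fin -PhiE measure_ge0 probability_le1. Qed.

(** The density never exceeds its peak. This is how every shift of the threshold, by smoothing or by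
    an approximation error, is paid for. *)
Lemma Phi_lipschitz (t e : R) : 0 <= e -> Phi (t + e) <= Phi t + peak * e.
Proof.
move=> e0; rewrite -lee_fin EFinD -!PhiE.
rewrite (_ : `]-oo, (t + e)%R]%classic = `]-oo, t]%classic `|` `]t, (t + e)%R]%classic); last first.
  apply/seteqP; split => x /=; rewrite !in_itv/=.
    by move=> xte; case: (leP x t) => xt; [left|right].
  by move=> [xt|/andP[]//]; rewrite (le_trans xt)// lerDl.
apply: (le_trans (measureU2 _ _ _)) => //.
rewrite leeD2l// /normal_prob.
apply: (@le_trans _ _ (\int[mu]_(x in `]t, (t + e)%R]) peak%:E)%E).
  apply: ge0_le_integral => //.
  - by move=> x _; rewrite lee_fin normal_pdf_ge0.
  - exact/measurable_EFinP/measurable_funTS.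
  - by move=> x _; rewrite lee_fin normal_pdf_ub// oner_neq0.
rewrite integral_cst//= lebesgue_measure_itv/= lte_fin.
case: ifPn => _; first by rewrite -EFinB -EFinM lee_fin (addrC t) addrK.
by rewrite mule0 lee_fin mulr_ge0 ?normal_peak_ge0.
Qed.

End standard_normal2.

(** * Lindeberg's replacement method *)

Section smooth_step.
Context {R : realType}.
Implicit Types x y t : R.

(** The next two functions are its first and second derivatives; they are tied to it by the Taylor
    inequality alone. *)
Definition pos_cube x := Num.max x 0 ^+ 3.
Definition pos_cube1 x := 3 * Num.max x 0 ^+ 2.
Definition pos_cube2 x := 6 * Num.max x 0.

Lemma pos_cube_taylor x y :
  `|pos_cube (x + y) - pos_cube x - pos_cube1 x * y - pos_cube2 x / 2 * y ^+ 2|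
    <= `|y| ^+ 3.
Proof.
rewrite /pos_cube /pos_cube1 /pos_cube2.
case: (leP (x + y) 0) => xy; case: (leP x 0) => x0.
- by rewrite !(expr0n, mulr0, mul0r, subrr, subr0, normr0)/= exprn_ge0.
- have -> : 0 ^+ 3 - x ^+ 3 - 3 * x ^+ 2 * y - 6 * x / 2 * y ^+ 2 = y ^+ 3 - (x + y) ^+ 3 by field.
  have y0 : y <= 0 by lra.
  rewrite (ler0_norm y0) ler_norml.
  have h1 : 0 <= - (x + y) by lra.
  have h2 : - (x + y) <= - y by lra.
  have : (- (x + y)) ^+ 3 <= (- y) ^+ 3 by apply: lerXn2r; rewrite ?nnegrE//; lra.
  have : 0 <= (- (x + y)) ^+ 3 by exact: exprn_ge0.
  have E (u : R) : (- u) ^+ 3 = - u ^+ 3 by ring.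
  by rewrite !E => *; apply/andP; split; lra.
- rewrite !(expr0n, mulr0, mul0r, subr0)/=.
  have y0 : 0 <= y by lra.
  rewrite !ger0_norm ?exprn_ge0//; last by lra.
  by apply: lerXn2r; rewrite ?nnegrE; lra.
- have -> : (x + y) ^+ 3 - x ^+ 3 - 3 * x ^+ 2 * y - 6 * x / 2 * y ^+ 2 = y ^+ 3 by field.
  by rewrite normrX.
Qed.

(** Third difference of the truncated cube divided by 3!: the distribution function of a sum of
    three independent uniform variables on [0, 1]. It is a C^2 spline with Lipschitz second
    derivative, which is the regularity behind a cubic Taylor remainder. *)
Definition smooth_step x :=
  (pos_cube x - 3 * pos_cube (x - 1) + 3 * pos_cube (x - 2) - pos_cube (x - 3)) / 6.
Definition smooth_step1 x :=
  (pos_cube1 x - 3 * pos_cube1 (x - 1) + 3 * pos_cube1 (x - 2) - pos_cube1 (x - 3)) / 6.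
Definition smooth_step2 x :=
  (pos_cube2 x - 3 * pos_cube2 (x - 1) + 3 * pos_cube2 (x - 2) - pos_cube2 (x - 3)) / 6.

(** The remainders of the four shifted cubes carry the weights 1, 3, 3, 1 over 6, a total of 8/6,
    rounded up to 2. *)
Lemma smooth_step_taylor x y :
  `|smooth_step (x + y) - smooth_step x - smooth_step1 x * y - smooth_step2 x / 2 * y ^+ 2|
    <= 2 * `|y| ^+ 3.
Proof.
pose r x := pos_cube (x + y) - pos_cube x - pos_cube1 x * y - pos_cube2 x / 2 * y ^+ 2.
have -> : smooth_step (x + y) - smooth_step x - smooth_step1 x * y - smooth_step2 x / 2 * y ^+ 2
  = (r x - 3 * r (x - 1) + 3 * r (x - 2) - r (x - 3)) / 6.
  rewrite /smooth_step /smooth_step1 /smooth_step2 /r.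
  rewrite (addrAC x y (- 1)) (addrAC x y (- 2)) (addrAC x y (- 3)); by field.
have y3 : 0 <= `|y| ^+ 3 by rewrite exprn_ge0.
have := pos_cube_taylor x y; have := pos_cube_taylor (x - 1) y.
have := pos_cube_taylor (x - 2) y; have := pos_cube_taylor (x - 3) y.
rewrite -!/(r _) !ler_norml => /andP[? ?] /andP[? ?] /andP[? ?] /andP[? ?].
by apply/andP; split; lra.
Qed.

Lemma smooth_step_le0 x : x <= 0 -> smooth_step x = 0.
Proof.
move=> x0; rewrite /smooth_step /pos_cube !max_r; lra.
Qed.

Lemma smooth_step_ge3 x : 3 <= x -> smooth_step x = 1.
Proof.
by move=> x3; rewrite /smooth_step /pos_cube !max_l; lra.
Qed.

Lemma smooth_step_bound x : 0 <= smooth_step x <= 1.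
Proof.
have cube (u : R) : 0 <= u -> u <= 1 -> [/\ 0 <= u ^+ 3, u ^+ 3 <= u ^+ 2 & u ^+ 2 <= u].
  by move=> u0 u1; split; [exact: exprn_ge0|exact: ler_wiXn2l|rewrite -[leRHS]expr1; exact: ler_wiXn2l].
case: (leP x 0) => x0; first by rewrite smooth_step_le0// lexx ler01.
case: (leP 3 x) => x3; first by rewrite smooth_step_ge3// lexx ler01.
rewrite /smooth_step /pos_cube (max_l (ltW x0)) (@max_r _ _ (x - 3)); last lra.
case: (leP (x - 1) 0) => x1.
  rewrite max_r; last lra.
  by case: (cube x) => //; lra.
case: (leP (x - 2) 0) => x2.
  have -> : x ^+ 3 = 1 + 3 * (x - 1) + 3 * (x - 1) ^+ 2 + (x - 1) ^+ 3 by ring.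
  have : 0 <= (1 - (x - 1)) ^+ 2 * (1 + 2 * (x - 1)) by rewrite mulr_ge0 ?sqr_ge0//; lra.
  have -> : (1 - (x - 1)) ^+ 2 * (1 + 2 * (x - 1)) = 1 - 3 * (x - 1) ^+ 2 + 2 * (x - 1) ^+ 3.
    by ring.
  by case: (cube (x - 1)); lra.
have -> : (x ^+ 3 - 3 * (x - 1) ^+ 3 + 3 * (x - 2) ^+ 3 - 0 ^+ 3) / 6 = 1 - (3 - x) ^+ 3 / 6.
  by field.
by case: (cube (3 - x)); lra.
Qed.

Lemma smooth_step1_bound x : `|smooth_step1 x| <= 3.
Proof.
rewrite ler_norml /smooth_step1 /pos_cube1.
have -> : (3 * Num.max x 0 ^+ 2 - 3 * (3 * Num.max (x - 1) 0 ^+ 2)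
   + 3 * (3 * Num.max (x - 2) 0 ^+ 2) - 3 * Num.max (x - 3) 0 ^+ 2) / 6 =
  (Num.max x 0 ^+ 2 - 3 * Num.max (x - 1) 0 ^+ 2
   + 3 * Num.max (x - 2) 0 ^+ 2 - Num.max (x - 3) 0 ^+ 2) / 2 by field.
have sq (u : R) : 0 <= u -> u <= 1 -> 0 <= u ^+ 2 <= 1.
  by move=> u0 u1; rewrite sqr_ge0 expr_le1.
case: (leP x 0) => x0; first by rewrite !max_r; lra.
case: (leP (x - 1) 0) => x1.
  rewrite !max_r; [|lra..].
  have /andP[] : 0 <= x ^+ 2 <= 1 by apply: sq; lra.
  lra.
case: (leP (x - 2) 0) => x2.
  rewrite max_r; last lra.
  have -> : x ^+ 2 = (x - 1) ^+ 2 + 2 * (x - 1) + 1 by ring.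
  have /andP[] : 0 <= (x - 1) ^+ 2 <= 1 by apply: sq; lra.
  lra.
case: (leP (x - 3) 0) => x3; last by lra.
have -> : (x ^+ 2 - 3 * (x - 1) ^+ 2 + 3 * (x - 2) ^+ 2 - 0 ^+ 2) / 2 = (3 - x) ^+ 2 / 2.
  by field.
have /andP[] : 0 <= (3 - x) ^+ 2 <= 1 by apply: sq; lra.
lra.
Qed.

Lemma smooth_step2_bound x : `|smooth_step2 x| <= 1.
Proof.
rewrite ler_norml /smooth_step2 /pos_cube2.
by case: (leP x 0) => x0; case: (leP (x - 1) 0) => x1; case: (leP (x - 2) 0) => x2;
  case: (leP (x - 3) 0) => x3; lra.
Qed.

Let cmax : continuous (fun x => Num.max x 0).
Proof.
move=> x; apply: (@continuous_max R R (fun x => x) (cst 0)); [exact: cvg_id|exact: cvg_cst].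
Qed.

Let ccomp (f : R -> R) c : continuous f -> continuous (fun x => f (x - c)).
Proof.
move=> cf x; apply: (@continuous_comp _ _ _ (fun z => z - c) f); last exact: cf.
by apply: cvgB; [exact: cvg_id|exact: cvg_cst].
Qed.

Let ccombine (f : R -> R) : continuous f ->
  continuous (fun x => (f x - 3 * f (x - 1) + 3 * f (x - 2) - f (x - 3)) / 6).
Proof.
move=> cf x; apply: cvgM; last exact: cvg_cst.
apply: cvgB; last exact: ccomp.
apply: cvgD; last by apply: cvgM; [exact: cvg_cst|exact: ccomp].
by apply: cvgB; [exact: cf|apply: cvgM; [exact: cvg_cst|exact: ccomp]].
Qed.

Lemma continuous_smooth_step : continuous smooth_step.
Proof.
apply: ccombine => x; apply: (@continuous_comp _ _ _ (fun z : R => Num.max z 0) (fun z => z ^+ 3)).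
  exact: cmax.
exact: exprn_continuous.
Qed.

Lemma continuous_smooth_step1 : continuous smooth_step1.
Proof.
apply: ccombine => x; apply: cvgM; first exact: cvg_cst.
apply: (@continuous_comp _ _ _ (fun z : R => Num.max z 0) (fun z => z ^+ 2)).
  exact: cmax.
exact: exprn_continuous.
Qed.

Lemma continuous_smooth_step2 : continuous smooth_step2.
Proof. by apply: ccombine => x; apply: cvgM; [exact: cvg_cst|exact: cmax]. Qed.

End smooth_step.

Section probability_integral.
Context d (T : measurableType d) (R : realType) (mu : probability T R).

Lemma bounded_integrable (f : T -> R) (K : R) : measurable_fun setT f ->
  (forall x, `|f x| <= K) -> mu.-integrable setT (EFin \o f).
Proof.
move=> mf fK; apply: measurable_bounded_integrable => //.
  by rewrite (le_lt_trans (probability_le1 _ _)) ?ltry.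
exists K; split; first exact: num_real.
by move=> M KM x _; exact: le_trans (fK x) (ltW KM).
Qed.

Lemma Rintegral_cst_prob (c : R) : \int[mu]_x c = c.
Proof.
by rewrite Rintegral_cst// [X in fine X](probability_setT mu) mulr1.
Qed.

Lemma EFin_Rintegral (f : T -> R) : mu.-integrable setT (EFin \o f) ->
  ((\int[mu]_x f x)%:E = \int[mu]_x (f x)%:E)%E.
Proof. by move=> fi; rewrite /Rintegral fineK// integrable_fin_num. Qed.

Lemma Rintegral_diff_le (f g : T -> R) (e : R) :
  mu.-integrable setT (EFin \o f) -> mu.-integrable setT (EFin \o g) ->
  (forall x, `|f x - g x| <= e) ->
  `|\int[mu]_x f x - \int[mu]_x g x| <= e.
Proof.
move=> fi gi fge; rewrite -RintegralB//.
have fgi : mu.-integrable setT (EFin \o (fun x => f x - g x)).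
  exact: (integrableB measurableT fi gi).
apply: (le_trans (le_normr_Rintegral measurableT fgi)).
rewrite -[leRHS]Rintegral_cst_prob; apply: le_Rintegral => //.
- by have := integrable_norm fgi.
- exact: finite_measure_integrable_cst.
Qed.

End probability_integral.

Section taylor2.
Context {R : realType}.

(** The cubic branch is for small increments. The quadratic branch keeps the expectation finite as
    soon as the variance is, so that large increments call for no third moment, as in Lindeberg's
    condition. *)
Definition taylor_rem (y : R) : R := Num.min (`|y| ^+ 3) (y ^+ 2).

Lemma taylor_rem_ge0 y : 0 <= taylor_rem y.
Proof. by rewrite /taylor_rem le_min exprn_ge0//= sqr_ge0. Qed.

Lemma measurable_taylor_rem : measurable_fun setT taylor_rem.
Proof.
apply: measurable_minr => //; apply: (measurableT_comp (f := fun z : R => z ^+ 3)) => //.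
Qed.

Lemma taylor_rem_le_sqr y : taylor_rem y <= y ^+ 2.
Proof. by rewrite /taylor_rem ge_min lexx orbT. Qed.

(** The first-order coefficient is hidden in the existential because it is integrated against a
    centred increment and leaves no trace. The second-order one has to be visible: it must be the
    same for the two increments compared. *)
Definition taylor2 (K : R) (u u2 : R -> R) :=
  exists u1 : R -> R, forall s y,
    `|u (s + y) - (u s + u1 s * y + u2 s / 2 * y ^+ 2)| <= K * taylor_rem y.

(** After integration the main terms depend on the increment only through its mean 0 and its
    variance [v]. Applied to a data increment and to a Gaussian one of the same variance, the common
    value [u s + u2 s / 2 * v] cancels. *)
Lemma taylor2_step d (T : measurableType d) (mu : probability T R) (zeta : T -> R)
    (K B v rho s : R) (u u2 : R -> R) :
  0 <= K -> taylor2 K u u2 -> measurable_fun setT u -> (forall x, `|u x| <= B) ->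
  mu.-integrable setT (EFin \o zeta) -> \int[mu]_x zeta x = 0 ->
  mu.-integrable setT (EFin \o (fun x => zeta x ^+ 2)) -> \int[mu]_x (zeta x ^+ 2) = v ->
  \int[mu]_x taylor_rem (zeta x) <= rho ->
  `|\int[mu]_x u (s + zeta x) - (u s + u2 s / 2 * v)| <= K * rho.
Proof.
move=> K0 [u1 tu] mu_ uB iz z0 iz2 zv zrho.
have mz : measurable_fun setT zeta by apply/measurable_EFinP/(measurable_int mu).
have irem : mu.-integrable setT (EFin \o (fun x => taylor_rem (zeta x))).
  apply: (le_integrable measurableT _ _ iz2).
    by apply/measurable_EFinP; exact: measurableT_comp measurable_taylor_rem mz.
  move=> x _; rewrite lee_fin ger0_norm ?taylor_rem_ge0// ger0_norm ?sqr_ge0//.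
  exact: taylor_rem_le_sqr.
have i1 : mu.-integrable setT (EFin \o (fun x => u (s + zeta x))).
  apply: (@bounded_integrable _ _ _ _ _ B) => //.
  by apply: measurableT_comp => //; exact: measurable_funD.
have ic : mu.-integrable setT (EFin \o (fun=> u s)) by exact: finite_measure_integrable_cst.
have il : mu.-integrable setT (EFin \o (fun x => u1 s * zeta x)).
  by have := integrableZl measurableT (u1 s) iz.
have iq : mu.-integrable setT (EFin \o (fun x => u2 s / 2 * zeta x ^+ 2)).
  by have := integrableZl measurableT (u2 s / 2) iz2.
have icl : mu.-integrable setT (EFin \o (fun x => u s + u1 s * zeta x)).
  exact: (integrableD measurableT ic il).
have iclq : mu.-integrable setT (EFin \o (fun x => u s + u1 s * zeta x + u2 s / 2 * zeta x ^+ 2)).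
  exact: (integrableD measurableT icl iq).
have -> : u s + u2 s / 2 * v = \int[mu]_x (u s + u1 s * zeta x + u2 s / 2 * zeta x ^+ 2).
  rewrite RintegralD// RintegralD// Rintegral_cst_prob RintegralZl// z0 RintegralZl// zv.
  by rewrite mulr0 addr0.
rewrite -RintegralB//.
have id := integrableB measurableT i1 iclq.
apply: (le_trans (le_normr_Rintegral measurableT id)).
apply: (@le_trans _ _ (\int[mu]_x (K * taylor_rem (zeta x)))).
  apply: le_Rintegral => //.
  - by have := integrable_norm id.
  - by have := integrableZl measurableT K irem.
by rewrite RintegralZl// ler_wpM2l.
Qed.

End taylor2.

Section gaussian_smoothing.
Context {R : realType}.
Local Notation gamma := (normal_prob (0 : R) 1).

(** Convolution of [g] with the centred normal law of standard deviation [c]: the expectation over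
    all Gaussian increments still present in a hybrid sum, lumped into one. *)
Definition gauss_smooth (g : R -> R) (c s : R) : R := \int[gamma]_x g (s + c * x).

Let continuous_affine (s c : R) : continuous (fun x : R => s + c * x).
Proof. by move=> x; apply: cvgD; [exact: cvg_cst|apply: cvgM => //; exact: cvg_cst]. Qed.

Let measurable_affine (g : R -> R) (s c : R) : continuous g -> measurable_fun setT (fun x => g (s + c * x)).
Proof.
move=> cg; apply: continuous_measurable_fun => x.
by apply: (@continuous_comp _ _ _ (fun x : R => s + c * x) g); [exact: continuous_affine|exact: cg].
Qed.

Let integrable_affine (g : R -> R) (K s c : R) : continuous g -> (forall x, `|g x| <= K) ->
  gamma.-integrable setT (EFin \o (fun x => g (s + c * x))).
Proof. by move=> cg gK; apply: (@bounded_integrable _ _ _ _ _ K) => //; exact: measurable_affine. Qed.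

Lemma gauss_smooth0 g s : gauss_smooth g 0 s = g s.
Proof.
rewrite /gauss_smooth; under eq_Rintegral do rewrite mul0r addr0.
exact: Rintegral_cst_prob.
Qed.

(** The Taylor inequality is integrated in the Gaussian variable with [s] and [y] fixed, so the
    constant [K] is the same for every [c]. The bounds on [g], [g1] and [g2] give integrability. *)
Lemma gauss_smooth_taylor2 (g g1 g2 : R -> R) (K c : R) :
  continuous g -> continuous g1 -> continuous g2 ->
  (forall x, `|g x| <= K) -> (forall x, `|g1 x| <= K) -> (forall x, `|g2 x| <= K) ->
  (forall s y, `|g (s + y) - (g s + g1 s * y + g2 s / 2 * y ^+ 2)| <= K * taylor_rem y) ->
  taylor2 K (gauss_smooth g c) (gauss_smooth g2 c).
Proof.
move=> cg cg1 cg2 gK g1K g2K tay; exists (gauss_smooth g1 c) => s y.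
have i0 := integrable_affine s c cg gK.
have i1 := integrable_affine s c cg1 g1K.
have i2 := integrable_affine s c cg2 g2K.
have iy := integrable_affine (s + y) c cg gK.
have i1y : gamma.-integrable setT (EFin \o (fun x => g1 (s + c * x) * y)).
  by have := integrableZr measurableT y i1.
have i2y : gamma.-integrable setT (EFin \o (fun x => g2 (s + c * x) * (y ^+ 2 / 2))).
  by have := integrableZr measurableT (y ^+ 2 / 2) i2.
have i01 : gamma.-integrable setT (EFin \o (fun x => g (s + c * x) + g1 (s + c * x) * y)).
  exact: (integrableD measurableT i0 i1y).
rewrite /gauss_smooth (mulrAC _ _ (y ^+ 2)) -(mulrA _ (y ^+ 2)).
rewrite -!RintegralZr// -!RintegralD//.
apply: Rintegral_diff_le => //; first exact: (integrableD measurableT i01 i2y).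
move=> x; rewrite (addrAC s y) (_ : g2 _ * _ = g2 (s + c * x) / 2 * y ^+ 2) ?tay//; ring.
Qed.

Lemma gauss_smooth_bound (g : R -> R) c s : continuous g -> (forall x, 0 <= g x <= 1) ->
  0 <= gauss_smooth g c s <= 1.
Proof.
move=> cg g01; apply/andP; split.
  by apply: Rintegral_ge0 => x _; case/andP: (g01 (s + c * x)).
rewrite -[leRHS](Rintegral_cst_prob gamma); apply: le_Rintegral => //.
- apply: (integrable_affine (K := 1)) => // x.
  by have /andP[g0 g1] := g01 x; rewrite ger0_norm.
- exact: finite_measure_integrable_cst.
- by move=> x _; case/andP: (g01 (s + c * x)).
Qed.

Lemma measurable_gauss_smooth (g : R -> R) c : continuous g -> (forall x, 0 <= g x) ->
  measurable_fun setT (gauss_smooth g c).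
Proof.
move=> cg g0.
pose f (p : R * R) := (g (p.1 + c * p.2))%:E.
have mf : measurable_fun setT f.
  apply/measurable_EFinP; apply: measurableT_comp; first exact: continuous_measurable_fun.
  by apply: measurable_funD => //; exact: measurable_funM.
apply: (@measurableT_comp _ _ _ _ _ _ (fine : \bar R -> R)) => //.
by apply: (measurable_fun_fubini_tonelli_F (m2 := gamma) f mf) => p; rewrite lee_fin.
Qed.

Lemma gauss_smooth_conv (g : R -> R) a b s : 0 < a -> 0 <= b -> continuous g -> (forall x, 0 <= g x <= 1) ->
  \int[gamma]_x gauss_smooth g b (s + a * x) = gauss_smooth g (Num.sqrt (a ^+ 2 + b ^+ 2)) s.
Proof.
(* [b = 0] occurs at the last replacement, when no further Gaussian increment is left. *)
move=> a0; rewrite le_eqVlt => /predU1P[<-|b0] cg g01.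
  under eq_Rintegral do rewrite gauss_smooth0.
  by rewrite expr0n/= addr0 sqrtr_sqr gtr0_norm.
have g0 x : 0 <= g x by case/andP: (g01 x).
have gK x : `|g x| <= 1 by rewrite ger0_norm//; case/andP: (g01 x).
rewrite /gauss_smooth {1 3}/Rintegral -integral_std_normal_conv//; congr fine.
apply: eq_integral => x _; rewrite EFin_Rintegral//.
exact: integrable_affine gK.
Qed.

End gaussian_smoothing.

Section lindeberg.
Context d1 d2 d3 (Omega : measurableType d1) (TA : measurableType d2)
  (TO : measurableType d3) (R : realType).
Variables (Pr : probability Omega R) (P : probability TO R).
Variables (O : nat -> Omega -> TO) (A : Omega -> TA).
Hypothesis mO : forall i, measurable_fun setT (O i).
Hypothesis mA : measurable_fun setT A.
Hypothesis indep : forall n (S : nat -> set TO) (B : set TA),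
  (forall i, measurable (S i)) -> measurable B ->
  Pr (A @^-1` B `&` \bigcap_(i in `I_n) (O i @^-1` S i)) =
  (Pr (A @^-1` B) * \prod_(i < n) P (S i))%E.
Local Notation gamma := (normal_prob (0 : R) 1).

Variable zeta : TA * TO -> R.
Hypothesis mzeta : measurable_fun setT zeta.

Definition psum k w := \sum_(i < k) zeta (A w, O i w).

(** What is known before observation [k]: [A] and the observations of smaller index. *)
Let past k := g_sigma_algebraType (cyl O A k.+1 k [set setT]).

Lemma measurable_past_A k : measurable_fun setT (A : past k -> TA).
Proof. exact: (measurable_cyl_ctx (C := [set setT]) erefl (u := id)). Qed.

Lemma measurable_past_psum k : measurable_fun setT (psum k : past k -> R).
Proof.
apply: measurable_sum => i; apply: measurableT_comp => //.
apply: measurable_fun_pair; first exact: measurable_past_A.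
apply: (measurable_cyl_other (C := [set setT]) erefl (u := id)) => //.
  by rewrite ltnS ltnW.
by rewrite ltn_eqF.
Qed.

Lemma measurable_psum k : measurable_fun setT (psum k).
Proof.
apply: measurable_sum => i; apply: measurableT_comp => //.
exact: measurable_fun_pair.
Qed.

Lemma ge0_integral_psum k (F : TA * R * TO -> R) : measurable_fun setT F -> (forall x, 0 <= F x) ->
  (\int[Pr]_w (F (A w, psum k w, O k w))%:E =
   \int[Pr]_w \int[P]_o (F (A w, psum k w, o))%:E)%E.
Proof.
move=> mF F0.
apply: (ge0_integral_past mO mA indep (V := fun w => (A w, psum k w))) => //.
by apply: measurable_fun_pair; [exact: measurable_past_A|exact: measurable_past_psum].
Qed.

Lemma Rintegral_psum k (F : TA * R * TO -> R) (B : R) : measurable_fun setT F ->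
  (forall x, 0 <= F x <= B) ->
  \int[Pr]_w F (A w, psum k w, O k w) = \int[Pr]_w \int[P]_o F (A w, psum k w, o).
Proof.
move=> mF F0B; rewrite {1 2}/Rintegral ge0_integral_psum//; last by move=> x; case/andP: (F0B x).
congr fine; apply: eq_integral => w _; rewrite EFin_Rintegral//.
apply: (@bounded_integrable _ _ _ _ _ B); first exact: measurableT_comp.
by move=> o; have /andP[F0 FB] := F0B (A w, psum k w, o); rewrite ger0_norm.
Qed.

Variable G : set TA.
Hypothesis mG : measurable G.

Lemma psumS k w : psum k.+1 w = psum k w + zeta (A w, O k w).
Proof. by rewrite /psum big_ord_recr. Qed.

(** Induction on the number of terms: given [A] and the past, the new term has mean 0, so the cross
    term of the square vanishes and at most [v] is added. The indicator of [G] restricts to values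
    of [A] for which the moments are controlled. *)
Lemma psum_second_moment (v : R) k :
  (forall a, G a -> P.-integrable setT (EFin \o (fun o => zeta (a, o)))) ->
  (forall a, G a -> \int[P]_o zeta (a, o) = 0) ->
  (forall a, G a -> P.-integrable setT (EFin \o (fun o => zeta (a, o) ^+ 2))) ->
  (forall a, G a -> \int[P]_o (zeta (a, o) ^+ 2) <= v) -> 0 <= v ->
  (\int[Pr]_w (\1_G (A w) * psum k w ^+ 2)%:E <= (k%:R * v)%:E)%E.
Proof.
move=> iz z0 iz2 zv v0; elim: k => [|k IH].
  rewrite mul0r integral0_eq// => w _.
  by rewrite /psum big_ord0 expr0n mulr0.
pose F (p : TA * R * TO) := \1_G p.1.1 * (p.1.2 + zeta (p.1.1, p.2)) ^+ 2.
have mF : measurable_fun setT F.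
  apply: measurable_funM.
    by apply: (@measurableT_comp _ _ _ _ _ _ (\1_G : TA -> R)) => //; exact: measurableT_comp.
  apply: (measurableT_comp (f := fun z : R => z ^+ 2)) => //; apply: measurable_funD.
    exact: measurableT_comp.
  apply: (measurableT_comp (f := zeta)) => //; apply: measurable_fun_pair => //.
  exact: measurableT_comp.
under eq_integral => w _ do rewrite psumS.
rewrite (@ge0_integral_psum k F mF); last by move=> x; rewrite mulr_ge0// sqr_ge0.
have mS := measurable_psum k.
have mI : measurable_fun setT (fun w => (\1_G (A w) * psum k w ^+ 2)%:E).
  apply/measurable_EFinP; apply: measurable_funM.
    exact: (measurableT_comp (f := (\1_G : TA -> R))).
  exact: (measurableT_comp (f := fun z : R => z ^+ 2)).
apply: (@le_trans _ _ (\int[Pr]_w ((\1_G (A w) * psum k w ^+ 2)%:E + v%:E))%E).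
  apply: ge0_le_integral => //.
  - move=> w _; apply: integral_ge0 => o _.
    by rewrite lee_fin mulr_ge0// sqr_ge0.
  - have mAS : measurable_fun setT (fun w => (A w, psum k w)) by exact: measurable_fun_pair.
    apply: (measurableT_comp (f := fun q => \int[P]_o (F (q, o))%:E)%E) mAS => //.
    apply: (measurable_fun_fubini_tonelli_F (m2 := P) (EFin \o F)) => //; first exact/measurable_EFinP.
    by move=> x; rewrite lee_fin mulr_ge0// sqr_ge0.
  - exact: emeasurable_funD.
  - move=> w _; rewrite /F/= indicE; have [GA|nGA] := boolP (A w \in G); last first.
      by rewrite mul0r add0e integral0_eq// => o _; rewrite mul0r.
    have {}GA : G (A w) by rewrite inE in GA.
    rewrite !mul1r; under eq_integral do rewrite mul1r.
    set s := psum k w.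
    have ic : P.-integrable setT (EFin \o (fun=> s ^+ 2)) by exact: finite_measure_integrable_cst.
    have il : P.-integrable setT (EFin \o (fun o => 2 * s * zeta (A w, o))).
      by have := integrableZl measurableT (2 * s) (iz _ GA).
    have icl : P.-integrable setT (EFin \o (fun o => s ^+ 2 + 2 * s * zeta (A w, o))).
      exact: (integrableD measurableT ic il).
    have iq := iz2 _ GA.
    have E : (fun o => (s + zeta (A w, o)) ^+ 2) =
        (fun o => (s ^+ 2 + 2 * s * zeta (A w, o)) + zeta (A w, o) ^+ 2).
      by apply/funext => o; ring.
    rewrite -(@EFin_Rintegral _ _ _ P (fun o => (s + zeta (A w, o)) ^+ 2)); last first.
      by rewrite E; exact: (integrableD measurableT icl iq).
    rewrite E RintegralD// RintegralD// Rintegral_cst_prob RintegralZl ?z0//; last exact: iz.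
    by rewrite mulr0 addr0 -EFinD lee_fin lerD2l zv.
rewrite ge0_integralD//; last by move=> w _; rewrite lee_fin mulr_ge0// sqr_ge0.
rewrite integral_cst// [X in (_ * X)%E](probability_setT Pr) mule1.
by rewrite -natr1 mulrDl mul1r EFinD leeD2r.
Qed.

(** Between the data sum and a standard normal variable stand the hybrids with [k] data terms and
    [n - k] Gaussian ones; each of the [n] exchanges costs the bracket on the right. [G] collects
    values of [A] for which the terms have mean 0 and variance 1/n, and the comparison is carried
    out on that event. *)
Lemma lindeberg (g g1 g2 : R -> R) (K rho : R) n : (0 < n)%N ->
  continuous g -> continuous g1 -> continuous g2 -> (forall x, 0 <= g x <= 1) -> 1 <= K ->
  (forall x, `|g1 x| <= K) -> (forall x, `|g2 x| <= K) ->
  (forall s y, `|g (s + y) - (g s + g1 s * y + g2 s / 2 * y ^+ 2)| <= K * taylor_rem y) ->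
  (forall a, G a -> P.-integrable setT (EFin \o (fun o => zeta (a, o)))) ->
  (forall a, G a -> \int[P]_o zeta (a, o) = 0) ->
  (forall a, G a -> P.-integrable setT (EFin \o (fun o => zeta (a, o) ^+ 2))) ->
  (forall a, G a -> \int[P]_o (zeta (a, o) ^+ 2) = n%:R^-1) ->
  (forall a, G a -> \int[P]_o taylor_rem (zeta (a, o)) <= rho) ->
  0 <= rho ->
  `|\int[Pr]_w (\1_G (A w) * g (psum n w)) - fine (Pr (A @^-1` G)) * \int[gamma]_x g x|
    <= n%:R * (K * (rho + 4 * normal_pdf 0 1 0 * (Num.sqrt n%:R)^-1 ^+ 3)).
Proof.
move=> n0 cg cg1 cg2 g01 K1 g1K g2K tay iz z0 iz2 zv zrho rho0.
have gK x : `|g x| <= K.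
  by have /andP[? ?] := g01 x; rewrite ger0_norm//; exact: le_trans K1.
have K0 : 0 <= K by exact: le_trans K1.
have g0 x : 0 <= g x by case/andP: (g01 x).
set e := K * _.
have e0 : 0 <= e.
  rewrite mulr_ge0// addr_ge0// mulr_ge0 ?exprn_ge0 ?invr_ge0//.
  by rewrite mulr_ge0// ltW// std_pdf_gt0.
have rn0 : 0 < (n%:R : R) by rewrite ltr0n.
have sn0 : 0 < Num.sqrt (n%:R : R) by rewrite sqrtr_gt0.
pose a1 : R := (Num.sqrt n%:R)^-1.
have a10 : 0 < a1 by rewrite invr_gt0.
have a12 : a1 ^+ 2 = n%:R^-1 by rewrite exprVn sqr_sqrtr// ltW.
(* Standard deviation of [n - k] Gaussian terms of variance 1/n. It is 1 at [k = 0], which gives the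
   Gaussian integral, and 0 at [k = n], which gives back [g]. *)
pose c k : R := Num.sqrt ((n - k)%:R / n%:R).
have c0 k : 0 <= c k by rewrite sqrtr_ge0.
have cS k : (k < n)%N -> c k = Num.sqrt (a1 ^+ 2 + c k.+1 ^+ 2).
  move=> kn; rewrite a12 sqr_sqrtr ?divr_ge0//; congr Num.sqrt.
  by rewrite -[X in X + _]mul1r -mulrDl; congr (_ / _); rewrite -subnSK// -natr1 addrC.
pose u k := gauss_smooth g (c k).
have u01 k s : 0 <= u k s <= 1 by exact: gauss_smooth_bound.
have mu_ k : measurable_fun setT (u k) by exact: measurable_gauss_smooth.
have tu k : taylor2 K (u k) (gauss_smooth g2 (c k)) by exact: gauss_smooth_taylor2 cg1 cg2 _ _ _ _.
have uK k x : `|u k x| <= 1 by have /andP[? ?] := u01 k x; rewrite ger0_norm.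
have mgam c' : measurable_fun setT (fun x : R => c' * x) by exact: measurable_funM.
(* One exchange: [u k] is [u k.+1] averaged over a Gaussian increment of variance 1/n, so the data
   increment and the Gaussian one have the same Taylor main terms around [s]. *)
have step k a s : (k < n)%N -> G a -> `|\int[P]_o u k.+1 (s + zeta (a, o)) - u k s| <= e.
  move=> kn Ga.
  have H1 := taylor2_step s K0 (tu k.+1) (mu_ _) (uK _) (iz _ Ga) (z0 _ Ga) (iz2 _ Ga) (zv _ Ga) (zrho _ Ga).
  have ix : gamma.-integrable setT (EFin \o (fun x : R => a1 * x)).
    by have := integrableZl measurableT a1 (@integrable_std_normal_id R).
  have ix2' : gamma.-integrable setT (EFin \o (fun x : R => x ^+ 2)).
    apply/integrableP; split; first exact/measurable_EFinP.
    under eq_integral => x _ do rewrite /= ger0_norm ?sqr_ge0//.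
    by rewrite integral_std_normal_sqr ltry.
  have E2 : (fun x : R => (a1 * x) ^+ 2) = (fun x => a1 ^+ 2 * x ^+ 2).
    by apply/funext => x; rewrite exprMn.
  have ix2 : gamma.-integrable setT (EFin \o (fun x : R => (a1 * x) ^+ 2)).
    by rewrite E2; have := integrableZl measurableT (a1 ^+ 2) ix2'.
  have ix3 : gamma.-integrable setT (EFin \o (fun x : R => `|x| ^+ 3)).
    apply/integrableP; split.
      by apply/measurable_EFinP; exact: (measurableT_comp (f := fun z : R => z ^+ 3)).
    under eq_integral => x _ do rewrite /= ger0_norm ?exprn_ge0//.
    by rewrite integral_std_normal_cube ltry.
  have x0 : \int[gamma]_x (a1 * x) = 0.
    rewrite RintegralZl//; last exact: integrable_std_normal_id.
    by rewrite /Rintegral integral_std_normal_id mulr0.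
  have x2 : \int[gamma]_x ((a1 * x) ^+ 2) = n%:R^-1.
    by rewrite E2 RintegralZl// /Rintegral integral_std_normal_sqr mulr1.
  (* For the Gaussian increment the cubic branch of the remainder is enough; its third absolute
     moment is of order n^(-3/2). *)
  have x3 : \int[gamma]_x taylor_rem (a1 * x) <= 4 * normal_pdf 0 1 0 * a1 ^+ 3.
    have -> : 4 * normal_pdf 0 1 0 * a1 ^+ 3 = \int[gamma]_x (a1 ^+ 3 * `|x| ^+ 3).
      have cubeE : \int[gamma]_x (`|x| ^+ 3) = 4 * normal_pdf 0 1 0.
        by rewrite /Rintegral integral_std_normal_cube.
      by rewrite RintegralZl// cubeE mulrC.
    apply: le_Rintegral => //.
    - apply: (le_integrable measurableT _ _ ix2).
        by apply/measurable_EFinP; exact: measurableT_comp measurable_taylor_rem (mgam a1).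
      move=> x _; rewrite lee_fin ger0_norm ?taylor_rem_ge0// ger0_norm ?sqr_ge0//.
      exact: taylor_rem_le_sqr.
    - by have := integrableZl measurableT (a1 ^+ 3) ix3.
    - move=> x _; rewrite /taylor_rem ge_min; apply/orP; left.
      by rewrite normrM exprMn (gtr0_norm a10).
  have := taylor2_step s K0 (tu k.+1) (mu_ _) (uK _) ix x0 ix2 x2 x3.
  rewrite gauss_smooth_conv// -cS// -/(u k) => H2.
  rewrite /e mulrDr; apply: le_trans (lerD H1 H2).
  by rewrite (distrC (u k s)); exact: ler_distD.
have mIA : measurable_fun setT (fun w => \1_G (A w) : R).
  exact: (measurableT_comp (f := (\1_G : TA -> R))).
have mIu k : measurable_fun setT (fun w => \1_G (A w) * u k (psum k w)).
  apply: measurable_funM => //; apply: (measurableT_comp (mu_ k)); exact: measurable_psum.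
have bI (a : TA) : 0 <= (\1_G a : R) <= 1 by rewrite indicE; case: (_ \in _); rewrite !lexx ler01.
have bIu a k s : 0 <= \1_G a * u k s <= 1.
  have /andP[? ?] := bI a; have /andP[? ?] := u01 k s.
  by rewrite mulr_ge0//= mulr_ile1.
have iIu k : Pr.-integrable setT (EFin \o (fun w => \1_G (A w) * u k (psum k w))).
  apply: (@bounded_integrable _ _ _ _ _ 1) => // w.
  by have /andP[? ?] := bIu (A w) k (psum k w); rewrite ger0_norm.
have main k : (k <= n)%N ->
    `|\int[Pr]_w (\1_G (A w) * u k (psum k w)) - fine (Pr (A @^-1` G)) * u 0%N 0| <= k%:R * e.
  elim: k => [_|k IH kn].
    rewrite mul0r; have -> : \int[Pr]_w (\1_G (A w) * u 0%N (psum 0 w)) =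
        \int[Pr]_w (\1_G (A w) * u 0%N 0).
      by apply: eq_Rintegral => w _; rewrite /psum big_ord0.
    rewrite RintegralZr//; last first.
      apply: (@bounded_integrable _ _ _ _ _ 1) => // w.
      by have /andP[? ?] := bI (A w); rewrite ger0_norm.
    have -> : \int[Pr]_w (\1_G (A w) : R) = fine (Pr (A @^-1` G)).
      rewrite /Rintegral; congr fine.
      transitivity (\int[Pr]_w (\1_(A @^-1` G) w)%:E)%E; first exact: eq_integral.
      rewrite integral_indic ?setIT//.
      by rewrite -[X in measurable X]setTI; exact: mA.
    by rewrite subrr normr0.
  pose F (p : TA * R * TO) := \1_G p.1.1 * u k.+1 (p.1.2 + zeta (p.1.1, p.2)).
  have mF : measurable_fun setT F.
    apply: measurable_funM.
      by apply: (@measurableT_comp _ _ _ _ _ _ (\1_G : TA -> R)) => //; exact: measurableT_comp.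
    apply: (measurableT_comp (mu_ k.+1)); apply: measurable_funD.
      exact: measurableT_comp.
    apply: (measurableT_comp (f := zeta)) => //; apply: measurable_fun_pair => //.
    exact: measurableT_comp.
  have -> : \int[Pr]_w (\1_G (A w) * u k.+1 (psum k.+1 w)) =
      \int[Pr]_w \int[P]_o F (A w, psum k w, o).
    rewrite -(@Rintegral_psum k F 1 mF); last by move=> x; exact: bIu.
    by apply: eq_Rintegral => w _; rewrite psumS.
  rewrite -natr1 mulrDl mul1r [leRHS]addrC.
  apply: (le_trans (ler_distD (\int[Pr]_w (\1_G (A w) * u k (psum k w))) _ _)).
  apply: lerD; last by apply: IH; exact: ltnW.
  apply: Rintegral_diff_le => //.
    apply: (@bounded_integrable _ _ _ _ _ 1).
      have mAS : measurable_fun setT (fun w => (A w, psum k w)).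
        by apply: measurable_fun_pair => //; exact: measurable_psum.
      apply: (measurableT_comp (f := fun q => \int[P]_o F (q, o))) mAS => //.
      apply: (@measurableT_comp _ _ _ _ _ _ (fine : \bar R -> R)) => //.
      apply: (measurable_fun_fubini_tonelli_F (m2 := P) (EFin \o F)) => //; first exact/measurable_EFinP.
      by move=> x; rewrite lee_fin; case/andP: (bIu x.1.1 k.+1 (x.1.2 + zeta (x.1.1, x.2))).
    move=> w; rewrite ger0_norm.
      rewrite -[leRHS](Rintegral_cst_prob P); apply: le_Rintegral => //.
      - apply: (@bounded_integrable _ _ _ _ _ 1); first exact: measurableT_comp.
        by move=> o; have /andP[? ?] := bIu (A w) k.+1 (psum k w + zeta (A w, o)); rewrite ger0_norm.
      - exact: finite_measure_integrable_cst.
      - by move=> o _; case/andP: (bIu (A w) k.+1 (psum k w + zeta (A w, o))).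
    by apply: Rintegral_ge0 => o _; case/andP: (bIu (A w) k.+1 (psum k w + zeta (A w, o))).
  move=> w; rewrite /F/=.
  have iuo : P.-integrable setT (EFin \o (fun o => u k.+1 (psum k w + zeta (A w, o)))).
    apply: (@bounded_integrable _ _ _ _ _ 1) => //.
    by apply: (measurableT_comp (mu_ _)); apply: measurable_funD => //; exact: measurableT_comp.
  rewrite RintegralZl// -mulrBr normrM indicE.
  have [GA|nGA] := boolP (A w \in G).
    by rewrite normr1 mul1r step//; rewrite inE in GA.
  by rewrite normr0 mul0r.
have := main n (leqnn n).
have -> : u 0%N 0 = \int[gamma]_x g x.
  rewrite /u /gauss_smooth /c subn0 divff ?lt0r_neq0// sqrtr1.
  by apply: eq_Rintegral => x _; rewrite add0r mul1r.
congr (`|_ - _| <= _); apply: eq_Rintegral => w _.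
by rewrite /u /c subnn mul0r sqrtr0 gauss_smooth0.
Qed.

End lindeberg.

(** * From smooth test functions to distribution functions *)

Section smooth_cut.
Context {R : realType}.
Variables (t delta : R).
Hypothesis delta0 : 0 < delta.

Definition smooth_cut (x : R) := 1 - smooth_step ((x - t) / delta).
Definition smooth_cut1 (x : R) := - (smooth_step1 ((x - t) / delta) / delta).
Definition smooth_cut2 (x : R) := - (smooth_step2 ((x - t) / delta) / delta ^+ 2).

(** A sum, so that it dominates the bound 2/delta^3 for the cubic remainder, the bounds 3/delta and
    1/delta^2 for the derivatives, and their total with 1 for large increments. [delta] is fixed
    before [n], so its growth for small [delta] is harmless. *)
Definition smooth_cut_cst : R := 1 + 2 / delta ^+ 3 + 3 / delta + 1 / delta ^+ 2.

Let c1 : 0 < delta^-1. Proof. by rewrite invr_gt0. Qed.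
Let c3 : 0 < delta^-1 ^+ 3. Proof. exact: exprn_gt0. Qed.
Let c2 : 0 < delta^-1 ^+ 2. Proof. exact: exprn_gt0. Qed.

Let ccomp (f : R -> R) : continuous f -> continuous (fun x => f ((x - t) / delta)).
Proof.
move=> cf x; apply: (@continuous_comp _ _ _ (fun z => (z - t) / delta) f); last exact: cf.
by apply: cvgM; [apply: cvgB; [exact: cvg_id|exact: cvg_cst]|exact: cvg_cst].
Qed.

Lemma continuous_smooth_cut : continuous smooth_cut.
Proof.
by move=> x; apply: cvgB; [exact: cvg_cst|apply: ccomp; exact: continuous_smooth_step].
Qed.

Lemma continuous_smooth_cut1 : continuous smooth_cut1.
Proof.
move=> x; apply: cvgN; apply: cvgM; last exact: cvg_cst.
by apply: ccomp; exact: continuous_smooth_step1.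
Qed.

Lemma continuous_smooth_cut2 : continuous smooth_cut2.
Proof.
move=> x; apply: cvgN; apply: cvgM; last exact: cvg_cst.
by apply: ccomp; exact: continuous_smooth_step2.
Qed.

Lemma smooth_cut_bound x : 0 <= smooth_cut x <= 1.
Proof. by have /andP[? ?] := smooth_step_bound ((x - t) / delta); rewrite /smooth_cut; lra. Qed.

Lemma smooth_cut_cst_ge1 : 1 <= smooth_cut_cst.
Proof. by rewrite /smooth_cut_cst -!exprVn; have := c1; have := c2; have := c3; lra. Qed.

Let cut1 x : `|smooth_cut1 x| <= 3 / delta.
Proof. by rewrite normrN normrM (gtr0_norm c1) ler_pM2r// smooth_step1_bound. Qed.

Let cut2 x : `|smooth_cut2 x| <= 1 / delta ^+ 2.
Proof.
rewrite normrN normrM -exprVn (gtr0_norm c2) ler_pM2r//; exact: smooth_step2_bound.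
Qed.

Lemma smooth_cut1_bound x : `|smooth_cut1 x| <= smooth_cut_cst.
Proof. by apply: (le_trans (cut1 x)); rewrite /smooth_cut_cst -!exprVn; have := c1; have := c2; have := c3; lra. Qed.

Lemma smooth_cut2_bound x : `|smooth_cut2 x| <= smooth_cut_cst.
Proof. by apply: (le_trans (cut2 x)); rewrite /smooth_cut_cst -!exprVn; have := c1; have := c2; have := c3; lra. Qed.

(** For |y| at most 1 the spline remainder is used. For larger y every term is bounded on its own,
    since 1 and |y| are then at most y^2. *)
Lemma smooth_cut_taylor s y :
  `|smooth_cut (s + y) - (smooth_cut s + smooth_cut1 s * y + smooth_cut2 s / 2 * y ^+ 2)|
    <= smooth_cut_cst * taylor_rem y.
Proof.
have cst0 : 0 <= smooth_cut_cst by apply: le_trans smooth_cut_cst_ge1.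
case: (leP `|y| 1) => y1.
  have -> : taylor_rem y = `|y| ^+ 3.
    by rewrite /taylor_rem min_l// -[leRHS]real_normK ?num_real// ler_wiXn2l.
  have -> : smooth_cut (s + y) - (smooth_cut s + smooth_cut1 s * y + smooth_cut2 s / 2 * y ^+ 2)
    = - (smooth_step ((s - t) / delta + y / delta) - smooth_step ((s - t) / delta)
      - smooth_step1 ((s - t) / delta) * (y / delta)
      - smooth_step2 ((s - t) / delta) / 2 * (y / delta) ^+ 2).
    rewrite /smooth_cut /smooth_cut1 /smooth_cut2 -mulrDl (addrAC s y) expr_div_n.
    by field; exact: lt0r_neq0.
  rewrite normrN; apply: (le_trans (smooth_step_taylor _ _)).
  rewrite normrM (gtr0_norm c1) exprMn mulrCA mulrC ler_wpM2r ?exprn_ge0//.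
  by rewrite /smooth_cut_cst -!exprVn; have := c1; have := c2; have := c3; lra.
have y2 : 1 < y ^+ 2 by rewrite -real_normK ?num_real// exprn_egt1.
have -> : taylor_rem y = y ^+ 2.
  by rewrite /taylor_rem min_r// -[leLHS]real_normK ?num_real// ler_weXn2l// ltW.
have H0 : `|smooth_cut (s + y) - smooth_cut s| <= 1.
  have /andP[? ?] := smooth_cut_bound (s + y); have /andP[? ?] := smooth_cut_bound s.
  by rewrite ler_norml; apply/andP; split; lra.
have H1 : `|smooth_cut1 s * y| <= 3 / delta * y ^+ 2.
  rewrite normrM ler_pM// -[leRHS]real_normK ?num_real//.
  by rewrite -[leLHS]expr1; apply: ler_weXn2l => //; exact: ltW.
have H2 : `|smooth_cut2 s / 2 * y ^+ 2| <= 1 / delta ^+ 2 * y ^+ 2.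
  rewrite normrM (ger0_norm (sqr_ge0 y)) ler_wpM2r ?sqr_ge0//.
  have h2 : `|2^-1 : R| = 2^-1 by rewrite ger0_norm.
  by rewrite normrM h2; have := cut2 s; have := normr_ge0 (smooth_cut2 s); lra.
rewrite (_ : _ - _ = (smooth_cut (s + y) - smooth_cut s) - smooth_cut1 s * y
  - smooth_cut2 s / 2 * y ^+ 2); last by ring.
apply: (le_trans (ler_normB _ _)); apply: (le_trans (lerD (ler_normB _ _) (lexx _))).
apply: (le_trans (lerD (lerD H0 H1) H2)).
have : 0 <= delta^-1 ^+ 3 * y ^+ 2 by rewrite mulr_ge0 ?sqr_ge0// ltW.
rewrite /smooth_cut_cst -!exprVn !mulrDl => ?; lra.
Qed.

Lemma smooth_cut_le x : x <= t -> smooth_cut x = 1.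
Proof.
move=> xt; rewrite /smooth_cut smooth_step_le0 ?subr0//.
by rewrite pmulr_lle0// subr_le0.
Qed.

Lemma smooth_cut_ge x : t + 3 * delta <= x -> smooth_cut x = 0.
Proof.
move=> xt; rewrite /smooth_cut smooth_step_ge3 ?subrr//.
by rewrite ler_pdivlMr// lerBrDl.
Qed.

Lemma indic_le_smooth_cut x : (x <= t)%R%:R <= smooth_cut x.
Proof.
by case: (leP x t) => xt; [rewrite smooth_cut_le|case/andP: (smooth_cut_bound x)].
Qed.

Lemma smooth_cut_le_indic x : smooth_cut x <= (x <= t + 3 * delta)%R%:R.
Proof.
case: (leP x (t + 3 * delta)) => xt; first by case/andP: (smooth_cut_bound x).
by rewrite smooth_cut_ge// ltW.
Qed.

Lemma gauss_smooth_cut : Phi t <= \int[normal_prob (0 : R) 1]_x smooth_cut x <= Phi (t + 3 * delta).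
Proof.
have mcut : measurable_fun setT smooth_cut.
  by apply: continuous_measurable_fun; exact: continuous_smooth_cut.
have icut : (normal_prob (0 : R) 1).-integrable setT (EFin \o smooth_cut).
  apply: (@bounded_integrable _ _ _ _ _ 1) => // x.
  by have /andP[? ?] := smooth_cut_bound x; rewrite ger0_norm.
have iI z : (normal_prob (0 : R) 1).-integrable setT (EFin \o (fun x : R => (x <= z)%R%:R)).
  apply: (@bounded_integrable _ _ _ _ _ 1).
    rewrite (_ : (fun x => _) = \1_(`]-oo, z])) //.
    by apply/funext => x; rewrite indicE mem_setE in_itv.
  by move=> x; case: (x <= z)%R; rewrite ?normr1 ?normr0.
have E z : Phi z = \int[normal_prob (0 : R) 1]_x ((x <= z)%R%:R).
  rewrite /Phi /Rintegral; congr fine.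
  transitivity (\int[normal_prob (0 : R) 1]_x (\1_(`]-oo, z]) x)%:E)%E.
    by rewrite integral_indic// setIT.
  by apply: eq_integral => x _; rewrite indicE mem_setE in_itv.
rewrite !E; apply/andP; split; apply: le_Rintegral => // x _.
- exact: indic_le_smooth_cut.
- exact: smooth_cut_le_indic.
Qed.

End smooth_cut.

Section clt_bound.
Context d1 d2 d3 (Omega : measurableType d1) (TA : measurableType d2)
  (TO : measurableType d3) (R : realType).
Variables (Pr : probability Omega R) (P : probability TO R).
Variables (O : nat -> Omega -> TO) (A : Omega -> TA).
Hypothesis mO : forall i, measurable_fun setT (O i).
Hypothesis mA : measurable_fun setT A.
Hypothesis indep : forall n (S : nat -> set TO) (B : set TA),
  (forall i, measurable (S i)) -> measurable B ->
  Pr (A @^-1` B `&` \bigcap_(i in `I_n) (O i @^-1` S i)) =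
  (Pr (A @^-1` B) * \prod_(i < n) P (S i))%E.

(** The indicator of (-oo, t] lies below the cut at [t] and above the cut at [t - 3 * delta]. Each
    cut is compared with its Gaussian integral, and returning from these integrals to [Phi t] costs
    a shift by [3 * delta]. The bound does not involve [t]. *)
Lemma clt_bound (zeta : TA * TO -> R) (G : set TA) (rho delta t : R) n :
  measurable_fun setT zeta -> measurable G -> (0 < n)%N -> 0 < delta ->
  (forall a, G a -> P.-integrable setT (EFin \o (fun o => zeta (a, o)))) ->
  (forall a, G a -> \int[P]_o zeta (a, o) = 0) ->
  (forall a, G a -> P.-integrable setT (EFin \o (fun o => zeta (a, o) ^+ 2))) ->
  (forall a, G a -> \int[P]_o (zeta (a, o) ^+ 2) = n%:R^-1) ->
  (forall a, G a -> \int[P]_o taylor_rem (zeta (a, o)) <= rho) ->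
  0 <= rho ->
  `|fine (Pr (A @^-1` G `&` [set w | psum O A zeta n w <= t]))
     - fine (Pr (A @^-1` G)) * Phi t| <=
  3 * delta * normal_peak 1 + n%:R * (smooth_cut_cst delta *
    (rho + 4 * normal_pdf 0 1 0 * (Num.sqrt n%:R)^-1 ^+ 3)).
Proof.
move=> mzeta mG n0 delta0 iz z0 iz2 zv zrho rho0.
set e := n%:R * _.
have L s := lindeberg mO mA indep mzeta mG n0
  (@continuous_smooth_cut R s delta) (@continuous_smooth_cut1 R s delta)
  (@continuous_smooth_cut2 R s delta) (smooth_cut_bound s delta)
  (smooth_cut_cst_ge1 delta0) (smooth_cut1_bound s delta0) (smooth_cut2_bound s delta0)
  (smooth_cut_taylor s delta0) iz z0 iz2 zv zrho rho0.
have mS : measurable_fun setT (psum O A zeta n) by exact: measurable_psum.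
have mAG : measurable (A @^-1` G) by rewrite -[X in measurable X]setTI; exact: mA.
have mSt s : measurable [set w | psum O A zeta n w <= s].
  rewrite -[X in measurable X]setTI.
  by have := mS measurableT `]-oo, s]%classic (measurable_itv _).
have pG01 : 0 <= fine (Pr (A @^-1` G)) <= 1.
  by rewrite fine_ge0//= -lee_fin fineK ?fin_num_measure// probability_le1.
have /andP[pG0 pG1] := pG01.
have mI (E : set Omega) : measurable E -> Pr.-integrable setT (EFin \o (\1_E : Omega -> R)).
  move=> mE; apply: (@bounded_integrable _ _ _ _ _ 1) => // w.
  by rewrite indicE; case: (w \in E); rewrite ?normr1 ?normr0.
have IE E : measurable E -> \int[Pr]_w (\1_E w : R) = fine (Pr E).
  by move=> mE; rewrite /Rintegral integral_indic// setIT.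
have mc s : measurable_fun setT (smooth_cut s delta).
  by apply: continuous_measurable_fun; exact: continuous_smooth_cut.
have ig s : Pr.-integrable setT (EFin \o (fun w => \1_G (A w) * smooth_cut s delta (psum O A zeta n w))).
  apply: (@bounded_integrable _ _ _ _ _ 1).
    apply: measurable_funM; first exact: (measurableT_comp (f := (\1_G : TA -> R))).
    exact: measurableT_comp.
  move=> w; have /andP[? ?] := smooth_cut_bound s delta (psum O A zeta n w).
  rewrite indicE; case: (_ \in _); rewrite ?mul1r ?mul0r ?normr0// ger0_norm//.
have IGS s w : \1_(A @^-1` G `&` [set w | psum O A zeta n w <= s]) w =
    \1_G (A w) * (psum O A zeta n w <= s)%R%:R :> R.
  by rewrite indicI; congr (_ * _); rewrite indicE; congr (nat_of_bool _)%:R; apply/idP/idP; rewrite inE.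
have I0 a : 0 <= (\1_G a : R) by [].
have up : fine (Pr (A @^-1` G `&` [set w | psum O A zeta n w <= t])) <=
    \int[Pr]_w (\1_G (A w) * smooth_cut t delta (psum O A zeta n w)).
  rewrite -IE; last exact: measurableI.
  apply: le_Rintegral => //; first by apply: mI; exact: measurableI.
  by move=> w _; rewrite IGS ler_wpM2l// indic_le_smooth_cut.
have lo : \int[Pr]_w (\1_G (A w) * smooth_cut (t - 3 * delta) delta (psum O A zeta n w)) <=
    fine (Pr (A @^-1` G `&` [set w | psum O A zeta n w <= t])).
  rewrite -IE; last exact: measurableI.
  apply: le_Rintegral => //; first by apply: mI; exact: measurableI.
  move=> w _; rewrite IGS ler_wpM2l//; apply: (le_trans (smooth_cut_le_indic _ delta0 _)).
  by rewrite subrK.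
have d30 : 0 <= 3 * delta by rewrite mulr_ge0// ltW.
have /andP[_ gu] := gauss_smooth_cut t delta0.
have /andP[gl _] := gauss_smooth_cut (t - 3 * delta) delta0.
have Pu := Phi_lipschitz t d30.
have := Phi_lipschitz (t - 3 * delta) d30; rewrite subrK => Pl.
have peak0 : 0 <= normal_peak (1 : R) by exact: normal_peak_ge0.
have pk : 0 <= normal_peak 1 * (3 * delta) by rewrite mulr_ge0.
have pk1 : fine (Pr (A @^-1` G)) * (normal_peak 1 * (3 * delta)) <= normal_peak 1 * (3 * delta).
  exact: ler_piMl.
have := L t; have := L (t - 3 * delta); rewrite -/e !ler_norml => /andP[l1 l2] /andP[u1 u2].
have hu : fine (Pr (A @^-1` G)) * \int[normal_prob 0 1]_x smooth_cut t delta x <=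
    fine (Pr (A @^-1` G)) * Phi t + fine (Pr (A @^-1` G)) * (normal_peak 1 * (3 * delta)).
  by rewrite -mulrDr ler_wpM2l//; exact: le_trans Pu.
have hl : fine (Pr (A @^-1` G)) * Phi t - fine (Pr (A @^-1` G)) * (normal_peak 1 * (3 * delta)) <=
    fine (Pr (A @^-1` G)) * \int[normal_prob 0 1]_x smooth_cut (t - 3 * delta) delta x.
  by rewrite -mulrBr ler_wpM2l//; apply: le_trans gl; rewrite lerBlDr.
by apply/andP; split; lra.
Qed.

End clt_bound.

(** * Conditional independence *)

Section conditional_probability.
Context d1 d2 (T : measurableType d1) (TZ : measurableType d2) (R : realType).
Variables (P : probability T R) (Z : T -> TZ) (E : set T).
Hypothesis mZ : measurable_fun setT Z.
Hypothesis mE : measurable E.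

(** The Radon-Nikodym derivative, with respect to the law of [Z], of the measure giving D the
    probability of [E] with [Z] in D. Existence matters because conditional independence is defined
    through all versions of the conditional probabilities and supplies none. *)
Lemma cond_prob_exists : exists p : TZ -> R,
  [/\ measurable_fun setT p, forall z, 0 <= p z &
    forall D, measurable D ->
    (\int[P]_(o in Z @^-1` D) (\1_E o)%:E = \int[P]_(o in Z @^-1` D) (p (Z o))%:E)%E].
Proof.
have mI : measurable_fun setT (\1_E : T -> R) by [].
have I0 o : 0 <= (\1_E o : R) by [].
have mZD D : measurable D -> measurable (Z @^-1` D).
  by move=> mD; rewrite -[X in measurable X]setTI; exact: mZ.
pose nu := image_measure (density_measure P mI I0) mZ.
have nuE D : nu D = (\int[P]_(o in Z @^-1` D) (\1_E o)%:E)%E by [].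
have nufin : fin_num_fun nu.
  move=> D mD; rewrite nuE integral_indic//; last exact: mZD.
  by rewrite fin_num_measure//; apply: measurableI => //; exact: mZD.
pose nu' : {finite_measure set TZ -> \bar R} :=
  HB.pack (nu : set TZ -> \bar R) (Measure_isFinite.Build _ _ _ (nu : set TZ -> \bar R) nufin)
   (Measure.class nu).
pose Z' : {RV P >-> TZ} := HB.pack Z (isMeasurableFun.Build _ _ _ _ Z mZ).
pose mu := distribution P Z'.
have numu : nu' `<< mu.
  apply/null_content_dominatesP => D mD muD0.
  apply/eqP; rewrite eq_le measure_ge0 andbT.
  rewrite -[X in (_ <= X)%E]muD0 -[X in (X <= _)%E]/(nu D) nuE integral_indic//; last exact: mZD.
  apply: le_measure; rewrite ?inE//; last exact: mZD.
  by apply: measurableI => //; exact: mZD.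
pose f := Radon_Nikodym_SigmaFinite.f nu' mu.
have f0 := Radon_Nikodym_SigmaFinite.f_ge0 numu.
have ff := Radon_Nikodym_SigmaFinite.f_fin_num numu.
have mf : measurable_fun setT f.
  exact: measurable_int (Radon_Nikodym_SigmaFinite.f_integrable numu).
exists (fine \o f); split => [|z|D mD].
- exact: measurableT_comp.
- by rewrite /= fine_ge0.
- rewrite -nuE -[LHS]/(nu' D) (Radon_Nikodym_SigmaFinite.f_integral numu mD).
  rewrite ge0_integral_pushforward//.
  + by apply: eq_integral => o _; rewrite /= fineK.
  + exact: measurable_funTS.
Qed.

End conditional_probability.

Section observation_measurability.
Variable R : realType.

(** The sigma-algebra is generated by bounded open boxes, so a half-space has to be exhausted by
    boxes whose sides grow with [k]. *)
Lemma measurable_coordinate N (j : 'I_N) : measurable_fun setT (fun x : Rn R N => x j : R).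
Proof.
apply: (measurability _ (RGenOInfty.measurableE R)).
move=> _ [_ [c ->] <-]; rewrite setTI.
rewrite (_ : _ @^-1` _ =
  \bigcup_k (@obox R N (fun i => if i == j then c else - k%:R) (fun=> k%:R))).
  apply: bigcupT_measurable => k; apply: sub_sigma_algebra.
  by eexists; eexists.
apply/seteqP; split => [x /=|x [k _ xk]]; last first.
  by rewrite /= in_itv/= andbT; have := xk j; rewrite eqxx => /andP[].
rewrite in_itv/= andbT => cx.
(* A common bound for all coordinates, so that one box index serves them all. *)
pose M := \sum_i `|x i|.
have xM i : `|x i| <= M by rewrite /M (bigD1 i)//= lerDl sumr_ge0.
exists (Num.truncn M).+1 => // i.
have Mt : M < (Num.truncn M).+1%:R by exact: truncnS_gt.
have := le_lt_trans (xM i) Mt; rewrite ltr_norml => /andP[lo ->].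
by rewrite andbT; case: eqP => [->|].
Qed.

Variable d : nat.

Lemma measurable_Xo : measurable_fun setT (@Xo R d). Proof. exact: measurable_coordinate. Qed.
Lemma measurable_Yo : measurable_fun setT (@Yo R d). Proof. exact: measurable_coordinate. Qed.

Lemma measurable_Zo : measurable_fun setT (@Zo R d).
Proof.
apply: (@measurability _ _ (Obs R d) (Zsp R d) setT (@Zo R d) (@boxes R d) erefl).
move=> _ [_ [a [b ->]] <-]; rewrite setTI.
rewrite (_ : _ @^-1` _ = \big[setI/setT]_(j < d)
    ((fun x : Obs R d => x (@rshift 2 d j)) @^-1` `]a j, b j[)).
  apply: bigsetI_measurable => j _; rewrite -[X in measurable X]setTI.
  exact: measurable_coordinate.
rewrite -bigcap_seq; apply/seteqP; split => [x xab j _|x xab j].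
  by rewrite /= in_itv/=; exact: xab.
have := xab j; rewrite /= in_itv/=; apply.
by rewrite mem_index_enum.
Qed.

End observation_measurability.

Section conditional_independence.
Context (R : realType) (d : nat) (P : probability (Obs R d) R).
Variables (X Y : Obs R d -> R).
Hypothesis mX : measurable_fun setT X.
Hypothesis mY : measurable_fun setT Y.

(** [X] and [Y] are variables here because the results are used in both orders: noise in Y against
    fits from (X, Z), and the reverse. *)
Definition cond_indep_fun := forall (B C : set R), measurable B -> measurable C ->
  forall pB pC : Zsp R d -> R,
    cond_exp P (fun o => \1_B (X o)) pB -> cond_exp P (fun o => \1_C (Y o)) pC ->
    cond_exp P (fun o => \1_B (X o) * \1_C (Y o)) (fun z => pB z * pC z).
Hypothesis ci : cond_indep_fun.

Let mZ := @measurable_Zo R d.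

(** A pi-system generating the sigma-algebra of (V, Z). *)
Definition pair_sets (V : Obs R d -> R) : set (set (Obs R d)) :=
  [set E | exists B D, [/\ measurable B, measurable D & E = V @^-1` B `&` Zo @^-1` D]].

Definition z_sets : set (set (Obs R d)) :=
  [set E | exists2 D, measurable D & E = Zo @^-1` D].

Lemma z_sets_measurable : z_sets `<=` measurable.
Proof. by move=> _ [D mD ->]; rewrite -[X in measurable X]setTI; exact: mZ. Qed.

Lemma z_sets_setI : setI_closed z_sets.
Proof. by move=> _ _ [D mD ->] [D' mD' ->]; exists (D `&` D') => //; exact: measurableI. Qed.

Lemma z_sets_setT : z_sets setT. Proof. by exists setT. Qed.

Lemma measurable_z_sets d' (U : measurableType d') (u : Zsp R d -> U) : measurable_fun setT u ->
  measurable_fun setT ((u \o Zo) : g_sigma_algebraType z_sets -> U).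
Proof.
move=> mu _ D mD; rewrite setTI comp_preimage; apply: sub_sigma_algebra.
by exists (u @^-1` D) => //; rewrite -[X in measurable X]setTI; exact: mu.
Qed.

Lemma pair_sets_measurable V : measurable_fun setT V -> pair_sets V `<=` measurable.
Proof.
move=> mV _ [B [D [mB mD ->]]]; apply: measurableI; rewrite -[X in measurable X]setTI.
  exact: mV.
exact: mZ.
Qed.

Lemma pair_sets_setI V : setI_closed (pair_sets V).
Proof.
move=> _ _ [B [D [mB mD ->]]] [B' [D' [mB' mD' ->]]].
exists (B `&` B'), (D `&` D'); split; [exact: measurableI..|].
by rewrite setIACA.
Qed.

Lemma pair_sets_setT V : pair_sets V setT.
Proof. by exists setT, setT; rewrite !preimage_setT setIT. Qed.

Lemma measurable_pair_sets_fst V d' (U : measurableType d') (u : R -> U) : measurable_fun setT u ->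
  measurable_fun setT ((u \o V) : g_sigma_algebraType (pair_sets V) -> U).
Proof.
move=> mu _ D mD; rewrite setTI comp_preimage; apply: sub_sigma_algebra.
exists (u @^-1` D), setT; split => //; first by rewrite -[X in measurable X]setTI; exact: mu.
by rewrite preimage_setT setIT.
Qed.

Lemma measurable_pair_sets_snd V d' (U : measurableType d') (u : Zsp R d -> U) :
  measurable_fun setT u ->
  measurable_fun setT ((u \o Zo) : g_sigma_algebraType (pair_sets V) -> U).
Proof.
move=> mu _ D mD; rewrite setTI comp_preimage; apply: sub_sigma_algebra.
exists setT, (u @^-1` D); split => //; first by rewrite -[X in measurable X]setTI; exact: mu.
by rewrite preimage_setT setTI.
Qed.

Let mZD D : measurable D -> measurable (Zo @^-1` D : set (Obs R d)).
Proof. by move=> mD; rewrite -[X in measurable X]setTI; exact: mZ. Qed.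

Let mpre (V : Obs R d -> R) B : measurable_fun setT V -> measurable B -> measurable (V @^-1` B).
Proof. by move=> mV mB; rewrite -[X in measurable X]setTI; exact: mV. Qed.

Lemma cond_prob_exp (V : Obs R d -> R) B : measurable_fun setT V -> measurable B ->
  exists p, cond_exp P (fun o => \1_B (V o)) p /\ forall z, 0 <= p z.
Proof.
move=> mV mB; have [p [mp p0 pE]] := cond_prob_exists P mZ (mpre mV mB).
exists p; split => //; split => //; split => //.
apply: (@bounded_integrable _ _ _ _ _ 1).
  exact: (measurableT_comp (f := (\1_B : R -> R))).
by move=> o; rewrite indicE; case: (_ \in _); rewrite ?normr1 ?normr0.
Qed.

(* The weight [p (Z)] is the conditional probability of {X \in B} given Z. *)
Lemma ci_transfer B : measurable B -> exists p : Zsp R d -> R,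
  [/\ measurable_fun setT p, forall z, 0 <= p z &
  forall phi : Obs R d -> R, measurable_fun setT (phi : g_sigma_algebraType (pair_sets Y) -> R) ->
  (forall o, 0 <= phi o) ->
  (\int[P]_o (phi o * \1_B (X o))%:E = \int[P]_o (phi o * p (Zo o))%:E)%E].
Proof.
move=> mB; have [pB [cpB pB0]] := cond_prob_exp mX mB.
have mpB := cpB.1; exists pB; split => //.
have m1 (V : Obs R d -> R) C : measurable_fun setT V -> measurable C ->
    measurable_fun setT (fun o => \1_C (V o) : R).
  by move=> mV mC; exact: (measurableT_comp (f := (\1_C : R -> R))).
have mpZ (p : Zsp R d -> R) : measurable_fun setT p -> measurable_fun setT (fun o : Obs R d => p (Zo o)).
  by move=> mp; exact: (measurableT_comp mp mZ).
have fin1 (V : Obs R d -> R) C : measurable_fun setT V -> measurable C ->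
    (\int[P]_o (\1_C (V o))%:E < +oo)%E.
  move=> mV mC; rewrite (_ : (\int[P]_o _)%E = P (V @^-1` C)).
    by rewrite (le_lt_trans (probability_le1 _ _)) ?ltry//; exact: mpre.
  transitivity (\int[P]_o (\1_(V @^-1` C) o)%:E)%E; first exact: eq_integral.
  by rewrite integral_indic ?setIT//; exact: mpre.
move=> phi mphi phi0.
have mX1 := m1 X B mX mB.
apply: (ge0_integral_pi_system (mu := P) (pair_sets_measurable mY) (pair_sets_setI (V := Y))
  mX1 (mpZ _ mpB) _ _ (fun=> pair_sets_setT Y)) => //.
- by rewrite bigcup_const.
- by move=> k; exact: fin1.
move=> _ [C [D [mC mD ->]]].
(* On the event Y in C, Z in D, conditional independence gives the integral of [pB * pC] over Z in
   D. Since [pB] times the indicator of D is a function of Z, [pC] may then be traded back for the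
   indicator of Y in C. *)
have [pC [cpC pC0]] := cond_prob_exp mY mC.
have [_ [_ /(_ D mD) prodE]] := ci mB mC cpB cpC.
have Y1 E (f : Obs R d -> R) : (\int[P]_(o in Y @^-1` C `&` E) (f o)%:E =
    \int[P]_(o in E) (f o * \1_C (Y o))%:E)%E.
  rewrite setIC integral_mkcondr; apply: eq_integral => o _.
  rewrite patchE (_ : (o \in Y @^-1` C) = (Y o \in C))// indicE.
  by case: ifP; rewrite ?mulr1 ?mulr0.
rewrite !Y1 {}prodE.
have Z1 (f : Obs R d -> R) : (\int[P]_(o in Zo @^-1` D) (f o)%:E =
    \int[P]_o (f o * \1_D (Zo o))%:E)%E.
  rewrite integral_mkcond; apply: eq_integral => o _.
  rewrite patchE (_ : (o \in Zo @^-1` D) = (Zo o \in D))// indicE.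
  by case: ifP; rewrite ?mulr1 ?mulr0.
rewrite !Z1.
have -> : (\int[P]_o (pB (Zo o) * pC (Zo o) * \1_D (Zo o))%:E =
    \int[P]_o ((pB (Zo o) * \1_D (Zo o)) * pC (Zo o))%:E)%E.
  by apply: eq_integral => o _; congr EFin; ring.
have -> : (\int[P]_o (pB (Zo o) * \1_C (Y o) * \1_D (Zo o))%:E =
    \int[P]_o ((pB (Zo o) * \1_D (Zo o)) * \1_C (Y o))%:E)%E.
  by apply: eq_integral => o _; congr EFin; ring.
symmetry; apply: (ge0_integral_pi_system (mu := P) z_sets_measurable z_sets_setI
  (m1 Y C mY mC) (mpZ _ cpC.1) _ _ (fun=> z_sets_setT)) => //.
- by rewrite bigcup_const.
- by move=> k; exact: fin1.
- by move=> _ [D' mD' ->]; rewrite cpC.2.2.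
- apply: (@measurable_z_sets _ _ (fun z => pB z * \1_D z)).
  by apply: measurable_funM.
- by move=> o; rewrite mulr_ge0.
Qed.

(** [cond_exp] asserts integrability of [V] only. The sets where g(Z) is nonnegative and where it is
    negative are events of Z, so the defining identity gives a finite integral on each. *)
Lemma integrable_cond_exp V g : measurable_fun setT V -> cond_exp P V g ->
  P.-integrable setT (EFin \o (fun o => g (Zo o))).
Proof.
move=> mV [mg [iV gE]].
have mgZ : measurable_fun setT (fun o : Obs R d => g (Zo o)) by exact: (measurableT_comp mg mZ).
apply/integrableP; split; first exact/measurable_EFinP.
have mD1 : measurable [set z | 0 <= g z].
  by rewrite -[X in measurable X]setTI; have := mg measurableT `[0, +oo[%classic (measurable_itv _);
  congr measurable; apply/seteqP; split => z /=; rewrite in_itv/= andbT.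
have mD2 := measurableC mD1.
rewrite -(setUv (Zo @^-1` [set z | 0 <= g z])) ge0_integral_setU//=; last 4 first.
- exact: mZD.
- exact: measurableC (mZD mD1).
- by rewrite setUv; apply/measurable_EFinP; exact: measurableT_comp.
- exact/disj_setPCl.
apply: lte_add_pinfty.
  rewrite (eq_integral (fun o => (g (Zo o))%:E)); last first.
    by move=> o; rewrite inE/= => g0; rewrite ger0_norm.
  rewrite -gE//.
  have : P.-integrable (Zo @^-1` [set z | 0 <= g z]) (EFin \o V).
    by apply: integrableS iV => //; exact: mZD.
  by move/(integrable_fin_num (mZD mD1)); rewrite fin_numElt => /andP[].
rewrite (eq_integral (fun o => (- (g (Zo o)))%:E)); last first.
  by move=> o; rewrite inE/= => /negP; rewrite -ltNge => g0; rewrite ltr0_norm.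
have iV2 : P.-integrable (Zo @^-1` (~` [set z | 0 <= g z])) (EFin \o V).
  by apply: integrableS iV => //; exact: mZD.
have f2 := integrable_fin_num (mZD mD2) iV2.
have E : (\int[P]_(o in Zo @^-1` (~` [set z | (0 <= g z)%R])) (g (Zo o))%:E =
    - \int[P]_(o in Zo @^-1` (~` [set z | (0 <= g z)%R])) (- g (Zo o))%:E)%E.
  rewrite -integral_ge0N; first by apply: eq_integral => o _; rewrite EFinN oppeK.
  by move=> o /= /negP; rewrite -ltNge lee_fin oppr_ge0 => /ltW.
by move: f2; rewrite gE// E fin_numN fin_numElt => /andP[].
Qed.

Let mcomp (u : Zsp R d -> R) : measurable_fun setT u -> measurable_fun setT (fun o : Obs R d => u (Zo o)).
Proof. by move=> mu; exact: (measurableT_comp mu mZ). Qed.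

Let measurable_resid (g : Zsp R d -> R) : measurable_fun setT g ->
  measurable_fun setT ((fun o => Y o - g (Zo o)) : g_sigma_algebraType (pair_sets Y) -> R).
Proof.
move=> mg; apply: measurable_funB.
  exact: (@measurable_pair_sets_fst Y _ _ id).
exact: (@measurable_pair_sets_snd Y _ _ g).
Qed.

Lemma integrable_resid g : cond_exp P Y g -> P.-integrable setT (EFin \o (fun o => Y o - g (Zo o))).
Proof.
move=> cg; have iY := cg.2.1.
by have := integrableB measurableT iY (integrable_cond_exp mY cg).
Qed.

Let pairE (f : Obs R d -> R) B D :
  (\int[P]_(o in X @^-1` B `&` Zo @^-1` D) (f o)%:E =
   \int[P]_o (f o * \1_D (Zo o) * \1_B (X o))%:E)%E.
Proof.
rewrite integral_mkcond; apply: eq_integral => o _.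
rewrite patchE in_setI (_ : (o \in X @^-1` B) = (X o \in B))//.
rewrite (_ : (o \in Zo @^-1` D) = (Zo o \in D))// !indicE.
by case: (_ \in B); case: (_ \in D); rewrite ?(mulr1, mulr0).
Qed.

(** The indicator of X in B may be replaced by p(Z), after which the residual is integrated against
    a function of Z alone and gives 0. The replacement is available for nonnegative functions, hence
    the two parts of the residual. *)
Lemma ci_mean0 g E : cond_exp P Y g -> pair_sets X E ->
  (\int[P]_(o in E) (Y o - g (Zo o))%:E = 0)%E.
Proof.
move=> cg [B [D [mB mD ->]]].
have [p [mp p0 pE]] := ci_transfer mB.
have ixi := integrable_resid cg.
have mres := measurable_resid cg.1.
set xi := fun o => Y o - g (Zo o) in ixi mres *.
have mxi : measurable_fun setT xi by apply/measurable_EFinP; exact: (measurable_int P ixi).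
pose pos o := Num.max (xi o) 0.
pose neg o := Num.max (- xi o) 0.
have pn o : xi o = pos o - neg o.
  by rewrite /pos /neg; case: (leP (xi o)); case: (leP (- xi o)) => *; lra.
have pos0 o : 0 <= pos o by rewrite /pos le_max lexx orbT.
have neg0 o : 0 <= neg o by rewrite /neg le_max lexx orbT.
have mpos' : measurable_fun setT (pos : g_sigma_algebraType (pair_sets Y) -> R).
  exact: measurable_maxr.
have mneg' : measurable_fun setT (neg : g_sigma_algebraType (pair_sets Y) -> R).
  by apply: measurable_maxr => //; exact: measurableT_comp.
have mpos : measurable_fun setT pos by exact: measurable_maxr.
have mneg : measurable_fun setT neg by apply: measurable_maxr => //; exact: measurableT_comp.
have posn o : pos o <= `|xi o| by rewrite /pos ge_max ler_norm normr_ge0.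
have negn o : neg o <= `|xi o| by rewrite /neg ge_max -normrN ler_norm normr_ge0.
have m1D : measurable_fun setT (fun o : Obs R d => \1_D (Zo o) : R).
  exact: (@mcomp (\1_D)).
have m1B : measurable_fun setT (fun o => \1_B (X o) : R).
  exact: (measurableT_comp (f := (\1_B : R -> R))).
have I0 (U : Type) (S : set U) x : 0 <= (\1_S x : R) <= 1.
  by rewrite indicE; case: (_ \in _); rewrite !lexx ler01.
(* No upper bound on [p] is at hand, so integrability of the product with [p] is read off the
   transfer identity itself. *)
have key (f : Obs R d -> R) : measurable_fun setT (f : g_sigma_algebraType (pair_sets Y) -> R) ->
    measurable_fun setT f -> (forall o, 0 <= f o <= `|xi o|) ->
    P.-integrable setT (EFin \o (fun o => (f o * \1_D (Zo o)) * \1_B (X o))) /\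
    P.-integrable setT (EFin \o (fun o => f o * (\1_D (Zo o) * p (Zo o)))) /\
    (\int[P]_o (f o * \1_D (Zo o) * \1_B (X o))%:E =
     \int[P]_o (f o * (\1_D (Zo o) * p (Zo o)))%:E)%E.
  move=> mf' mf f0.
  have i1 : P.-integrable setT (EFin \o (fun o => (f o * \1_D (Zo o)) * \1_B (X o))).
    apply: (le_integrable measurableT _ _ ixi).
      apply/measurable_EFinP; apply: measurable_funM; last exact: m1B.
      by apply: measurable_funM; [exact: mf|exact: m1D].
    move=> o _; rewrite lee_fin; have /andP[fo0 fo1] := f0 o.
    have /andP[? ?] := I0 _ D (Zo o); have /andP[? ?] := I0 _ B (X o).
    rewrite ger0_norm; last by rewrite !mulr_ge0.
    by rewrite (le_trans _ fo1)// -[leRHS]mulr1 ler_pM ?mulr_ge0// -[leRHS]mulr1 ler_pM.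
  have E1 : (\int[P]_o (f o * \1_D (Zo o) * \1_B (X o))%:E =
     \int[P]_o (f o * (\1_D (Zo o) * p (Zo o)))%:E)%E.
    rewrite pE; first by apply: eq_integral => o _; rewrite mulrA.
      by apply: measurable_funM => //; apply: (@measurable_pair_sets_snd Y _ _ (\1_D : Zsp R d -> R)).
    by move=> o; have /andP[fo0 _] := f0 o; have /andP[? ?] := I0 _ D (Zo o); rewrite mulr_ge0.
  split => //; split => //.
  apply/integrableP; split.
    apply/measurable_EFinP; apply: measurable_funM => //; apply: measurable_funM => //.
    exact: mcomp.
  have fp0 o : 0 <= f o * (\1_D (Zo o) * p (Zo o)).
    have /andP[fo0 _] := f0 o; have /andP[? ?] := I0 _ D (Zo o).
    by rewrite !mulr_ge0.
  under eq_integral => o _ do rewrite /= ger0_norm//.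
  rewrite -E1; have := integrable_fin_num measurableT i1.
  by rewrite fin_numElt => /andP[].
have pos01 o : 0 <= pos o <= `|xi o| by rewrite pos0 posn.
have neg01 o : 0 <= neg o <= `|xi o| by rewrite neg0 negn.
have [ip1 [ip2 ipE]] := key pos mpos' mpos pos01.
have [in1 [in2 inE_]] := key neg mneg' mneg neg01.
rewrite pairE.
transitivity (\int[P]_o ((pos o * \1_D (Zo o) * \1_B (X o)) - (neg o * \1_D (Zo o) * \1_B (X o)))%:E)%E.
  by apply: eq_integral => o _; rewrite -/(xi o) pn; congr EFin; ring.
rewrite (integralB_EFin measurableT ip1 in1) ipE inE_ -(integralB_EFin measurableT ip2 in2).
transitivity (\int[P]_o ((\1_D (Zo o) * p (Zo o)) * xi o)%:E)%E.
  by apply: eq_integral => o _; rewrite [in RHS]pn; congr EFin; ring.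
apply: (integral0_pi_system (mu := P) z_sets_measurable z_sets_setI z_sets_setT ixi).
- move=> _ [D' mD' ->]; rewrite /xi.
  have iY := integrableS measurableT (mZD mD') (@subsetT _ _) cg.2.1.
  have ig := integrableS measurableT (mZD mD') (@subsetT _ _) (integrable_cond_exp mY cg).
  rewrite (integralB_EFin (mZD mD') iY ig) cg.2.2// subee//.
  exact: (integrable_fin_num (mZD mD') ig).
- apply: (@measurable_z_sets _ _ (fun z => \1_D z * p z)).
  exact: measurable_funM.
- have := integrableB measurableT ip2 in2; apply: eq_integrable => // o _.
  by rewrite /= -EFinB [in RHS]pn; congr EFin; ring.
Qed.

(** The indicator of X in B is replaced by p(Z) on both sides; what remains is the defining property
    of [v], tested against a function of Z. *)
Lemma ci_var (g v : Zsp R d -> R) E : measurable_fun setT g ->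
  cond_exp_nonneg P (fun o => (Y o - g (Zo o)) ^+ 2) v -> pair_sets X E ->
  (\int[P]_(o in E) ((Y o - g (Zo o)) ^+ 2)%:E = \int[P]_(o in E) (v (Zo o))%:E)%E.
Proof.
move=> mg [mxi2 [mv [v0 vE]]] [B [D [mB mD ->]]].
have [p [mp p0 pE]] := ci_transfer mB.
have m1D : measurable_fun setT ((fun o => \1_D (Zo o) : R) : g_sigma_algebraType (pair_sets Y) -> R).
  exact: (@measurable_pair_sets_snd Y _ _ (\1_D : Zsp R d -> R)).
rewrite !pairE !pE.
- have -> : (\int[P]_o ((Y o - g (Zo o)) ^+ 2 * \1_D (Zo o) * p (Zo o))%:E =
      \int[P]_o (\1_D (Zo o) * p (Zo o) * (Y o - g (Zo o)) ^+ 2)%:E)%E.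
    by apply: eq_integral => o _; congr EFin; ring.
  have -> : (\int[P]_o (v (Zo o) * \1_D (Zo o) * p (Zo o))%:E =
      \int[P]_o (\1_D (Zo o) * p (Zo o) * v (Zo o))%:E)%E.
    by apply: eq_integral => o _; congr EFin; ring.
  (* [v] need not be integrable; the events where it is at most [k] give the sigma-finite
     exhaustion. *)
  have mvk k : measurable [set z | v z <= k%:R].
    rewrite -[X in measurable X]setTI; have := mv measurableT `]-oo, k%:R]%classic (measurable_itv _).
    by congr measurable.
  apply: (ge0_integral_pi_system (mu := P) z_sets_measurable z_sets_setI mxi2 (mcomp mv) _ _
    (g := fun k => Zo @^-1` [set z | v z <= k%:R])) => //.
  + by move=> o; exact: sqr_ge0.
  + by move=> k; exists [set z | v z <= k%:R].
  + apply/seteqP; split => // o _; exists (Num.truncn (v (Zo o))).+1 => //=.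
    by rewrite ltW// truncnS_gt.
  + move=> k; rewrite vE//.
    apply: (@le_lt_trans _ _ (\int[P]_(o in Zo @^-1` [set z | (v z <= k%:R)%R]) (k%:R)%:E)%E).
      apply: ge0_le_integral => //; first exact: mZD.
      - by move=> o _; rewrite lee_fin.
      - by apply/measurable_EFinP/measurable_funTS; exact: mcomp.
    rewrite integral_cst; last exact: mZD.
    by rewrite lte_mul_pinfty// ?lee_fin// (le_lt_trans (probability_le1 _ _)) ?ltry//; exact: mZD.
  + by move=> _ [D' mD' ->]; exact: vE.
  + apply: (@measurable_z_sets _ _ (fun z => \1_D z * p z)).
    exact: measurable_funM.
  + by move=> o; rewrite mulr_ge0.
- apply: measurable_funM => //; exact: (@measurable_pair_sets_snd Y _ _ v).
- by move=> o; rewrite mulr_ge0.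
- apply: measurable_funM => //; apply: (measurableT_comp (f := fun z : R => z ^+ 2)) => //.
  exact: measurable_resid.
- by move=> o; rewrite mulr_ge0// sqr_ge0.
Qed.

End conditional_independence.

Lemma cond_indep_fun_P0 (R : realType) d (P : probability (Obs R d) R) : cond_indep P ->
  cond_indep_fun P Xo Yo /\ cond_indep_fun P Yo Xo.
Proof.
move=> ciP; split => // B C mB mC pB pC cB cC.
rewrite (_ : (fun o => _) = (fun o => \1_C (Xo o) * \1_B (Yo o))); last first.
  by apply/funext => o; rewrite mulrC.
rewrite (_ : (fun z => _) = (fun z => pC z * pB z)); last by apply/funext => z; rewrite mulrC.
exact: ciP.
Qed.

(** * Noise terms of the regressions *)

Section markov_inequality.
Context d (T : measurableType d) (R : realType) (mu : probability T R).

Lemma markov_le (h : T -> R) (lam K : R) : measurable_fun setT h -> (forall x, 0 <= h x) ->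
  0 < lam -> (\int[mu]_x (h x)%:E <= K%:E)%E ->
  (mu [set x | (lam <= h x)%R] <= (K / lam)%:E)%E.
Proof.
move=> mh h0 lam0 hK.
have mE : measurable [set x | lam <= h x].
  rewrite -[X in measurable X]setTI; have := mh measurableT `[lam, +oo[%classic (measurable_itv _).
  by congr measurable; apply/seteqP; split => x /=; rewrite in_itv/= andbT.
have E : (lam%:E * mu [set x | (lam <= h x)%R] =
    \int[mu]_x (lam%:E * (\1_[set x | (lam <= h x)%R] x)%:E))%E.
  rewrite ge0_integralZl//; last by rewrite lee_fin ltW.
    by rewrite integral_indic// setIT.
  exact/measurable_EFinP.
have pfin : mu [set x | lam <= h x] \is a fin_num by exact: fin_num_measure.
suff : (lam%:E * mu [set x | (lam <= h x)%R] <= K%:E)%E.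
  by rewrite -(fineK pfin) -EFinM !lee_fin ler_pdivlMr// mulrC.
apply: le_trans hK; rewrite E.
apply: ge0_le_integral => //.
- by move=> x _; rewrite -EFinM lee_fin mulr_ge0// ltW.
- by apply: emeasurable_funM => //; exact/measurable_EFinP.
- exact/measurable_EFinP.
move=> x _; rewrite -EFinM lee_fin indicE; have [|_] := boolP (x \in _).
  by rewrite inE/= mulr1.
by rewrite mulr0.
Qed.

End markov_inequality.

(** * Second moments of conditionally centred sums *)

Section orthogonal_sum.
Context d1 d2 d3 (Omega : measurableType d1) (TA : measurableType d2)
  (TO : measurableType d3) (R : realType).
Variables (Pr : probability Omega R) (P : probability TO R).
Variables (O : nat -> Omega -> TO) (A : Omega -> TA).
Hypothesis mO : forall i, measurable_fun setT (O i).
Hypothesis mA : measurable_fun setT A.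
Hypothesis indep : forall n (S : nat -> set TO) (B : set TA),
  (forall i, measurable (S i)) -> measurable B ->
  Pr (A @^-1` B `&` \bigcap_(i in `I_n) (O i @^-1` S i)) =
  (Pr (A @^-1` B) * \prod_(i < n) P (S i))%E.

Variables (n : nat) (C : set (set TO)).
Hypothesis Cm : C `<=` measurable.
Hypothesis CI : setI_closed C.
Hypothesis CT : C setT.
Variables (phi psi : TO -> R).
Hypothesis iphi : P.-integrable setT (EFin \o phi).
Hypothesis mpsi : measurable_fun setT psi.
Hypothesis psi0 : forall o, 0 <= psi o.
Hypothesis phi_mean0 : forall E, C E -> (\int[P]_(o in E) (phi o)%:E = 0)%E.
Hypothesis phi_var : forall E, C E ->
  (\int[P]_(o in E) (phi o ^+ 2)%:E = \int[P]_(o in E) (psi o)%:E)%E.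
Hypothesis Cpsi : forall k : nat, C [set o | psi o <= k%:R].
Variables (U : nat -> Omega -> R) (kappa : R).
Hypothesis mU : forall i k, (i < n)%N -> (k < n)%N ->
  measurable_fun setT (U i : g_sigma_algebraType (cyl O A n k C) -> R).
Hypothesis Ukappa : forall w, \sum_(i < n) U i w ^+ 2 * psi (O i w) <= kappa.

Let mphi : measurable_fun setT phi.
Proof. by apply/measurable_EFinP; exact: measurable_int iphi. Qed.

Let mUT i : (i < n)%N -> measurable_fun setT (U i).
Proof. by move=> ltin; exact: (measurable_fun_g_sigma (@cyl_measurable _ _ _ _ _ _ _ _ mO mA n i C) (mU ltin ltin)). Qed.

Let mV i : (i < n)%N -> measurable_fun setT (fun w => U i w * phi (O i w)).
Proof. by move=> ltin; apply: measurable_funM; [exact: mUT|exact: measurableT_comp]. Qed.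

Let term_kappa i w : (i < n)%N -> 0 <= U i w ^+ 2 * psi (O i w) <= kappa.
Proof.
move=> ltin; rewrite mulr_ge0 ?sqr_ge0//=; apply: le_trans (Ukappa w).
rewrite (bigD1 (Ordinal ltin))//= lerDl sumr_ge0// => j _.
by rewrite mulr_ge0 ?sqr_ge0.
Qed.

Let var_term i : (i < n)%N ->
  (\int[Pr]_w ((U i w * phi (O i w)) ^+ 2)%:E = \int[Pr]_w (U i w ^+ 2 * psi (O i w))%:E)%E.
Proof.
move=> ltin; under eq_integral do rewrite exprMn.
apply: (ge0_integral_cyl mO mA indep ltin Cm CI (phi := fun o => phi o ^+ 2) (psi := psi)
  (g := fun k => [set o | psi o <= k%:R])) => //.
- exact: (measurableT_comp (f := fun z : R => z ^+ 2)).
- by move=> o; exact: sqr_ge0.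
- apply/seteqP; split => // o _; exists (Num.truncn (psi o)).+1 => //=.
  by rewrite ltW// truncnS_gt.
- move=> k; rewrite phi_var//.
  apply: (@le_lt_trans _ _ (\int[P]_(o in [set o | (psi o <= k%:R)%R]) (k%:R)%:E)%E).
    apply: ge0_le_integral => //; first exact: Cm.
    - by move=> o _; rewrite lee_fin.
    - by apply/measurable_EFinP/measurable_funTS.
  rewrite integral_cst; last exact: Cm.
  by rewrite lte_mul_pinfty// ?lee_fin// (le_lt_trans (probability_le1 _ _)) ?ltry//; exact: Cm.
- exact: (measurableT_comp (f := fun z : R => z ^+ 2) _ (mU ltin ltin)).
- by move=> w; exact: sqr_ge0.
Qed.

Let iterm i : (i < n)%N -> Pr.-integrable setT (EFin \o (fun w => U i w ^+ 2 * psi (O i w))).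
Proof.
move=> ltin; apply: (@bounded_integrable _ _ _ _ _ kappa).
  apply: measurable_funM; last exact: measurableT_comp.
  by apply: (measurableT_comp (f := fun z : R => z ^+ 2)) => //; exact: mUT.
by move=> w; have /andP[? ?] := term_kappa w ltin; rewrite ger0_norm.
Qed.

Let iV2 i : (i < n)%N -> Pr.-integrable setT (EFin \o (fun w => (U i w * phi (O i w)) ^+ 2)).
Proof.
move=> ltin; apply/integrableP; split.
  apply/measurable_EFinP; apply: (measurableT_comp (f := fun z : R => z ^+ 2)) => //.
  exact: mV.
under eq_integral => w _ do rewrite /= ger0_norm ?sqr_ge0//.
rewrite var_term//; have := integrable_fin_num measurableT (iterm ltin).
by rewrite fin_numElt => /andP[].
Qed.

Let iVV i j : (i < n)%N -> (j < n)%N ->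
  Pr.-integrable setT (EFin \o (fun w => (U i w * phi (O i w)) * (U j w * phi (O j w)))).
Proof.
move=> ltin ltjn.
have := integrableD measurableT (iV2 ltin) (iV2 ltjn).
apply: le_integrable => //.
  by apply/measurable_EFinP; apply: measurable_funM; exact: mV.
move=> w _; rewrite /= lee_fin.
set a := U i w * _; set b := U j w * _.
rewrite (ger0_norm (_ : 0 <= a ^+ 2 + b ^+ 2)); last by rewrite addr_ge0 ?sqr_ge0.
have := sqr_ge0 (a - b); have := sqr_ge0 (a + b); have := sqr_ge0 a; have := sqr_ge0 b.
rewrite ler_norml sqrrD sqrrB => *; apply/andP; split; lra.
Qed.

(** All factors except [phi (O i)] are measurable without the hidden part of [O i]: the coefficients
    by assumption, and [phi (O j)] because it belongs to another observation. Given that information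
    [phi (O i)] has mean 0. *)
Let cross i j : (i < n)%N -> (j < n)%N -> i != j ->
  \int[Pr]_w ((U i w * phi (O i w)) * (U j w * phi (O j w))) = 0.
Proof.
move=> ltin ltjn ij; rewrite /Rintegral.
have E : (fun w => (U i w * phi (O i w)) * (U j w * phi (O j w))) =
    (fun w => (U i w * (U j w * phi (O j w))) * phi (O i w)).
  by apply/funext => w; ring.
have := iVV ltin ltjn; rewrite E => iE.
have mh : measurable_fun setT ((fun w => U i w * (U j w * phi (O j w))) :
    g_sigma_algebraType (cyl O A n i C) -> R).
  apply: measurable_funM; first exact: mU.
  apply: measurable_funM; first exact: mU.
  by apply: (measurable_cyl_other CT) => //; rewrite eq_sym.
rewrite (_ : (\int[Pr]_x _)%E = 0%E)//.
rewrite -[RHS](integral0_cyl mO mA indep ltin CI CT iphi phi_mean0 mh iE).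
by apply: eq_integral => w _; congr EFin; ring.
Qed.

(** Conditioning replaces each square of [phi] by [psi], and the resulting sum is bounded pathwise
    by [kappa]. *)
Lemma orthogonal_sum_diag : (\int[Pr]_w (\sum_(i < n) (U i w * phi (O i w)) ^+ 2)%:E <= kappa%:E)%E.
Proof.
under eq_integral do rewrite -sumEFin.
rewrite ge0_integral_sum//; last 2 first.
- move=> i; apply/measurable_EFinP; apply: (measurableT_comp (f := fun z : R => z ^+ 2)) => //.
  exact: mV.
- by move=> i w _; rewrite lee_fin sqr_ge0.
under eq_bigr => i _ do rewrite var_term//.
rewrite -ge0_integral_sum//; last 2 first.
- by move=> i; have /integrableP[] := iterm (ltn_ord i).
- by move=> i w _; rewrite lee_fin; case/andP: (term_kappa w (ltn_ord i)).
apply: (@le_trans _ _ (\int[Pr]_w kappa%:E)%E).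
  apply: ge0_le_integral => //.
  - by move=> w _; apply: sume_ge0 => i _; rewrite lee_fin; case/andP: (term_kappa w (ltn_ord i)).
  - apply: emeasurable_sum => i; by have /integrableP[] := iterm (ltn_ord i).
  - by move=> w _; rewrite sumEFin lee_fin.
by rewrite integral_cst// [X in (_ * X)%E](probability_setT Pr) mule1.
Qed.

Lemma orthogonal_sum_sqr : (\int[Pr]_w ((\sum_(i < n) U i w * phi (O i w)) ^+ 2)%:E <= kappa%:E)%E.
Proof.
apply: le_trans orthogonal_sum_diag.
have isum (F : 'I_n -> Omega -> R) (s : seq 'I_n) :
    (forall i, Pr.-integrable setT (EFin \o F i)) ->
    Pr.-integrable setT (EFin \o (fun w => \sum_(i <- s) F i w)) /\
    \int[Pr]_w (\sum_(i <- s) F i w) = \sum_(i <- s) \int[Pr]_w F i w.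
  move=> iF; elim: s => [|i s [IH1 IH2]].
    have E0 : (fun w => \sum_(i <- [::]) F i w) = (fun=> 0) by apply/funext => w; rewrite big_nil.
    rewrite E0 big_nil Rintegral_cst_prob; split => //.
    exact: finite_measure_integrable_cst.
  have Es : (fun w => \sum_(j <- i :: s) F j w) = (fun w => F i w + \sum_(j <- s) F j w).
    by apply/funext => w; rewrite big_cons.
  rewrite Es big_cons -IH2; split; first exact: (integrableD measurableT (iF i) IH1).
  exact: RintegralD.
pose F (i j : 'I_n) w := (U i w * phi (O i w)) * (U j w * phi (O j w)).
have iF i j : Pr.-integrable setT (EFin \o F i j) by exact: iVV.
have iFi i := isum (F i) (index_enum 'I_n) (iF i).
have iFF := isum (fun i w => \sum_j F i j w) (index_enum 'I_n) (fun i => (iFi i).1).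
have E1 : (fun w => (\sum_(i < n) U i w * phi (O i w)) ^+ 2) = (fun w => \sum_i \sum_j F i j w).
  apply/funext => w; rewrite expr2 big_distrl/=; apply: eq_bigr => i _.
  by rewrite big_distrr.
have E2 : (fun w => \sum_(i < n) (U i w * phi (O i w)) ^+ 2) = (fun w => \sum_i F i i w).
  by apply/funext => w; apply: eq_bigr => i _; rewrite expr2.
have iD := isum (fun i => F i i) (index_enum 'I_n) (fun i => iF i i).
have -> : (\int[Pr]_w ((\sum_(i < n) U i w * phi (O i w)) ^+ 2)%:E =
    (\int[Pr]_w (\sum_i \sum_j F i j w)%R)%:E)%E.
  rewrite EFin_Rintegral; last exact: iFF.1.
  by apply: eq_integral => w _; have := congr1 (fun h => h w) E1 => /= ->.
have -> : (\int[Pr]_w (\sum_(i < n) (U i w * phi (O i w)) ^+ 2)%:E =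
    (\int[Pr]_w (\sum_i F i i w)%R)%:E)%E.
  rewrite EFin_Rintegral; last exact: iD.1.
  by apply: eq_integral => w _; have := congr1 (fun h => h w) E2 => /= ->.
rewrite lee_fin iFF.2 iD.2 le_eqVlt; apply/orP; left; apply/eqP.
apply: eq_bigr => i _; rewrite (iFi i).2 (bigD1 i)//= big1 ?addr0// => j ji.
by rewrite /F cross// eq_sym.
Qed.

End orthogonal_sum.

Section regression_measurability.
Context (R : realType) (d : nat) d1 d2 (Omega : measurableType d1) (TA : measurableType d2).
Variables (O : nat -> Omega -> Obs R d) (A : Omega -> TA).

Lemma measurable_cyl_pair_fst (V : Obs R d -> R) n k i : measurable_fun setT V ->
  (i < n)%N -> (k < n)%N ->
  measurable_fun setT ((V \o O i) : g_sigma_algebraType (cyl O A n k (pair_sets V)) -> R).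
Proof.
move=> mV ltin ltkn; have [->|ik] := eqVneq i k; last first.
  exact: (measurable_cyl_other (pair_sets_setT V)).
apply: (measurable_cyl_this ltkn (pair_sets_measurable mV)) => D mD.
by exists D, setT; split => //; rewrite preimage_setT setIT.
Qed.

Lemma measurable_cyl_pair_snd (V : Obs R d -> R) n k i : measurable_fun setT V ->
  (i < n)%N -> (k < n)%N ->
  measurable_fun setT ((Zo \o O i) : g_sigma_algebraType (cyl O A n k (pair_sets V)) -> Zsp R d).
Proof.
move=> mV ltin ltkn; have [->|ik] := eqVneq i k; last first.
  by apply: (measurable_cyl_other (pair_sets_setT V)) => //; exact: measurable_Zo.
apply: (measurable_cyl_this ltkn (pair_sets_measurable mV)) => D mD.
by exists setT, D; split => //; rewrite preimage_setT setTI.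
Qed.

(** Data entering only through (V, Z) reveal nothing more about any single observation, so their
    sigma-algebra lies below the cylinder one whichever index [k] is singled out. *)
Let gen_cyl (V : Obs R d -> R) (G : set (set Omega)) n k : measurable_fun setT V -> (k < n)%N ->
  (forall E, G E -> exists i, (i < n)%N /\
     ((exists B : set R, measurable B /\ E = (V \o O i) @^-1` B) \/
      (exists B : set (Zsp R d), measurable B /\ E = (Zo \o O i) @^-1` B))) ->
  <<s G >> `<=` <<s cyl O A n k (pair_sets V) >>.
Proof.
move=> mV ltkn GE; apply: smallest_sub; first exact: smallest_sigma_algebra.
move=> E /GE[i [ltin [|] [B [mB ->]]]].
  by have := measurable_cyl_pair_fst mV ltin ltkn measurableT mB; rewrite setTI.
by have := measurable_cyl_pair_snd mV ltin ltkn measurableT mB; rewrite setTI.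
Qed.

Lemma regression_XZ_measurable fhat n i k : regression_XZ O fhat -> (i < n)%N -> (k < n)%N ->
  measurable_fun setT ((fun w => fhat n w (zs O i w)) :
    g_sigma_algebraType (cyl O A n k (pair_sets Xo)) -> R).
Proof.
move=> reg ltin ltkn _ B mB; rewrite setTI.
by apply: (gen_cyl (@measurable_Xo R d) ltkn _ (reg n i ltin B mB)) => E.
Qed.

Lemma regression_YZ_measurable ghat n i k : regression_YZ O ghat -> (i < n)%N -> (k < n)%N ->
  measurable_fun setT ((fun w => ghat n w (zs O i w)) :
    g_sigma_algebraType (cyl O A n k (pair_sets Yo)) -> R).
Proof.
move=> reg ltin ltkn _ B mB; rewrite setTI.
by apply: (gen_cyl (@measurable_Yo R d) ltkn _ (reg n i ltin B mB)) => E.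
Qed.

End regression_measurability.

Section noise_terms.
Context (R : realType) (d : nat) d1 d2 (Omega : measurableType d1) (TA : measurableType d2).
Variables (O : nat -> Omega -> Obs R d) (A : Omega -> TA).
Variables (Pr : probability Omega R) (P : probability (Obs R d) R).
Hypothesis iid : iid_indep O A Pr P.
Variables (V V' : Obs R d -> R).
Hypothesis mV : measurable_fun setT V.
Hypothesis mV' : measurable_fun setT V'.
Hypothesis ci : cond_indep_fun P V V'.
Variables (f g v : Zsp R d -> R).
Hypothesis mf : measurable_fun setT f.
Hypothesis cg : cond_exp P V' g.
Hypothesis cv : cond_exp_nonneg P (fun o => (V' o - g (Zo o)) ^+ 2) v.
Variables (n : nat) (fit : nat -> Omega -> R) (wt : TA -> Zsp R d -> R) (C : R).
Hypothesis n0 : (0 < n)%N.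
Hypothesis mfit : forall i k, (i < n)%N -> (k < n)%N ->
  measurable_fun setT (fit i : g_sigma_algebraType (cyl O A n k (pair_sets V)) -> R).
Hypothesis mwt : measurable_fun setT (fun p : TA * Zsp R d => wt p.1 p.2).
Hypothesis wtC : forall a z, `|wt a z| <= C.

Let D i w := f (Zo (O i w)) - fit i w.
Let B w := n%:R^-1 * \sum_(i < n) D i w ^+ 2 * v (Zo (O i w)).
(** The indicator depends on the data only through the fits and the Z's, so it keeps the
    coefficients measurable for the conditioning; it makes the sum of [Q ^+ 2 * v] at most C^2 n
    delta on every outcome. *)
Let Q delta i w := D i w * wt (A w) (Zo (O i w)) * (B w <= delta)%R%:R.

Let mZc (u : Zsp R d -> R) i k : measurable_fun setT u -> (i < n)%N -> (k < n)%N ->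
  measurable_fun setT ((fun w => u (Zo (O i w))) : g_sigma_algebraType (cyl O A n k (pair_sets V)) -> R).
Proof.
move=> mu ltin ltkn.
have H := @measurable_cyl_pair_snd _ _ _ _ _ _ O A V n k i mV ltin ltkn.
have H2 := measurableT_comp mu H; exact H2.
Qed.

Let mD i k : (i < n)%N -> (k < n)%N ->
  measurable_fun setT (D i : g_sigma_algebraType (cyl O A n k (pair_sets V)) -> R).
Proof.
move=> ltin ltkn; apply: measurable_funB; last exact: mfit.
exact: mZc.
Qed.

Let mv : measurable_fun setT v. Proof. exact: cv.2.1. Qed.
Let v0 z : 0 <= v z. Proof. exact: cv.2.2.1. Qed.

Let mB k : (k < n)%N ->
  measurable_fun setT (B : g_sigma_algebraType (cyl O A n k (pair_sets V)) -> R).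
Proof.
move=> ltkn; apply: measurable_funM => //; apply: measurable_sum => i.
apply: measurable_funM.
  exact: (measurableT_comp (f := fun z : R => z ^+ 2) _ (mD (ltn_ord i) ltkn)).
exact: (@mZc _ i k mv).
Qed.

Let mQ delta i k : (i < n)%N -> (k < n)%N ->
  measurable_fun setT (Q delta i : g_sigma_algebraType (cyl O A n k (pair_sets V)) -> R).
Proof.
move=> ltin ltkn; apply: measurable_funM; last first.
  rewrite (_ : (fun w => _) = (\1_(`]-oo, delta]) : R -> R) \o B); last first.
    by apply/funext => w; rewrite /= indicE mem_setE in_itv.
  apply: (measurableT_comp (f := (\1_(`]-oo, delta]) : R -> R))); last exact: mB.
  exact: measurable_indic.
apply: measurable_funM; first exact: mD.
have H1 : measurable_fun setT (A : g_sigma_algebraType (cyl O A n k (pair_sets V)) -> TA).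
  exact: (measurable_cyl_ctx (pair_sets_setT V) (u := id)).
have H2 := @measurable_cyl_pair_snd _ _ _ _ _ _ O A V n k i mV ltin ltkn.
have H3 := measurableT_comp mwt (measurable_fun_pair H1 H2).
exact H3.
Qed.

Let C0 : 0 <= C.
Proof. by apply: le_trans (wtC point point); exact: normr_ge0. Qed.

Let Qsum delta w : 0 <= delta -> \sum_(i < n) Q delta i w ^+ 2 * v (Zo (O i w)) <= C ^+ 2 * (n%:R * delta).
Proof.
move=> delta0; rewrite /Q; case: (leP (B w) delta) => Bd; last first.
  rewrite big1 ?mulr_ge0 ?sqr_ge0// => i _.
  by rewrite mulr0 expr0n mul0r.
have rn0 : 0 < (n%:R : R) by rewrite ltr0n.
have : \sum_(i < n) D i w ^+ 2 * v (Zo (O i w)) <= n%:R * delta.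
  by rewrite -ler_pdivrMl.
move=> S1; apply: le_trans (ler_wpM2l (sqr_ge0 C) S1); rewrite mulr_sumr.
apply: ler_sum => i _; rewrite mulr1 mulrA ler_wpM2r// exprMn mulrC ler_wpM2r ?sqr_ge0//.
by rewrite -real_normK ?num_real// lerXn2r ?nnegrE.
Qed.

Let phi o := V' o - g (Zo o).

Let noise_terms delta : 0 <= delta ->
  (\int[Pr]_w ((\sum_(i < n) Q delta i w * phi (O i w)) ^+ 2)%:E <= (C ^+ 2 * (n%:R * delta))%:E)%E /\
  (\int[Pr]_w (\sum_(i < n) (Q delta i w * phi (O i w)) ^+ 2)%:E <= (C ^+ 2 * (n%:R * delta))%:E)%E.
Proof.
move=> delta0; have [mO [mA indep]] := iid.
have mvZ : measurable_fun setT (fun o : Obs R d => v (Zo o)).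
  exact: (measurableT_comp mv (@measurable_Zo R d)).
have mean0 E : pair_sets V E -> (\int[P]_(o in E) (phi o)%:E = 0)%E by exact: ci_mean0.
have var E : pair_sets V E ->
    (\int[P]_(o in E) (phi o ^+ 2)%:E = \int[P]_(o in E) (v (Zo o))%:E)%E.
  by move=> VE; apply: (ci_var mV mV' ci cg.1 cv VE).
have Cpsi k : pair_sets V [set o | v (Zo o) <= k%:R].
  exists setT, [set z | v z <= k%:R]; split => //; last by rewrite preimage_setT setTI.
  rewrite -[X in measurable X]setTI; have := mv measurableT (measurable_itv `]-oo, k%:R]).
  by congr measurable.
split.
- apply: (@orthogonal_sum_sqr _ _ _ _ _ _ _ Pr P O A mO mA indep n (pair_sets V)
    (pair_sets_measurable mV) (pair_sets_setI (V := V)) (pair_sets_setT V) phi (v \o Zo)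
    (integrable_resid mV' cg) mvZ (fun o => v0 (Zo o)) mean0 var Cpsi (Q delta)) => //.
    by move=> i k ltin ltkn; exact: mQ.
  by move=> w; exact: Qsum.
- apply: (@orthogonal_sum_diag _ _ _ _ _ _ _ Pr P O A mO mA indep n (pair_sets V)
    (pair_sets_measurable mV) (pair_sets_setI (V := V)) phi (v \o Zo)
    (integrable_resid mV' cg) mvZ (fun o => v0 (Zo o)) var Cpsi (Q delta)) => //.
    by move=> i k ltin ltkn; exact: mQ.
  by move=> w; exact: Qsum.
Qed.

Let mT (F : Omega -> R) : (forall k, (k < n)%N ->
    measurable_fun setT (F : g_sigma_algebraType (cyl O A n k (pair_sets V)) -> R)) ->
  measurable_fun setT F.
Proof.
have [mO [mA _]] := iid.
by move=> mF; exact: (measurable_fun_g_sigma (@cyl_measurable _ _ _ _ _ _ _ _ mO mA n 0%N _) (mF 0%N n0)).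
Qed.

Let mphi : measurable_fun setT phi.
Proof. by apply/measurable_EFinP; exact: measurable_int (integrable_resid mV' cg). Qed.

Let mDw i : (i < n)%N ->
  measurable_fun setT (fun w => D i w * wt (A w) (Zo (O i w)) * phi (O i w)).
Proof.
have [mO [mA _]] := iid; move=> ltin.
apply: measurable_funM; last exact: measurableT_comp.
apply: measurable_funM; first by apply: mT => k; exact: mD.
have H2 : measurable_fun setT (fun w => (A w, Zo (O i w))).
  by apply: measurable_fun_pair => //; exact: (measurableT_comp (@measurable_Zo R d) (mO i)).
have H3 := measurableT_comp mwt H2; exact H3.
Qed.

Let mBT : measurable_fun setT B. Proof. by apply: mT => k; exact: mB. Qed.

Let mle (h : Omega -> R) a : measurable_fun setT h -> measurable [set w | h w <= a].
Proof.
move=> mh; rewrite -[X in measurable X]setTI.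
by have := mh measurableT _ (measurable_itv `]-oo, a]); congr measurable.
Qed.

Let mge (h : Omega -> R) a : measurable_fun setT h -> measurable [set w | a <= h w].
Proof.
move=> mh; rewrite -[X in measurable X]setTI.
have := mh measurableT _ (measurable_itv `[a, +oo[); congr measurable.
by apply/seteqP; split => x /=; rewrite in_itv/= andbT.
Qed.

Let QE delta i w : B w <= delta -> Q delta i w = D i w * wt (A w) (Zo (O i w)).
Proof. by move=> Bd; rewrite /Q Bd mulr1. Qed.

Let mQT delta i : (i < n)%N -> measurable_fun setT (fun w => Q delta i w * phi (O i w)).
Proof.
have [mO [mA _]] := iid; move=> ltin.
by apply: measurable_funM; [apply: mT => k; exact: mQ|exact: measurableT_comp].
Qed.

Let rn0 : 0 < (n%:R : R). Proof. by rewrite ltr0n. Qed.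

(** On the event that [B] is at most [delta] the truncated coefficients are the original ones, so
    Markov's inequality for the square of their sum applies. *)
Lemma noise_sum_prob delta e : 0 <= delta -> 0 < e ->
  (Pr [set w | (n%:R^-1 * \sum_(i < n) (f (Zo (O i w)) - fit i w) ^+ 2 * v (Zo (O i w)) <= delta)%R /\
     (e <= `|(Num.sqrt n%:R)^-1 * \sum_(i < n)
       (f (Zo (O i w)) - fit i w) * wt (A w) (Zo (O i w)) * (V' (O i w) - g (Zo (O i w)))|)%R]
   <= (C ^+ 2 * delta / e ^+ 2)%:E)%E.
Proof.
move=> delta0 e0; have [H _] := noise_terms delta0.
have lam0 : 0 < n%:R * e ^+ 2 by rewrite mulr_gt0// exprn_gt0.
have mS : measurable_fun setT (fun w => (\sum_(i < n) Q delta i w * phi (O i w)) ^+ 2).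
  apply: (measurableT_comp (f := fun z : R => z ^+ 2)) => //.
  by apply: measurable_sum => i; exact: mQT.
have := markov_le mS (fun w => sqr_ge0 _) lam0 H.
have -> : C ^+ 2 * (n%:R * delta) / (n%:R * e ^+ 2) = C ^+ 2 * delta / e ^+ 2.
  by field; rewrite !lt0r_neq0.
apply: le_trans; apply: le_measure; rewrite ?inE.
- rewrite (_ : [set w | _] = [set w | B w <= delta] `&` [set w | e <=
    `|(Num.sqrt n%:R)^-1 * \sum_(i < n) D i w * wt (A w) (Zo (O i w)) * phi (O i w)|])//.
  apply: measurableI; first exact: mle.
  apply: mge; apply: measurableT_comp => //; apply: measurable_funM => //.
  by apply: measurable_sum => i; exact: mDw.
- exact: mge.
- move=> w /= [Bd ew].
  under eq_bigr => i _ do rewrite QE//.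
  rewrite normrM in ew.
  have s0 : 0 < (Num.sqrt n%:R : R) by rewrite sqrtr_gt0.
  have {}ew : e * Num.sqrt n%:R <= `|\sum_(i < n) D i w * wt (A w) (Zo (O i w)) * phi (O i w)|.
    by rewrite -ler_pdivlMr// mulrC -(gtr0_norm (_ : 0 < (Num.sqrt n%:R)^-1)) ?invr_gt0.
  rewrite -[leRHS]real_normK ?num_real//.
  have -> : n%:R * e ^+ 2 = (e * Num.sqrt n%:R) ^+ 2 by rewrite exprMn sqr_sqrtr ?ler0n// mulrC.
  by rewrite lerXn2r ?nnegrE// mulr_ge0 ?ltW.
Qed.

(** The counterpart for the denominator, where the squares themselves are summed: their expectation
    is the diagonal part of the same second moment. *)
Lemma noise_sqr_prob delta e : 0 <= delta -> 0 < e ->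
  (Pr [set w | (n%:R^-1 * \sum_(i < n) (f (Zo (O i w)) - fit i w) ^+ 2 * v (Zo (O i w)) <= delta)%R /\
     (e <= n%:R^-1 * \sum_(i < n)
       ((f (Zo (O i w)) - fit i w) * wt (A w) (Zo (O i w)) * (V' (O i w) - g (Zo (O i w)))) ^+ 2)%R]
   <= (C ^+ 2 * delta / e)%:E)%E.
Proof.
move=> delta0 e0; have [_ H] := noise_terms delta0.
have lam0 : 0 < n%:R * e by rewrite mulr_gt0.
have mS : measurable_fun setT (fun w => \sum_(i < n) (Q delta i w * phi (O i w)) ^+ 2).
  apply: measurable_sum => i; apply: (measurableT_comp (f := fun z : R => z ^+ 2)) => //.
  exact: mQT.
have S0 w : 0 <= \sum_(i < n) (Q delta i w * phi (O i w)) ^+ 2.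
  by apply: sumr_ge0 => i _; exact: sqr_ge0.
have := markov_le mS S0 lam0 H.
have -> : C ^+ 2 * (n%:R * delta) / (n%:R * e) = C ^+ 2 * delta / e.
  by field; rewrite !lt0r_neq0.
apply: le_trans; apply: le_measure; rewrite ?inE.
- rewrite (_ : [set w | _] = [set w | B w <= delta] `&` [set w | e <=
    n%:R^-1 * \sum_(i < n) (D i w * wt (A w) (Zo (O i w)) * phi (O i w)) ^+ 2])//.
  apply: measurableI; first exact: mle.
  apply: mge; apply: measurable_funM => //.
  apply: measurable_sum => i; apply: (measurableT_comp (f := fun z : R => z ^+ 2)) => //.
  exact: mDw.
- exact: mge.
- move=> w /= [Bd ew].
  under eq_bigr => i _ do rewrite QE//.
  by rewrite -ler_pdivlMl.
Qed.

End noise_terms.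

(** * The weighted sum of residual products *)

Section weighted_sum.
Context d1 d2 d3 (Omega : measurableType d1) (TA : measurableType d2)
  (TO : measurableType d3) (R : realType).
Variables (Pr : probability Omega R) (P : probability TO R).
Variables (O : nat -> Omega -> TO) (A : Omega -> TA).
Hypothesis mO : forall i, measurable_fun setT (O i).
Hypothesis mA : measurable_fun setT A.
Hypothesis indep : forall n (S : nat -> set TO) (B : set TA),
  (forall i, measurable (S i)) -> measurable B ->
  Pr (A @^-1` B `&` \bigcap_(i in `I_n) (O i @^-1` S i)) =
  (Pr (A @^-1` B) * \prod_(i < n) P (S i))%E.

Variables (r : TO -> R) (W : TA * TO -> R) (C K tau : R).
Hypothesis mr : measurable_fun setT r.
Hypothesis mW : measurable_fun setT W.
Hypothesis C0 : 0 < C.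
Hypothesis K0 : 0 < K.
Hypothesis WC : forall p, `|W p| <= C.
Hypothesis ir2 : P.-integrable setT (EFin \o (fun o => r o ^+ 2)).
Hypothesis mean0 : forall a, \int[P]_o (r o * W (a, o)) = 0.
Let tail o := r o ^+ 2 * (K < `|r o|)%R%:R.
Hypothesis tailE : \int[P]_o (r o ^+ 2 * (K < `|r o|)%R%:R) <= tau.

(** For the residual products and the estimated weights this is the conditional variance bar
    sigma_n^2, as a function of the value of [A]. *)
Definition cond_var (a : TA) : R := \int[P]_o ((r o * W (a, o)) ^+ 2).

Let mWa a : measurable_fun setT (fun o => W (a, o)).
Proof. exact: measurableT_comp. Qed.

Let mb : measurable_fun setT (fun o => (K < `|r o|)%R%:R : R).
Proof.
rewrite (_ : (fun o => _) = (\1_(`]K, +oo[) : R -> R) \o (fun o => `|r o|)); last first.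
  by apply/funext => o; rewrite /= indicE mem_setE in_itv/= andbT.
by apply: (measurableT_comp (f := (\1_(`]K, +oo[) : R -> R))) => //; exact: measurableT_comp.
Qed.

Let b01 (b : bool) : 0 <= (b%:R : R) <= 1. Proof. by case: b; rewrite !lexx ler01. Qed.

Let mr2 : measurable_fun setT (fun o => r o ^+ 2).
Proof. exact: (measurableT_comp (f := fun z : R => z ^+ 2)). Qed.

Let mtail : measurable_fun setT tail. Proof. exact: measurable_funM. Qed.

Let tail0 o : 0 <= tail o.
Proof. by have /andP[? _] := b01 (K < `|r o|); rewrite mulr_ge0 ?sqr_ge0. Qed.

Let itail : P.-integrable setT (EFin \o tail).
Proof.
apply: (le_integrable measurableT _ _ ir2); first exact/measurable_EFinP.
move=> o _; rewrite lee_fin ger0_norm ?tail0// ger0_norm ?sqr_ge0//.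
by have /andP[_ ?] := b01 (K < `|r o|); rewrite ler_piMr ?sqr_ge0.
Qed.

Let tau0 : 0 <= tau.
Proof. by apply: le_trans tailE; apply: Rintegral_ge0 => o _; exact: tail0. Qed.

Let rW2 a o : (r o * W (a, o)) ^+ 2 <= C ^+ 2 * r o ^+ 2.
Proof.
rewrite exprMn mulrC ler_wpM2r ?sqr_ge0// -real_normK ?num_real//.
by rewrite lerXn2r ?nnegrE// ltW.
Qed.

Let mrW : measurable_fun setT (fun p : TA * TO => r p.2 * W p).
Proof. by apply: measurable_funM => //; exact: measurableT_comp. Qed.

Let mrWa a : measurable_fun setT (fun o => r o * W (a, o)).
Proof. exact: measurable_funM. Qed.

Let iC2 : P.-integrable setT (EFin \o (fun o => C ^+ 2 * r o ^+ 2)).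
Proof. by have := integrableZl measurableT (C ^+ 2) ir2. Qed.

Let irW2 a : P.-integrable setT (EFin \o (fun o => (r o * W (a, o)) ^+ 2)).
Proof.
apply: (le_integrable measurableT _ _ iC2).
  by apply/measurable_EFinP; exact: (measurableT_comp (f := fun z : R => z ^+ 2)).
move=> o _; rewrite lee_fin ger0_norm ?sqr_ge0// ger0_norm ?rW2//.
by rewrite mulr_ge0 ?sqr_ge0.
Qed.

Let irW a : P.-integrable setT (EFin \o (fun o => r o * W (a, o))).
Proof.
have i1 : P.-integrable setT (EFin \o (fun=> 1 : R)) by exact: finite_measure_integrable_cst.
have := integrableD measurableT i1 (irW2 a); apply: le_integrable => //.
  by apply/measurable_EFinP.
move=> o _; rewrite /= lee_fin; set x := r o * _.
rewrite (ger0_norm (_ : 0 <= 1 + x ^+ 2)) ?addr_ge0 ?sqr_ge0//.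
have := sqr_ge0 (x - 1); have := sqr_ge0 (x + 1); have := sqr_ge0 x.
by rewrite ler_norml sqrrB sqrrD => *; apply/andP; split; lra.
Qed.

Lemma cond_var_ge0 a : 0 <= cond_var a.
Proof. by apply: Rintegral_ge0 => o _; exact: sqr_ge0. Qed.

Lemma cond_var_le a : cond_var a <= C ^+ 2 * (K ^+ 2 + tau).
Proof.
have i1 : P.-integrable setT (EFin \o (fun=> K ^+ 2)) by exact: finite_measure_integrable_cst.
have i2 : P.-integrable setT (EFin \o (fun o => K ^+ 2 + tail o)).
  exact: (integrableD measurableT i1 itail).
apply: (@le_trans _ _ (\int[P]_o (C ^+ 2 * (K ^+ 2 + tail o)))).
  apply: le_Rintegral => //; first by have := integrableZl measurableT (C ^+ 2) i2.
  move=> o _; apply: (le_trans (rW2 a o)); rewrite ler_wpM2l ?sqr_ge0// /tail.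
  case: (ltP K `|r o|) => rK; first by rewrite mulr1 lerDr sqr_ge0.
  by rewrite mulr0 addr0 -real_normK ?num_real// lerXn2r ?nnegrE// ltW.
by rewrite RintegralZl// RintegralD// Rintegral_cst_prob ler_wpM2l ?sqr_ge0// lerD2l.
Qed.

Let measurable_int_a (h : TA * TO -> R) : measurable_fun setT h -> (forall p, 0 <= h p) ->
  measurable_fun setT (fun a => \int[P]_o h (a, o)).
Proof.
move=> mh h0; apply: (@measurableT_comp _ _ _ _ _ _ (fine : \bar R -> R)) => //.
apply: (measurable_fun_fubini_tonelli_F (m2 := P) (EFin \o h)) => //; first exact/measurable_EFinP.
Qed.

Lemma measurable_cond_var : measurable_fun setT cond_var.
Proof.
apply: (@measurable_int_a (fun p => (r p.2 * W p) ^+ 2)); last by move=> p; exact: sqr_ge0.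
exact: (measurableT_comp (f := fun z : R => z ^+ 2)).
Qed.

Variables (n : nat) (c : R).
Hypothesis n0 : (0 < n)%N.
Hypothesis c0 : 0 < c.

Let rn0 : 0 < (n%:R : R). Proof. by rewrite ltr0n. Qed.

Definition var_good : set TA := [set a | c <= cond_var a].

Lemma measurable_var_good : measurable var_good.
Proof.
rewrite -[X in measurable X]setTI.
have := measurable_cond_var measurableT (measurable_itv `[c, +oo[); congr measurable.
by apply/seteqP; split => x /=; rewrite in_itv/= andbT.
Qed.

(** The normalisation uses the conditional standard deviation, a function of [A]: given a good value
    of [A] the variance is exactly 1/n, as the replacement argument requires. *)
Definition std_term (p : TA * TO) : R := r p.2 * W p / (Num.sqrt n%:R * Num.sqrt (cond_var p.1)).

Lemma measurable_std_term : measurable_fun setT std_term.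
Proof.
rewrite (_ : std_term = fun p => r p.2 * W p * ((Num.sqrt n%:R)^-1 * (cond_var p.1) `^ (- 2^-1))).
  apply: measurable_funM => //; apply: measurable_funM => //.
  apply: (measurableT_comp (f := fun x : R => x `^ (- 2^-1))); first exact: measurable_powR.
  by apply: measurableT_comp => //; exact: measurable_cond_var.
apply/funext => p; rewrite /std_term powRN powR12_sqrt ?cond_var_ge0//.
by rewrite invfM.
Qed.

Let wscale a : R := (Num.sqrt n%:R * Num.sqrt (cond_var a))^-1.

Let std_termE a o : std_term (a, o) = wscale a * (r o * W (a, o)).
Proof. by rewrite /std_term mulrC. Qed.

Let wscale2 a : var_good a -> wscale a ^+ 2 = (n%:R * cond_var a)^-1.
Proof.
move=> ca; rewrite /wscale exprVn exprMn !sqr_sqrtr ?ler0n//.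
exact: cond_var_ge0.
Qed.

Let cv0 a : var_good a -> 0 < cond_var a.
Proof. exact: lt_le_trans. Qed.

Let std_int a : P.-integrable setT (EFin \o (fun o => std_term (a, o))).
Proof.
rewrite (_ : (fun o => std_term (a, o)) = fun o => wscale a * (r o * W (a, o))).
  by have := integrableZl measurableT (wscale a) (irW a).
by apply/funext => o; rewrite std_termE.
Qed.

Let std_mean a : \int[P]_o std_term (a, o) = 0.
Proof.
under eq_Rintegral do rewrite std_termE.
by rewrite RintegralZl// mean0 mulr0.
Qed.

Let std_sqrE a : (fun o => std_term (a, o) ^+ 2) = fun o => wscale a ^+ 2 * (r o * W (a, o)) ^+ 2.
Proof. by apply/funext => o; rewrite std_termE exprMn. Qed.

Let std_int2 a : P.-integrable setT (EFin \o (fun o => std_term (a, o) ^+ 2)).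
Proof. by rewrite std_sqrE; have := integrableZl measurableT (wscale a ^+ 2) (irW2 a). Qed.

Let std_var a : var_good a -> \int[P]_o (std_term (a, o) ^+ 2) = n%:R^-1.
Proof.
move=> ca; rewrite std_sqrE RintegralZl// -/(cond_var a) wscale2//.
by rewrite invfM mulfVK// lt0r_neq0// cv0.
Qed.

Let wscale_le a : var_good a -> 0 <= wscale a <= (Num.sqrt (n%:R * c))^-1.
Proof.
move=> ca; have cva := cv0 ca.
rewrite /wscale invr_ge0 mulr_ge0 ?sqrtr_ge0//=.
rewrite -sqrtrM ?ler0n// lef_pV2 ?posrE ?sqrtr_gt0 ?mulr_gt0//.
by rewrite ler_wsqrtr// ler_pM2l.
Qed.

(** Below the level [K], one factor of the cube is at most C K / sqrt(n c) and the other two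
    integrate to at most 1/n. Above [K], the quadratic branch is at most C^2 r^2 / (n c), whose
    integral is controlled by [tau]. *)
Let std_rem a : var_good a -> \int[P]_o taylor_rem (std_term (a, o)) <=
  (C * K / Num.sqrt (n%:R * c) + C ^+ 2 * tau / c) / n%:R.
Proof.
move=> ca; have cva := cv0 ca; have /andP[ws0 ws1] := wscale_le ca.
have mst : measurable_fun setT (fun o => std_term (a, o)).
  by apply/measurable_EFinP; exact: measurable_int (std_int a).
have irem : P.-integrable setT (EFin \o (fun o => taylor_rem (std_term (a, o)))).
  apply: (le_integrable measurableT _ _ (std_int2 a)).
    by apply/measurable_EFinP; exact: measurableT_comp measurable_taylor_rem mst.
  move=> o _; rewrite lee_fin ger0_norm ?taylor_rem_ge0// ger0_norm ?sqr_ge0//.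
  exact: taylor_rem_le_sqr.
set q := C * K / _.
have q0 : 0 <= q by rewrite divr_ge0 ?mulr_ge0 ?sqrtr_ge0// ltW.
set l := C ^+ 2 / (n%:R * c).
have i1 : P.-integrable setT (EFin \o (fun o => q * std_term (a, o) ^+ 2)).
  by have := integrableZl measurableT q (std_int2 a).
have i2 : P.-integrable setT (EFin \o (fun o => l * tail o)).
  by have := integrableZl measurableT l itail.
have i12 := integrableD measurableT i1 i2.
apply: (@le_trans _ _ (\int[P]_o (q * std_term (a, o) ^+ 2 + l * tail o))).
  apply: le_Rintegral => // o _; rewrite /tail.
  case: (ltP K `|r o|) => rK.
    rewrite mulr1; apply: (le_trans (taylor_rem_le_sqr _)).
    apply: (@le_trans _ _ (l * r o ^+ 2)); last by rewrite lerDr mulr_ge0 ?sqr_ge0.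
    rewrite std_termE exprMn wscale2//.
    apply: (@le_trans _ _ ((n%:R * cond_var a)^-1 * (C ^+ 2 * r o ^+ 2))).
      by rewrite ler_wpM2l// invr_ge0 mulr_ge0// ltW.
    rewrite mulrA ler_wpM2r ?sqr_ge0// mulrC /l ler_wpM2l ?sqr_ge0//.
    by rewrite lef_pV2 ?posrE ?mulr_gt0// ler_pM2l.
  rewrite mulr0 mulr0 addr0 /taylor_rem ge_min; apply/orP; left.
  rewrite exprS -[X in _ * X <= _]normrX (ger0_norm (sqr_ge0 _)) ler_wpM2r ?sqr_ge0//.
  rewrite std_termE !normrM (ger0_norm ws0) /q mulrC ler_pM ?mulr_ge0//.
  by rewrite mulrC ler_pM.
rewrite RintegralD// !RintegralZl// std_var// mulrDl lerD//.
have -> : C ^+ 2 * tau / c / n%:R = l * tau.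
  by rewrite /l; field; rewrite !lt0r_neq0.
apply: ler_wpM2l => //.
by rewrite /l divr_ge0 ?sqr_ge0// mulr_ge0// ltW.
Qed.

(** The remainder of each data term carries a factor 1/n and the Gaussian one is of order n^(-3/2),
    so after [n] exchanges everything but the term in [tau] is of order 1 / sqrt(n). *)
Lemma weighted_clt delta t : 0 < delta ->
  `|fine (Pr (A @^-1` var_good `&` [set w | psum O A std_term n w <= t]))
     - fine (Pr (A @^-1` var_good)) * Phi t| <=
  3 * delta * normal_peak 1 + smooth_cut_cst delta *
    ((C * K / Num.sqrt (n%:R * c) + C ^+ 2 * tau / c) +
     4 * normal_pdf 0 1 0 / Num.sqrt n%:R).
Proof.
move=> delta0.
have := clt_bound mO mA indep t measurable_std_term measurable_var_good n0 delta0
  (fun a _ => std_int a) (fun a _ => std_mean a) (fun a _ => std_int2 a) std_var std_rem.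
have s0 : 0 < Num.sqrt (n%:R : R) by rewrite sqrtr_gt0.
have -> : n%:R * (smooth_cut_cst delta *
   ((C * K / Num.sqrt (n%:R * c) + C ^+ 2 * tau / c) / n%:R +
     4 * normal_pdf 0 1 0 * (Num.sqrt n%:R)^-1 ^+ 3)) =
   smooth_cut_cst delta *
    ((C * K / Num.sqrt (n%:R * c) + C ^+ 2 * tau / c) +
     4 * normal_pdf 0 1 0 / Num.sqrt n%:R).
  set q := C * K / _ + _.
  have {1 2}-> : n%:R = Num.sqrt n%:R ^+ 2 :> R by rewrite sqr_sqrtr// ltW.
  by field; exact: lt0r_neq0.
apply; rewrite divr_ge0 ?ler0n// addr_ge0//.
  by rewrite divr_ge0 ?mulr_ge0 ?sqrtr_ge0// ltW.
by rewrite divr_ge0 ?mulr_ge0 ?sqr_ge0// ltW.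
Qed.

(** Chebyshev's inequality for [n] orthogonal terms of variance 1/n. It is used because a relative
    error of the denominator is multiplied by the size of the ratio. *)
Lemma weighted_tight (L : R) : 0 < L ->
  (Pr (A @^-1` var_good `&` [set w | (L <= `|psum O A std_term n w|)%R]) <= (L ^- 2)%:E)%E.
Proof.
move=> L0.
have nV : 0 <= (n%:R^-1 : R) by rewrite invr_ge0 ltW.
have vle a : var_good a -> \int[P]_o (std_term (a, o) ^+ 2) <= n%:R^-1.
  by move=> ca; rewrite std_var.
have H := psum_second_moment mO mA indep measurable_std_term measurable_var_good n
  (fun a _ => std_int a) (fun a _ => std_mean a) (fun a _ => std_int2 a) vle nV.
rewrite divff ?lt0r_neq0// in H.
have mS : measurable_fun setT (psum O A std_term n) by exact: measurable_psum measurable_std_term _.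
have mIS : measurable_fun setT (fun w => \1_var_good (A w) * psum O A std_term n w ^+ 2 : R).
  apply: measurable_funM.
    apply: (measurableT_comp (f := (\1_var_good : TA -> R))) => //.
    exact/measurable_indic/measurable_var_good.
  exact: (measurableT_comp (f := fun z : R => z ^+ 2)).
have IS0 w : 0 <= \1_var_good (A w) * psum O A std_term n w ^+ 2 :> R.
  by rewrite mulr_ge0 ?sqr_ge0.
have := markov_le mIS IS0 (exprn_gt0 2 L0) H; rewrite div1r.
apply: le_trans; apply: le_measure; rewrite ?inE.
- apply: measurableI; first by rewrite -[X in measurable X]setTI; apply: mA => //; exact: measurable_var_good.
  rewrite -[X in measurable X]setTI.
  have mn : measurable_fun setT (fun w => `|psum O A std_term n w|) by exact: measurableT_comp.
  have := mn measurableT _ (measurable_itv `[L, +oo[); congr measurable.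
  by apply/seteqP; split => x /=; rewrite in_itv/= andbT.
- rewrite -[X in measurable X]setTI.
  have := mIS measurableT _ (measurable_itv `[L ^+ 2, +oo[); congr measurable.
  by apply/seteqP; split => x /=; rewrite in_itv/= andbT.
- move=> w [/= Gw Lw]; rewrite indicE mem_set// mul1r -[leRHS]real_normK ?num_real//.
  by rewrite lerXn2r ?nnegrE// ltW.
Qed.

Let trunc_sqr (p : TA * TO) := (r p.2 * W p) ^+ 2 * (`|r p.2| <= K)%R%:R.
Let trunc_mean a := \int[P]_o trunc_sqr (a, o).

Let mtrunc : measurable_fun setT trunc_sqr.
Proof.
apply: measurable_funM; first exact: (measurableT_comp (f := fun z : R => z ^+ 2)).
rewrite (_ : (fun p => _) = (\1_(`]-oo, K]) : R -> R) \o (fun p : TA * TO => `|r p.2|)); last first.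
  by apply/funext => o; rewrite /= indicE mem_setE in_itv.
apply: (measurableT_comp (f := (\1_(`]-oo, K]) : R -> R))).
  exact: measurable_indic.
by apply: measurableT_comp => //; exact: measurableT_comp.
Qed.

Let trunc_bound p : 0 <= trunc_sqr p <= (C * K) ^+ 2.
Proof.
rewrite /trunc_sqr; case: (leP `|r p.2| K) => rK; last by rewrite mulr0 lexx sqr_ge0.
rewrite mulr1 sqr_ge0/= -real_normK ?num_real// lerXn2r ?nnegrE//.
  by rewrite mulr_ge0 ?ltW.
by rewrite normrM mulrC ler_pM.
Qed.

Let itrunc a : P.-integrable setT (EFin \o (fun o => trunc_sqr (a, o))).
Proof.
apply: (@bounded_integrable _ _ _ _ _ ((C * K) ^+ 2)); first exact: measurableT_comp.
by move=> o; have /andP[? ?] := trunc_bound (a, o); rewrite ger0_norm.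
Qed.

Let trunc_mean_bound a : 0 <= trunc_mean a <= (C * K) ^+ 2.
Proof.
apply/andP; split; first by apply: Rintegral_ge0 => o _; case/andP: (trunc_bound (a, o)).
rewrite -[leRHS](Rintegral_cst_prob P); apply: le_Rintegral => //.
- exact: finite_measure_integrable_cst.
- by move=> o _; case/andP: (trunc_bound (a, o)).
Qed.

Let trunc_tail a o : trunc_sqr (a, o) <= (r o * W (a, o)) ^+ 2 <= trunc_sqr (a, o) + C ^+ 2 * tail o.
Proof.
rewrite /trunc_sqr /tail; case: (ltP K `|r o|) => rK /=.
  by rewrite mulr0 mulr1 add0r sqr_ge0 rW2.
by rewrite mulr1 !mulr0 addr0 lexx.
Qed.

Let trunc_mean_var a : trunc_mean a <= cond_var a <= trunc_mean a + C ^+ 2 * tau.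
Proof.
apply/andP; split.
  by apply: le_Rintegral => // o _; case/andP: (trunc_tail a o).
have i2 : P.-integrable setT (EFin \o (fun o => C ^+ 2 * tail o)).
  by have := integrableZl measurableT (C ^+ 2) itail.
apply: (@le_trans _ _ (\int[P]_o (trunc_sqr (a, o) + C ^+ 2 * tail o))).
  apply: le_Rintegral => //; first exact: (integrableD measurableT (itrunc a) i2).
  by move=> o _; case/andP: (trunc_tail a o).
by rewrite RintegralD// RintegralZl// lerD2l ler_wpM2l ?sqr_ge0.
Qed.

Let mtrunc_mean : measurable_fun setT trunc_mean.
Proof. by apply: measurable_int_a => // p; case/andP: (trunc_bound p). Qed.

Let ctr (p : TA * TO) := trunc_sqr p - trunc_mean p.1.

Let mctr : measurable_fun setT ctr.
Proof. by apply: measurable_funB => //; exact: measurableT_comp. Qed.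

Let ctr_bound p : `|ctr p| <= (C * K) ^+ 2.
Proof.
have /andP[? ?] := trunc_bound p; have /andP[? ?] := trunc_mean_bound p.1.
by rewrite /ctr ler_norml; apply/andP; split; lra.
Qed.

Let ictr a : P.-integrable setT (EFin \o (fun o => ctr (a, o))).
Proof.
apply: (@bounded_integrable _ _ _ _ _ ((C * K) ^+ 2)); first exact: measurableT_comp.
by move=> o; exact: ctr_bound.
Qed.

Let ctr_mean a : \int[P]_o ctr (a, o) = 0.
Proof.
rewrite /ctr /= RintegralB//; last exact: finite_measure_integrable_cst.
by rewrite Rintegral_cst_prob subrr.
Qed.

Let ctr2_bound a o : 0 <= ctr (a, o) ^+ 2 <= ((C * K) ^+ 2) ^+ 2.
Proof.
by rewrite sqr_ge0/= -real_normK ?num_real// lerXn2r ?nnegrE ?sqr_ge0.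
Qed.

Let ictr2 a : P.-integrable setT (EFin \o (fun o => ctr (a, o) ^+ 2)).
Proof.
apply: (@bounded_integrable _ _ _ _ _ (((C * K) ^+ 2) ^+ 2)).
  by apply: (measurableT_comp (f := fun z : R => z ^+ 2)) => //; exact: measurableT_comp.
by move=> o; have /andP[? ?] := ctr2_bound a o; rewrite ger0_norm.
Qed.

Let ctr_var a : \int[P]_o (ctr (a, o) ^+ 2) <= ((C * K) ^+ 2) ^+ 2.
Proof.
rewrite -[leRHS](Rintegral_cst_prob P); apply: le_Rintegral => //.
- exact: finite_measure_integrable_cst.
- by move=> o _; case/andP: (ctr2_bound a o).
Qed.

Let mge (h : Omega -> R) a : measurable_fun setT h -> measurable [set w | a <= h w].
Proof.
move=> mh; rewrite -[X in measurable X]setTI.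
have := mh measurableT _ (measurable_itv `[a, +oo[); congr measurable.
by apply/seteqP; split => x /=; rewrite in_itv/= andbT.
Qed.

Let mterm i : measurable_fun setT (fun w => (r (O i w) * W (A w, O i w)) ^+ 2).
Proof.
apply: (measurableT_comp (f := fun z : R => z ^+ 2)) => //.
apply: measurable_funM; first exact: measurableT_comp.
by apply: (measurableT_comp mW); exact: measurable_fun_pair.
Qed.

(** The squares need not have a variance. Those with |r| at most [K] are bounded by (C K)^2 and,
    centred given [A], obey Chebyshev; the others have mean at most C^2 tau and obey Markov. Three
    errors of size [e] add up: the centred truncated mean, the empirical tail, and the gap between
    truncated and full variance. *)
Lemma weighted_lln (e : R) : 0 < e -> C ^+ 2 * tau < e ->
  (Pr [set w | (3 * e <= `|n%:R^-1 * (\sum_(i < n) (r (O i w) * W (A w, O i w)) ^+ 2)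
       - cond_var (A w)|)%R]
   <= (C ^+ 2 * tau / e + ((C * K) ^+ 2) ^+ 2 / (n%:R * e ^+ 2))%:E)%E.
Proof.
move=> e0 taue.
have mS : measurable_fun setT (psum O A ctr n) by exact: measurable_psum mctr _.
have K40 : 0 <= ((C * K) ^+ 2) ^+ 2 by exact: sqr_ge0.
have H1 := psum_second_moment mO mA indep mctr measurableT n
  (fun a _ => ictr a) (fun a _ => ctr_mean a) (fun a _ => ictr2 a) (fun a _ => ctr_var a) K40.
have mIS : measurable_fun setT (fun w => \1_[set: TA] (A w) * psum O A ctr n w ^+ 2 : R).
  apply: measurable_funM.
    by apply: (measurableT_comp (f := (\1_[set: TA] : TA -> R))) => //; exact: measurable_indic.
  exact: (measurableT_comp (f := fun z : R => z ^+ 2)).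
have IS0 w : 0 <= \1_[set: TA] (A w) * psum O A ctr n w ^+ 2 :> R.
  by rewrite mulr_ge0 ?sqr_ge0.
have ne0 : 0 < (n%:R * e) ^+ 2 by rewrite exprn_gt0// mulr_gt0.
have M1 := markov_le mIS IS0 ne0 H1.
pose T w := n%:R^-1 * \sum_(i < n) C ^+ 2 * tail (O i w).
have mT : measurable_fun setT T.
  apply: measurable_funM => //; apply: measurable_sum => i; apply: measurable_funM => //.
  exact: measurableT_comp.
have T0 w : 0 <= T w.
  rewrite mulr_ge0 ?invr_ge0 ?ler0n// sumr_ge0// => i _.
  by rewrite mulr_ge0 ?sqr_ge0.
have H2 : (\int[Pr]_w (T w)%:E <= (C ^+ 2 * tau)%:E)%E.
  have iO i : Pr.-integrable setT (EFin \o (fun w => tail (O i w))).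
    exact: (integrable_obs mO mA indep i itail).
  under eq_integral => w _ do rewrite /T -mulr_sumr mulrA EFinM -sumEFin.
  rewrite ge0_integralZl//; last 3 first.
  - by apply: emeasurable_sum => i; have /integrableP[] := iO i.
  - by move=> w _; apply: sume_ge0 => i _; rewrite lee_fin.
  - by rewrite lee_fin mulr_ge0 ?sqr_ge0// invr_ge0.
  rewrite ge0_integral_sum//; last 2 first.
  - by move=> i; have /integrableP[] := iO i.
  - by move=> i w _; rewrite lee_fin.
  under eq_bigr => i _ do rewrite (integral_obs mO mA indep i mtail tail0) -EFin_Rintegral//.
  rewrite sumEFin sumr_const card_ord -EFinM lee_fin -(mulr_natl (\int[P]_x tail x)).
  rewrite mulrACA mulVf ?lt0r_neq0// mul1r.
  by rewrite ler_wpM2l ?sqr_ge0.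
have M2 := markov_le mT T0 e0 H2.
have mE1 := mge ((n%:R * e) ^+ 2) mIS.
have mE2 := mge e mT.
have -> : C ^+ 2 * tau / e + ((C * K) ^+ 2) ^+ 2 / (n%:R * e ^+ 2) =
    C ^+ 2 * tau / e + (n%:R * ((C * K) ^+ 2) ^+ 2) / (n%:R * e) ^+ 2.
  by congr (_ + _); field; rewrite !lt0r_neq0.
rewrite EFinD; apply: le_trans (leeD M2 M1).
apply: le_trans (measureU2 _ mE2 mE1).
apply: le_measure; rewrite ?inE.
- apply: mge; apply: measurableT_comp => //; apply: measurable_funB.
    by apply: measurable_funM => //; apply: measurable_sum => i; exact: mterm.
  by apply: measurableT_comp => //; exact: measurable_cond_var.
- exact: measurableU.
move=> w /=; apply: contraPP => /not_orP[/negP + /negP].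
rewrite -!ltNge indicE mem_set// mul1r => Te pe; apply/negP; rewrite -ltNge.
have {}pe : `|psum O A ctr n w| < n%:R * e.
  by rewrite -(ltr_pXn2r (n := 2)) ?nnegrE// ?real_normK ?num_real// mulr_ge0 ?ltW.
have /andP[m1 m2] := trunc_mean_var (A w).
have psE : psum O A ctr n w = \sum_(i < n) trunc_sqr (A w, O i w) - n%:R * trunc_mean (A w).
  rewrite /psum /ctr big_split/= sumrN; congr (_ - _).
  by rewrite sumr_const card_ord mulr_natl.
set S := \sum_(i < n) (r (O i w) * W (A w, O i w)) ^+ 2.
have S1 : \sum_(i < n) trunc_sqr (A w, O i w) <= S.
  by apply: ler_sum => i _; case/andP: (trunc_tail (A w) (O i w)).
have S2 : S <= \sum_(i < n) trunc_sqr (A w, O i w) + n%:R * T w.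
  rewrite /T mulVKf ?lt0r_neq0// -big_split/=.
  by apply: ler_sum => i _; case/andP: (trunc_tail (A w) (O i w)).
have nTe : n%:R * T w < n%:R * e by rewrite ltr_pM2l.
move: pe; rewrite psE !ltr_norml => /andP[p1 p2].
have L1 : n%:R * (cond_var (A w) - trunc_mean (A w)) < n%:R * e.
  by rewrite ltr_pM2l//; lra.
have L2 : 0 <= n%:R * (cond_var (A w) - trunc_mean (A w)).
  by rewrite mulr_ge0//; lra.
rewrite mulrBr in L1; rewrite mulrBr in L2.
rewrite -(ltr_pM2l rn0) -[X in _ && X](ltr_pM2l rn0) mulrBr mulVKf ?lt0r_neq0// mulrN.
by apply/andP; split; lra.
Qed.

End weighted_sum.

(** * The test statistic *)

Section finite_sums.
Context {R : realType}.

Lemma sum_cauchy_schwarz n (a b : 'I_n -> R) :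
  (\sum_i a i * b i) ^+ 2 <= (\sum_i a i ^+ 2) * (\sum_i b i ^+ 2).
Proof.
have E1 : (\sum_i a i * b i) ^+ 2 = \sum_i \sum_j (a i * b i) * (a j * b j).
  by rewrite expr2 big_distrl/=; apply: eq_bigr => i _; rewrite big_distrr.
have E2 : (\sum_i a i ^+ 2) * (\sum_i b i ^+ 2) = \sum_i \sum_j a i ^+ 2 * b j ^+ 2.
  by rewrite big_distrl/=; apply: eq_bigr => i _; rewrite big_distrr.
have E3 : (\sum_i a i ^+ 2) * (\sum_i b i ^+ 2) = \sum_i \sum_j a j ^+ 2 * b i ^+ 2.
  by rewrite E2 exchange_big.
have : (\sum_i a i * b i) ^+ 2 *+ 2 <= ((\sum_i a i ^+ 2) * (\sum_i b i ^+ 2)) *+ 2.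
  rewrite [leRHS]mulr2n {1}E2 E3 E1 -sumrMnl -big_split/=; apply: ler_sum => i _.
  rewrite -sumrMnl -big_split/=; apply: ler_sum => j _.
  have := sqr_ge0 (a i * b j - a j * b i); rewrite sqrrB !exprMn mulr2n; nra.
by rewrite !mulr2n; lra.
Qed.

Lemma sum_sqr_prod_le n (a b : 'I_n -> R) :
  \sum_i (a i * b i) ^+ 2 <= (\sum_i a i ^+ 2) * (\sum_i b i ^+ 2).
Proof.
rewrite big_distrl/=; apply: ler_sum => i _; rewrite exprMn ler_wpM2l ?sqr_ge0//.
by rewrite (bigD1 i)//= lerDl sumr_ge0// => j _; exact: sqr_ge0.
Qed.

(** Young's inequality 2|rq| <= theta r^2 + q^2 / theta. Summed over the sample, the mixed terms are
    absorbed with a small factor by the sum of r^2, which is under control. *)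
Lemma sqr_diff_le (r q theta : R) : 0 < theta ->
  `|(r + q) ^+ 2 - r ^+ 2| <= theta * r ^+ 2 + (1 + theta^-1) * q ^+ 2.
Proof.
move=> th0.
have H1 : 0 <= theta^-1 * (theta * r - q) ^+ 2 by rewrite mulr_ge0 ?sqr_ge0// invr_ge0 ltW.
have H2 : 0 <= theta^-1 * (theta * r + q) ^+ 2 by rewrite mulr_ge0 ?sqr_ge0// invr_ge0 ltW.
have E1 : theta^-1 * (theta * r - q) ^+ 2 = theta * r ^+ 2 - 2 * r * q + theta^-1 * q ^+ 2.
  by field; exact: lt0r_neq0.
have E2 : theta^-1 * (theta * r + q) ^+ 2 = theta * r ^+ 2 + 2 * r * q + theta^-1 * q ^+ 2.
  by field; exact: lt0r_neq0.
have -> : (r + q) ^+ 2 - r ^+ 2 = 2 * r * q + q ^+ 2 by ring.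
have q2 := sqr_ge0 q.
rewrite E1 in H1; rewrite E2 in H2.
by rewrite ler_norml; apply/andP; split; lra.
Qed.

Lemma ratio_close (tN a D2 s2 c e1 e2 L : R) : 0 < c -> c <= s2 -> 0 <= e1 -> 0 <= e2 ->
  e2 <= c / 2 -> `|tN - a| <= e1 -> `|D2 - s2| <= e2 -> `|a / Num.sqrt s2| <= L ->
  `|tN / Num.sqrt D2 - a / Num.sqrt s2| <= e1 / Num.sqrt (c / 2) + L * e2 * 2 / c.
Proof.
move=> c0 cs e10 e20 e2c tNa Ds aL.
have D2c : c / 2 <= D2 by move: Ds; rewrite ler_norml => /andP[? ?]; lra.
have c20 : 0 < c / 2 by rewrite divr_gt0.
have D20 : 0 < D2 by exact: lt_le_trans D2c.
have s20 : 0 < s2 by exact: lt_le_trans cs.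
have t0 : 0 < Num.sqrt D2 by rewrite sqrtr_gt0.
have s0 : 0 < Num.sqrt s2 by rewrite sqrtr_gt0.
have tE : Num.sqrt D2 ^+ 2 = D2 by rewrite sqr_sqrtr// ltW.
have sE : Num.sqrt s2 ^+ 2 = s2 by rewrite sqr_sqrtr// ltW.
set t := Num.sqrt D2 in t0 tE *; set s := Num.sqrt s2 in s0 sE aL *.
have st : `|s - t| <= e2 / t.
  have E : (s - t) * (s + t) = s2 - D2 by rewrite -sE -tE; ring.
  rewrite ler_pdivlMr//.
  apply: (@le_trans _ _ (`|s - t| * (s + t))).
    by rewrite ler_wpM2l// lerDr ltW.
  rewrite -[X in _ * X](gtr0_norm (_ : 0 < s + t)) ?addr_gt0// -normrM E.
  by rewrite distrC.
(* The numerator error is divided by [t]; the denominator error is multiplied by the bounded ratio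
   [a / s]. With |s - t| at most e2 / t, the second part is at most L e2 / D2, where D2 is at least
   c / 2. *)
have -> : tN / t - a / s = (tN - a) / t + a / s * ((s - t) / t).
  by field; rewrite !lt0r_neq0.
apply: (le_trans (ler_normD _ _)); apply: lerD.
  rewrite normrM normfV (gtr0_norm t0) ler_pM ?invr_ge0 ?(ltW t0)//.
  by rewrite lef_pV2 ?posrE ?sqrtr_gt0// ler_wsqrtr.
rewrite normrM -!mulrA ler_pM//.
rewrite normrM normfV (gtr0_norm t0).
apply: (@le_trans _ _ (e2 / t / t)); first by rewrite ler_wpM2r// invr_ge0 ltW.
rewrite -mulrA -invfM -expr2 tE ler_wpM2l//.
by rewrite -[leRHS]invrK lef_pV2 ?posrE ?invr_gt0 ?divr_gt0// invfM invrK mulrC.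
Qed.

(** Each residual product is eps xi W plus three error terms. For D E W, bounded weights and
    Cauchy-Schwarz reduce both the sum and the sum of squares to the product of the two total
    squared fitting errors, so [AB] stands for n A_f A_g and [x] for its square root. The factor 3
    comes from the square of a sum of three terms. *)
Lemma residual_sums n (D E eps xi W : 'I_n -> R) (C theta AB : R) : (0 < n)%N ->
  0 < theta -> 0 <= C -> (forall i, `|W i| <= C) ->
  (\sum_i D i ^+ 2) * (\sum_i E i ^+ 2) <= n%:R * AB ->
  let r i := eps i * xi i * W i in
  let bf i := D i * W i * xi i in
  let bg i := E i * W i * eps i in
  let res i := (D i + eps i) * (E i + xi i) * W i in
  (forall x, 0 <= x -> AB <= x ^+ 2 ->
   `|(Num.sqrt n%:R)^-1 * (\sum_i res i) - (Num.sqrt n%:R)^-1 * (\sum_i r i)| <=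
   `|(Num.sqrt n%:R)^-1 * (\sum_i bf i)| + `|(Num.sqrt n%:R)^-1 * (\sum_i bg i)| + C * x) /\
  `|n%:R^-1 * (\sum_i res i ^+ 2) - n%:R^-1 * (\sum_i r i ^+ 2)| <=
   theta * (n%:R^-1 * (\sum_i r i ^+ 2)) + (1 + theta^-1) * (3 *
     (n%:R^-1 * (\sum_i bf i ^+ 2) + n%:R^-1 * (\sum_i bg i ^+ 2) + C ^+ 2 * AB)).
Proof.
move=> n0 th0 C0 WC DE r bf bg res.
have rn0 : 0 < (n%:R : R) by rewrite ltr0n.
have s0 : 0 < Num.sqrt (n%:R : R) by rewrite sqrtr_gt0.
pose z i := (D i * E i) * W i.
have resE i : res i = r i + (bf i + bg i + z i) by rewrite /res /r /bf /bg /z; ring.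
have W2 i : W i ^+ 2 <= C ^+ 2 by rewrite -real_normK ?num_real// lerXn2r ?nnegrE.
have z2 : \sum_i z i ^+ 2 <= C ^+ 2 * (n%:R * AB).
  apply: (@le_trans _ _ (C ^+ 2 * \sum_i (D i * E i) ^+ 2)).
    rewrite mulr_sumr; apply: ler_sum => i _.
    by rewrite /z exprMn mulrC ler_wpM2r ?sqr_ge0.
  by rewrite ler_wpM2l ?sqr_ge0//; exact: le_trans (sum_sqr_prod_le _ _) DE.
have zsum : (\sum_i z i) ^+ 2 <= C ^+ 2 * (n%:R * AB).
  have -> : \sum_i z i = \sum_i D i * (E i * W i).
    by apply: eq_bigr => i _; rewrite /z mulrA.
  apply: (le_trans (sum_cauchy_schwarz _ _)).
  apply: (@le_trans _ _ ((\sum_i D i ^+ 2) * (C ^+ 2 * \sum_i E i ^+ 2))).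
    rewrite ler_wpM2l ?sumr_ge0 => // [i _|]; first exact: sqr_ge0.
    rewrite mulr_sumr; apply: ler_sum => i _.
    by rewrite exprMn mulrC ler_wpM2r ?sqr_ge0.
  by rewrite mulrCA ler_wpM2l ?sqr_ge0.
split.
  move=> x x0 ABx.
  have zx : `|(Num.sqrt n%:R)^-1 * \sum_i z i| <= C * x.
    rewrite normrM normfV (gtr0_norm s0) mulrC ler_pdivrMr//.
    rewrite -(ler_pXn2r (n := 2)) ?nnegrE//; last by rewrite mulr_ge0 ?mulr_ge0 ?sqrtr_ge0.
    rewrite real_normK ?num_real//.
    rewrite !exprMn sqr_sqrtr ?ler0n//; apply: (le_trans zsum).
    by rewrite -mulrA ler_wpM2l ?sqr_ge0// mulrC ler_wpM2r ?ler0n.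
  have -> : \sum_i res i = \sum_i r i + (\sum_i bf i + \sum_i bg i + \sum_i z i).
    by rewrite -!big_split/=; apply: eq_bigr => i _; exact: resE.
  rewrite mulrDr addrAC subrr add0r !mulrDr.
  by apply: (le_trans (ler_normD _ _)); apply: lerD => //; exact: ler_normD.
have thp : 0 <= 1 + theta^-1 by rewrite addr_ge0// invr_ge0 ltW.
rewrite -mulrBr -sumrB normrM normfV (gtr0_norm rn0).
apply: (@le_trans _ _ (n%:R^-1 * \sum_i (theta * r i ^+ 2 + (1 + theta^-1) *
    (3 * (bf i ^+ 2 + bg i ^+ 2 + z i ^+ 2))))).
  rewrite ler_wpM2l ?invr_ge0 ?ler0n//; apply: (le_trans (ler_norm_sum _ _ _)).
  apply: ler_sum => i _; rewrite resE; apply: (le_trans (sqr_diff_le _ _ th0)).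
  rewrite lerD2l ler_wpM2l//.
  have := sqr_ge0 (bf i - bg i); have := sqr_ge0 (bf i - z i); have := sqr_ge0 (bg i - z i); nra.
rewrite big_split/= -!mulr_sumr !big_split/= mulrDr mulrCA lerD2l.
have -> : n%:R^-1 * ((1 + theta^-1) * (3 * (\sum_i bf i ^+ 2 + \sum_i bg i ^+ 2 + \sum_i z i ^+ 2)))
  = (1 + theta^-1) * (3 * (n%:R^-1 * (\sum_i bf i ^+ 2) + n%:R^-1 * (\sum_i bg i ^+ 2)
    + n%:R^-1 * \sum_i z i ^+ 2)) by ring.
rewrite ler_wpM2l//.
by rewrite ler_wpM2l// lerD2l ler_pdivrMl// mulrCA.
Qed.

End finite_sums.

Section cdf_compare.
Context d (Omega : measurableType d) (R : realType) (Pr : probability Omega R).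

(** Off [Bad], the event T <= t is squeezed between S <= t - kappa and S <= t + kappa. In the lower
    bound the probability of [Bad] counts twice: once for this comparison, once for the mass that
    [G] may lack. *)
Lemma cdf_compare (G Bad : set Omega) (T S : Omega -> R) (kappa b err : R) :
  measurable G -> measurable Bad -> measurable_fun setT T -> measurable_fun setT S ->
  0 <= kappa -> (Pr Bad <= b%:E)%E ->
  (forall w, ~ Bad w -> G w /\ `|T w - S w| <= kappa) ->
  (forall s, `|fine (Pr (G `&` [set w | S w <= s])) - fine (Pr G) * Phi s| <= err) ->
  forall t, `|fine (Pr [set w | T w <= t]) - Phi t| <= err + 2 * b + normal_peak 1 * kappa.
Proof.
move=> mG mBad mT mS k0 Bb close clt t.
have mle (h : Omega -> R) a : measurable_fun setT h -> measurable [set w | h w <= a].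
  move=> mh; rewrite -[X in measurable X]setTI.
  by have := mh measurableT _ (measurable_itv `]-oo, a]); congr measurable.
have fle (E F : set Omega) : measurable E -> measurable F -> E `<=` F -> fine (Pr E) <= fine (Pr F).
  by move=> mE mF EF; rewrite fine_le ?fin_num_measure// le_measure ?inE.
have fU (E F : set Omega) : measurable E -> measurable F ->
    fine (Pr (E `|` F)) <= fine (Pr E) + fine (Pr F).
  move=> mE mF; rewrite -lee_fin EFinD !fineK ?fin_num_measure ?measureU2//.
  exact: measurableU.
have Bfin : fine (Pr Bad) <= b by rewrite -lee_fin fineK ?fin_num_measure.
have mGS s : measurable (G `&` [set w | S w <= s]) by apply: measurableI => //; exact: mle.
have up : fine (Pr [set w | T w <= t]) <= fine (Pr (G `&` [set w | S w <= t + kappa])) + fine (Pr Bad).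
  apply: le_trans (fU _ _ (mGS _) mBad); apply: fle; [exact: mle|exact: measurableU|].
  move=> w /= Tt; have [Bw|/close[Gw TS]] := pselect (Bad w); [by right|left; split => //=].
  by move: TS; rewrite ler_norml => /andP[? ?]; lra.
have lo : fine (Pr (G `&` [set w | S w <= t - kappa])) <= fine (Pr [set w | T w <= t]) + fine (Pr Bad).
  apply: le_trans (fU _ _ (mle _ _ mT) mBad); apply: fle => //; first by apply: measurableU => //; exact: mle.
  move=> w /= [Gw St]; have [Bw|/close[_ TS]] := pselect (Bad w); [by right|left => /=].
  by move: TS; rewrite ler_norml => /andP[? ?]; lra.
have pG : 1 - b <= fine (Pr G).
  have : fine (Pr [set: Omega]) <= fine (Pr (G `|` Bad)).
    apply: fle => //; first exact: measurableU.
    by move=> w _; have [Bw|/close[Gw _]] := pselect (Bad w); [right|left].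
  rewrite [X in fine X](probability_setT Pr)/= => h.
  by have := fU _ _ mG mBad; lra.
have pG1 : fine (Pr G) <= 1.
  by rewrite -lee_fin fineK ?fin_num_measure// probability_le1.
have pG0 : 0 <= fine (Pr G) by exact: fine_ge0.
have := clt (t + kappa); have := clt (t - kappa).
rewrite !ler_norml => /andP[c1 _] /andP[_ c2].
have Pu := Phi_lipschitz t k0.
have := Phi_lipschitz (t - kappa) k0; rewrite subrK => Pl.
have /andP[P10 P11] := Phi_bound (t - kappa).
have /andP[P20 P21] := Phi_bound (t + kappa).
have h1 : fine (Pr G) * Phi (t + kappa) <= Phi (t + kappa) by rewrite ler_piMl.
have h2 : Phi (t - kappa) - fine (Pr G) * Phi (t - kappa) <= 1 - fine (Pr G).
  rewrite -{1}[Phi _]mul1r -mulrBl ler_piMr// subr_ge0//.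
have b0 : 0 <= b by apply: le_trans Bfin; exact: fine_ge0.
by apply/andP; split; lra.
Qed.

End cdf_compare.

Section gcm_sample.
Context (R : realType) (d : nat) (dO : measure_display) (Omega : measurableType dO)
  (dA : measure_display) (TA : measurableType dA).
Variables (O : nat -> Omega -> Obs R d) (A : Omega -> TA).
Variables (Pr : probability Omega R) (P : probability (Obs R d) R).
Variables (fhat ghat : nat -> Omega -> Zsp R d -> R) (what : nat -> TA -> Zsp R d -> R) (C : R).
Hypothesis C0 : 0 < C.
Hypothesis whatC : forall n a z, `|what n a z| <= C.
Hypothesis mwhat : forall n, measurable_fun setT (fun p : TA * Zsp R d => what n p.1 p.2).
Hypothesis regX : regression_XZ O fhat.
Hypothesis regY : regression_YZ O ghat.
Variables (f g u v : Zsp R d -> R).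

Definition resid_prod (o : Obs R d) : R := (Xo o - f (Zo o)) * (Yo o - g (Zo o)).
Definition obs_weight n (p : TA * Obs R d) : R := what n p.1 (Zo p.2).

Local Notation s2 n := (cond_var P resid_prod (obs_weight n)).
Local Notation S n := (psum O A (std_term P resid_prod (obs_weight n) n) n).

Definition AB n w : R := n%:R * (A_f O fhat f n w * A_g O ghat g n w).

Definition cross_f n w : R := (Num.sqrt n%:R)^-1 * \sum_(i < n)
  (f (Zo (O i w)) - fhat n w (zs O i w)) * what n (A w) (Zo (O i w)) * (Yo (O i w) - g (Zo (O i w))).
Definition cross_g n w : R := (Num.sqrt n%:R)^-1 * \sum_(i < n)
  (g (Zo (O i w)) - ghat n w (zs O i w)) * what n (A w) (Zo (O i w)) * (Xo (O i w) - f (Zo (O i w))).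
Definition cross_sqr_f n w : R := n%:R^-1 * \sum_(i < n)
  ((f (Zo (O i w)) - fhat n w (zs O i w)) * what n (A w) (Zo (O i w)) * (Yo (O i w) - g (Zo (O i w)))) ^+ 2.
Definition cross_sqr_g n w : R := n%:R^-1 * \sum_(i < n)
  ((g (Zo (O i w)) - ghat n w (zs O i w)) * what n (A w) (Zo (O i w)) * (Xo (O i w) - f (Zo (O i w)))) ^+ 2.
Definition mean_sqr n w : R := n%:R^-1 * \sum_(i < n) (resid_prod (O i w) * obs_weight n (A w, O i w)) ^+ 2.

(** Deterministic, for one outcome outside all bad events. [3 * x1] is the total of the three
    numerator errors, and [9 * q1] is three times the total of the three mean squares. The last
    summand under [e2] is for the squared mean that the denominator subtracts: it equals tau_N^2 /
    n, with tau_N bounded. *)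
Lemma statistic_close n w (c L x x1 q1 l1 Smax theta e2 kappa : R) : (0 < n)%N ->
  0 < c -> c <= s2 n (A w) -> s2 n (A w) <= Smax ->
  0 <= L -> `|S n w| <= L -> 0 <= x -> AB n w <= x ^+ 2 -> C * x <= x1 ->
  `|cross_f n w| <= x1 -> `|cross_g n w| <= x1 ->
  cross_sqr_f n w <= q1 -> cross_sqr_g n w <= q1 -> C ^+ 2 * AB n w <= q1 ->
  `|mean_sqr n w - s2 n (A w)| <= l1 -> 0 < theta ->
  theta * (Smax + l1) + (1 + theta^-1) * (9 * q1) + l1 + 2 * (L ^+ 2 * Smax + 9 * x1 ^+ 2) / n%:R <= e2 ->
  e2 <= c / 2 ->
  3 * x1 / Num.sqrt (c / 2) + L * e2 * 2 / c <= kappa ->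
  `|Tstat O A fhat ghat what n w - S n w| <= kappa.
Proof.
move=> n0 c0 cs sS L0 SL x0 ABx Cx bfx bgx qfq qgq ABq m2l th0 e2H e2c kap.
have rn0 : 0 < (n%:R : R) by rewrite ltr0n.
have sn0 : 0 < Num.sqrt (n%:R : R) by rewrite sqrtr_gt0.
have snE : Num.sqrt (n%:R : R) ^+ 2 = n%:R by rewrite sqr_sqrtr// ltW.
pose D (i : 'I_n) := f (Zo (O i w)) - fhat n w (zs O i w).
pose E (i : 'I_n) := g (Zo (O i w)) - ghat n w (zs O i w).
pose eps (i : 'I_n) := Xo (O i w) - f (Zo (O i w)).
pose xi (i : 'I_n) := Yo (O i w) - g (Zo (O i w)).
pose W (i : 'I_n) := what n (A w) (Zo (O i w)).
have DE : (\sum_i D i ^+ 2) * (\sum_i E i ^+ 2) <= n%:R * AB n w.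
  rewrite le_eqVlt; apply/orP; left; apply/eqP.
  rewrite /AB /A_f /A_g -/D -/E; set a := \sum_(i < n) _; set b := \sum_(i < n) _.
  by field; exact: lt0r_neq0.
have [H1 H2] := residual_sums eps xi n0 th0 (ltW C0) (fun i => whatC n (A w) (Zo (O i w))) DE.
have {H1} := H1 x x0 ABx.
have resE (i : 'I_n) : (D i + eps i) * (E i + xi i) * W i = Rres O A fhat ghat what n i w.
  by rewrite /Rres /D /E /eps /xi /W /xs /ys /zs; ring.
rewrite (eq_bigr _ (fun i _ => resE i)).
have resE2 (i : 'I_n) : ((D i + eps i) * (E i + xi i) * W i) ^+ 2 = Rres O A fhat ghat what n i w ^+ 2.
  by rewrite resE.
rewrite (eq_bigr _ (fun i _ => resE2 i)) in H2.
rewrite -[(Num.sqrt n%:R)^-1 * \sum_(i < n) Rres _ _ _ _ _ _ _ _]/(tauN O A fhat ghat what n w).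
set a := (Num.sqrt n%:R)^-1 * \sum_(i < n) (eps i * xi i * W i).
rewrite -/(cross_f n w) -/(cross_g n w) => tNa0.
have tNa : `|tauN O A fhat ghat what n w - a| <= 3 * x1.
  by apply: (le_trans tNa0); lra.
have SE : S n w = a / Num.sqrt (s2 n (A w)).
  rewrite /psum /a mulr_sumr mulr_suml; apply: eq_bigr => i _.
  by rewrite /std_term /= invfM /resid_prod /obs_weight /eps /xi /W/=; ring.
have s20 : 0 < s2 n (A w) by exact: lt_le_trans cs.
set mR2 := n%:R^-1 * \sum_(i < n) Rres O A fhat ghat what n i w ^+ 2.
have {}H2 : `|mR2 - mean_sqr n w| <=
    theta * mean_sqr n w + (1 + theta^-1) * (3 * (cross_sqr_f n w + cross_sqr_g n w + C ^+ 2 * AB n w)).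
  exact: H2.
have thp : 0 <= 1 + theta^-1 by rewrite addr_ge0// invr_ge0 ltW.
have m2S : mean_sqr n w <= Smax + l1 by move: m2l; rewrite ler_norml => /andP[? ?]; lra.
have H3 : `|mR2 - mean_sqr n w| <= theta * (Smax + l1) + (1 + theta^-1) * (9 * q1).
  apply: (le_trans H2); apply: lerD; first by rewrite ler_wpM2l// ltW.
  by rewrite ler_wpM2l//; lra.
set D2 := mR2 - (n%:R^-1 * \sum_(i < n) Rres O A fhat ghat what n i w) ^+ 2.
have meanE : (n%:R^-1 * \sum_(i < n) Rres O A fhat ghat what n i w) ^+ 2 =
    tauN O A fhat ghat what n w ^+ 2 / n%:R.
  by rewrite /tauN !exprMn !exprVn snE; field; exact: lt0r_neq0.
have aL : `|a| <= L * Num.sqrt (s2 n (A w)).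
  by move: SL; rewrite SE normrM normfV (ger0_norm (sqrtr_ge0 _)) ler_pdivrMr// sqrtr_gt0.
have x10 : 0 <= x1 by apply: le_trans bfx.
have a2 : a ^+ 2 <= L ^+ 2 * Smax.
  rewrite -real_normK ?num_real//.
  apply: (@le_trans _ _ ((L * Num.sqrt (s2 n (A w))) ^+ 2)).
    by rewrite lerXn2r ?nnegrE// mulr_ge0// sqrtr_ge0.
  by rewrite exprMn sqr_sqrtr ?(ltW s20)// ler_wpM2l ?sqr_ge0.
have t2 : tauN O A fhat ghat what n w ^+ 2 <= 2 * (L ^+ 2 * Smax + 9 * x1 ^+ 2).
  set tN := tauN O A fhat ghat what n w in tNa *.
  have d2 : (tN - a) ^+ 2 <= 9 * x1 ^+ 2.
    have -> : 9 * x1 ^+ 2 = (3 * x1) ^+ 2 by ring.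
    by rewrite -real_normK ?num_real// lerXn2r ?nnegrE// mulr_ge0.
  have := sqr_ge0 (tN - a - a); rewrite (_ : (tN - a - a) ^+ 2 = 2 * (tN - a) ^+ 2 + 2 * a ^+ 2 - tN ^+ 2); last by ring.
  lra.
have tn0 : 0 <= tauN O A fhat ghat what n w ^+ 2 / n%:R by rewrite divr_ge0 ?sqr_ge0 ?ler0n.
have tn : tauN O A fhat ghat what n w ^+ 2 / n%:R <= 2 * (L ^+ 2 * Smax + 9 * x1 ^+ 2) / n%:R.
  by rewrite ler_wpM2r// invr_ge0 ler0n.
have Ds : `|D2 - s2 n (A w)| <= e2.
  apply: le_trans e2H; rewrite /D2 meanE.
  rewrite (_ : mR2 - _ - _ = mR2 - mean_sqr n w + (mean_sqr n w - s2 n (A w))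
    - tauN O A fhat ghat what n w ^+ 2 / n%:R); last by ring.
  apply: (le_trans (ler_normB _ _)); rewrite (ger0_norm tn0) lerD//.
  by apply: (le_trans (ler_normD _ _)); exact: lerD.
have e20 : 0 <= e2 by apply: le_trans Ds.
have S_L : `|a / Num.sqrt (s2 n (A w))| <= L by rewrite -SE.
have x130 : 0 <= 3 * x1 by rewrite mulr_ge0.
have := ratio_close c0 cs x130 e20 e2c tNa Ds S_L.
by rewrite -SE => H; apply: le_trans kap.
Qed.

Hypothesis iid : iid_indep O A Pr P.
Hypothesis cf : cond_exp P Xo f.
Hypothesis cg : cond_exp P Yo g.
Hypothesis cu : cond_exp_nonneg P (fun o => (Xo o - f (Zo o)) ^+ 2) u.
Hypothesis cv : cond_exp_nonneg P (fun o => (Yo o - g (Zo o)) ^+ 2) v.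
Hypothesis ci : cond_indep P.

Let mO i : measurable_fun setT (O i). Proof. exact: iid.1. Qed.
Let mA : measurable_fun setT A. Proof. exact: iid.2.1. Qed.
Let mX : measurable_fun setT (@Xo R d). Proof. exact: measurable_Xo. Qed.
Let mY : measurable_fun setT (@Yo R d). Proof. exact: measurable_Yo. Qed.
Let mZ : measurable_fun setT (@Zo R d). Proof. exact: measurable_Zo. Qed.

Let mfZ (h : Zsp R d -> R) : measurable_fun setT h -> measurable_fun setT (fun o : Obs R d => h (Zo o)).
Proof. by move=> mh; exact: (measurableT_comp mh mZ). Qed.

Let mobs (h : Obs R d -> R) i : measurable_fun setT h -> measurable_fun setT (fun w => h (O i w)).
Proof. by move=> mh; exact: measurableT_comp. Qed.

Let meps : measurable_fun setT (fun o : Obs R d => Xo o - f (Zo o)).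
Proof. by apply: measurable_funB => //; apply: mfZ; exact: cf.1. Qed.

Let mxi : measurable_fun setT (fun o : Obs R d => Yo o - g (Zo o)).
Proof. by apply: measurable_funB => //; apply: mfZ; exact: cg.1. Qed.

Lemma measurable_resid_prod : measurable_fun setT resid_prod.
Proof. exact: measurable_funM. Qed.

Lemma measurable_obs_weight n : measurable_fun setT (obs_weight n).
Proof.
have H : measurable_fun setT (fun p : TA * Obs R d => (p.1, Zo p.2)).
  by apply: measurable_fun_pair => //; exact: (measurableT_comp mZ).
have H2 := measurableT_comp (mwhat n) H; exact H2.
Qed.

Let mwt n i : measurable_fun setT (fun w => what n (A w) (Zo (O i w))).
Proof.
have H : measurable_fun setT (fun w => (A w, Zo (O i w))).
  by apply: measurable_fun_pair => //; exact: (measurableT_comp mZ).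
have H2 := measurableT_comp (mwhat n) H; exact H2.
Qed.

Let mfh n i : (i < n)%N -> measurable_fun setT (fun w => fhat n w (zs O i w)).
Proof.
move=> ltin; have H := @regression_XZ_measurable _ _ _ _ _ _ O A _ n i i regX ltin ltin.
have H2 := measurable_fun_g_sigma (@cyl_measurable _ _ _ _ _ _ _ _ mO mA n i (pair_sets Xo)) H; exact H2.
Qed.

Let mgh n i : (i < n)%N -> measurable_fun setT (fun w => ghat n w (zs O i w)).
Proof.
move=> ltin; have H := @regression_YZ_measurable _ _ _ _ _ _ O A _ n i i regY ltin ltin.
have H2 := measurable_fun_g_sigma (@cyl_measurable _ _ _ _ _ _ _ _ mO mA n i (pair_sets Yo)) H; exact H2.
Qed.

Let mD n i : (i < n)%N -> measurable_fun setT (fun w => f (Zo (O i w)) - fhat n w (zs O i w)).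
Proof.
move=> ltin; apply: measurable_funB; last exact: mfh.
by apply: (mobs i (h := fun o => f (Zo o))); apply: mfZ; exact: cf.1.
Qed.

Let mE n i : (i < n)%N -> measurable_fun setT (fun w => g (Zo (O i w)) - ghat n w (zs O i w)).
Proof.
move=> ltin; apply: measurable_funB; last exact: mgh.
by apply: (mobs i (h := fun o => g (Zo o))); apply: mfZ; exact: cg.1.
Qed.

Let msqr (h : Omega -> R) : measurable_fun setT h -> measurable_fun setT (fun w => h w ^+ 2).
Proof. by move=> mh; exact: (measurableT_comp (f := fun z : R => z ^+ 2)). Qed.

Let mcf n i : (i < n)%N -> measurable_fun setT (fun w =>
  (f (Zo (O i w)) - fhat n w (zs O i w)) * what n (A w) (Zo (O i w)) * (Yo (O i w) - g (Zo (O i w)))).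
Proof.
move=> ltin; apply: measurable_funM; first by apply: measurable_funM; [exact: mD|exact: mwt].
exact: (mobs i mxi).
Qed.

Let mcg n i : (i < n)%N -> measurable_fun setT (fun w =>
  (g (Zo (O i w)) - ghat n w (zs O i w)) * what n (A w) (Zo (O i w)) * (Xo (O i w) - f (Zo (O i w)))).
Proof.
move=> ltin; apply: measurable_funM; first by apply: measurable_funM; [exact: mE|exact: mwt].
exact: (mobs i meps).
Qed.

Let mcross_f n : measurable_fun setT (cross_f n).
Proof. by apply: measurable_funM => //; apply: measurable_sum => i; exact: mcf. Qed.

Let mcross_g n : measurable_fun setT (cross_g n).
Proof. by apply: measurable_funM => //; apply: measurable_sum => i; exact: mcg. Qed.

Let mcross_sqr_f n : measurable_fun setT (cross_sqr_f n).
Proof. by apply: measurable_funM => //; apply: measurable_sum => i; apply: msqr; exact: mcf. Qed.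

Let mcross_sqr_g n : measurable_fun setT (cross_sqr_g n).
Proof. by apply: measurable_funM => //; apply: measurable_sum => i; apply: msqr; exact: mcg. Qed.

Let mAB n : measurable_fun setT (AB n).
Proof.
apply: measurable_funM => //; apply: measurable_funM; apply: measurable_funM => //;
  apply: measurable_sum => i; apply: msqr; [exact: mD|exact: mE].
Qed.

Let mBf n : measurable_fun setT (B_f O fhat f v n).
Proof.
apply: measurable_funM => //; apply: measurable_sum => i; apply: measurable_funM.
  by apply: msqr; exact: mD.
by apply: (mobs i (h := fun o => v (Zo o))); apply: mfZ; exact: cv.2.1.
Qed.

Let mBg n : measurable_fun setT (B_g O ghat g u n).
Proof.
apply: measurable_funM => //; apply: measurable_sum => i; apply: measurable_funM.
  by apply: msqr; exact: mE.
by apply: (mobs i (h := fun o => u (Zo o))); apply: mfZ; exact: cu.2.1.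
Qed.

Let mmean_sqr n : measurable_fun setT (mean_sqr n).
Proof.
apply: measurable_funM => //; apply: measurable_sum => i; apply: msqr.
by apply: measurable_funM; [exact: (mobs i measurable_resid_prod)|exact: mwt].
Qed.

Let mRres n i : (i < n)%N -> measurable_fun setT (Rres O A fhat ghat what n i).
Proof.
move=> ltin; apply: measurable_funM; last exact: mwt.
apply: measurable_funM; apply: measurable_funB; first exact: (mobs i mX).
- exact: mfh.
- exact: (mobs i mY).
- exact: mgh.
Qed.

Lemma measurable_Tstat n : measurable_fun setT (Tstat O A fhat ghat what n).
Proof.
pose D2 w := n%:R^-1 * (\sum_(i < n) Rres O A fhat ghat what n i w ^+ 2) -
  (n%:R^-1 * \sum_(r < n) Rres O A fhat ghat what n r w) ^+ 2.
have mD2 : measurable_fun setT D2.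
  apply: measurable_funB.
    by apply: measurable_funM => //; apply: measurable_sum => i; apply: msqr; exact: mRres.
  by apply: msqr; apply: measurable_funM => //; apply: measurable_sum => i; exact: mRres.
(* The square root of a negative number is 0, and so is the inverse of 0, so on every outcome
   dividing by the root is multiplying by the power -1/2 of the positive part. *)
rewrite (_ : Tstat _ _ _ _ _ _ = fun w => tauN O A fhat ghat what n w * (Num.max (D2 w) 0) `^ (- 2^-1)).
  apply: measurable_funM.
    by apply: measurable_funM => //; apply: measurable_sum => i; exact: mRres.
  apply: (measurableT_comp (f := fun x : R => x `^ (- 2^-1))); first exact: measurable_powR.
  exact: measurable_maxr.
apply/funext => w; rewrite /Tstat /tauD -/(D2 w) powRN powR12_sqrt ?le_max ?lexx ?orbT//.
by case: (leP (D2 w) 0) => D0; rewrite ?(max_r D0) ?sqrtr0 ?(ler0_sqrtr D0)// max_l// ltW.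
Qed.

Hypothesis ir2 : P.-integrable setT (EFin \o (fun o => resid_prod o ^+ 2)).

Let mr := measurable_resid_prod.

Let ir : P.-integrable setT (EFin \o resid_prod).
Proof.
have i1 : P.-integrable setT (EFin \o (fun=> 1 : R)) by exact: finite_measure_integrable_cst.
have i2 := integrableD measurableT i1 ir2.
apply: (le_integrable measurableT _ _ i2); first exact/measurable_EFinP.
move=> o _; rewrite lee_fin [leRHS]ger0_norm ?addr_ge0 ?sqr_ge0//.
rewrite -[resid_prod o ^+ 2]real_normK ?num_real//.
by have := sqr_ge0 (`|resid_prod o| - 1); have := normr_ge0 (resid_prod o); nra.
Qed.

(** The factor (X - f(Z)) w(Z) is a function of (X, Z), against which Y - g(Z) integrates to 0. The
    product is integrable, being dominated by C |eps xi|. *)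
Let mean0 n a : \int[P]_o (resid_prod o * obs_weight n (a, o)) = 0.
Proof.
have [ciXY _] := cond_indep_fun_P0 ci.
pose h o := (Xo o - f (Zo o)) * what n a (Zo o).
have mwa : measurable_fun setT (what n a).
  by have H := measurableT_comp (mwhat n) (pair1_measurable a); exact H.
have mh : measurable_fun setT (h : g_sigma_algebraType (pair_sets (@Xo R d)) -> R).
  apply: measurable_funM; last exact: (@measurable_pair_sets_snd _ _ Xo _ _ (what n a)).
  apply: measurable_funB; first exact: (@measurable_pair_sets_fst _ _ Xo _ _ id).
  by apply: (@measurable_pair_sets_snd _ _ Xo _ _ f) => //; exact: cf.1.
have hE o : h o * (Yo o - g (Zo o)) = resid_prod o * obs_weight n (a, o).
  by rewrite /h /resid_prod /obs_weight /=; ring.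
have mhT : measurable_fun setT (fun o => h o * (Yo o - g (Zo o))).
  apply: measurable_funM => //; apply: measurable_funM => //.
  exact: mfZ.
have := @integral0_pi_system _ _ _ P _ (pair_sets_measurable mX) (@pair_sets_setI _ _ Xo)
  (fun o => Yo o - g (Zo o)) (@pair_sets_setT _ _ Xo) (integrable_resid mY cg)
  (fun E EX => ci_mean0 mX mY ciXY cg EX) h mh.
move=> int0; rewrite /Rintegral (eq_integral (fun o => (h o * (Yo o - g (Zo o)))%:E)); last first.
  by move=> o _; rewrite hE.
rewrite int0//.
  have iC := integrableZl measurableT C ir.
  apply: (le_integrable measurableT _ _ iC); first exact/measurable_EFinP.
  move=> o _; rewrite /= hE lee_fin !normrM (ger0_norm (ltW C0)) mulrC.
  by rewrite ler_wpM2r// whatC.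
Qed.

Let indep n (T : nat -> set (Obs R d)) (B : set TA) :
  (forall i, measurable (T i)) -> measurable B ->
  Pr (A @^-1` B `&` \bigcap_(i in `I_n) (O i @^-1` T i)) =
  (Pr (A @^-1` B) * \prod_(i < n) P (T i))%E.
Proof. exact: iid.2.2. Qed.

Let small E b := measurable E /\ (Pr E <= b%:E)%E.

Let smallU E F a b : small E a -> small F b -> small (E `|` F) (a + b).
Proof.
move=> [mE1 Ea] [mF Fb]; split; first exact: measurableU.
apply: (le_trans (measureU2 _ _ _)) => //; rewrite EFinD; exact: leeD.
Qed.

Let mlt (h : Omega -> R) a : measurable_fun setT h -> measurable [set w | a < h w].
Proof.
move=> mh; rewrite -[X in measurable X]setTI.
by have := mh measurableT _ (measurable_itv `]a, +oo[); congr measurable;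
  apply/seteqP; split => w /=; rewrite in_itv/= andbT.
Qed.

Let mge (h : Omega -> R) a : measurable_fun setT h -> measurable [set w | a <= h w].
Proof.
move=> mh; rewrite -[X in measurable X]setTI.
by have := mh measurableT _ (measurable_itv `[a, +oo[); congr measurable;
  apply/seteqP; split => w /=; rewrite in_itv/= andbT.
Qed.

Let mle (h : Omega -> R) a : measurable_fun setT h -> measurable [set w | h w <= a].
Proof.
move=> mh; rewrite -[X in measurable X]setTI.
by have := mh measurableT _ (measurable_itv `]-oo, a]); congr measurable;
  apply/seteqP; split => w /=; rewrite in_itv/=.
Qed.

Let mnorm (h : Omega -> R) : measurable_fun setT h -> measurable_fun setT (fun w => `|h w|).
Proof. by move=> mh; exact: measurableT_comp. Qed.

(** Union bound over ten bad events: four of probability [p] (small variance, and the three little-o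
    hypotheses), the tail of the normalised sum, four noise events, and the law of large numbers.
    Off all of them the deterministic comparison applies. *)
Lemma statistic_cdf_bound n (K tau c p L x1 d1 e theta e2 kappa delta : R) :
  (0 < n)%N -> 0 < K -> \int[P]_o (resid_prod o ^+ 2 * (K < `|resid_prod o|)%R%:R) <= tau ->
  0 < c -> (Pr (A @^-1` (~` var_good P resid_prod (obs_weight n) c)) <= p%:E)%E ->
  0 < L -> 0 < x1 -> 0 <= d1 -> 0 < e -> C ^+ 2 * tau < e -> 0 < theta -> 0 <= kappa -> 0 < delta ->
  (Pr [set w | ((x1 / C) ^+ 2 < `|A_f O fhat f n w * A_g O ghat g n w / n%:R^-1|)%R] <= p%:E)%E ->
  (Pr [set w | (d1 < `|B_f O fhat f v n w / 1|)%R] <= p%:E)%E ->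
  (Pr [set w | (d1 < `|B_g O ghat g u n w / 1|)%R] <= p%:E)%E ->
  let Smax := C ^+ 2 * (K ^+ 2 + tau) in
  theta * (Smax + 3 * e) + (1 + theta^-1) * (9 * x1 ^+ 2) + 3 * e
    + 2 * (L ^+ 2 * Smax + 9 * x1 ^+ 2) / n%:R <= e2 ->
  e2 <= c / 2 ->
  3 * x1 / Num.sqrt (c / 2) + L * e2 * 2 / c <= kappa ->
  forall t, `|fine (Pr [set w | Tstat O A fhat ghat what n w <= t]) - Phi t| <=
    (3 * delta * normal_peak 1 + smooth_cut_cst delta *
      ((C * K / Num.sqrt (n%:R * c) + C ^+ 2 * tau / c) + 4 * normal_pdf 0 1 0 / Num.sqrt n%:R))
    + 2 * (4 * p + L ^- 2 + 4 * (C ^+ 2 * d1 / x1 ^+ 2) +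
         (C ^+ 2 * tau / e + ((C * K) ^+ 2) ^+ 2 / (n%:R * e ^+ 2)))
    + normal_peak 1 * kappa.
Proof.
move=> n0 K0 tailE c0 pG L0 x10 d10 e0 taue th0 k0 delta0 pAB pBf pBg Smax He2 e2c Hk t.
have WC q : `|obs_weight n q| <= C by exact: whatC.
have [ciXY ciYX] := cond_indep_fun_P0 ci.
have mS : measurable_fun setT (S n).
  by apply: measurable_psum => //; exact: (measurable_std_term P mr (measurable_obs_weight n) n).
have mgood := measurable_var_good P mr (measurable_obs_weight n) c.
have mpre (B : set TA) : measurable B -> measurable (A @^-1` B).
  by move=> mB; rewrite -[X in measurable X]setTI; exact: mA.
have ms2 : measurable_fun setT (fun w => s2 n (A w)).
  by apply: measurableT_comp => //; exact: (measurable_cond_var P mr (measurable_obs_weight n)).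
have mfitX i k : (i < n)%N -> (k < n)%N -> measurable_fun setT
    ((fun w => fhat n w (zs O i w)) : g_sigma_algebraType (cyl O A n k (pair_sets Xo)) -> R).
  exact: regression_XZ_measurable.
have mfitY i k : (i < n)%N -> (k < n)%N -> measurable_fun setT
    ((fun w => ghat n w (zs O i w)) : g_sigma_algebraType (cyl O A n k (pair_sets Yo)) -> R).
  exact: regression_YZ_measurable.
have x20 : 0 < x1 ^+ 2 by rewrite exprn_gt0.
have E1 : small (A @^-1` (~` var_good P resid_prod (obs_weight n) c)) p.
  by split => //; apply: mpre; exact: measurableC.
have E2 : small (A @^-1` (var_good P resid_prod (obs_weight n) c) `&` [set w | L <= `|S n w|]) (L ^- 2).
  split; first by apply: measurableI; [exact: mpre|apply: mge; exact: mnorm].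
  exact: (weighted_tight mO mA indep mr (measurable_obs_weight n) C0 WC ir2 (mean0 n)).
have E3 : small [set w | (x1 / C) ^+ 2 < `|A_f O fhat f n w * A_g O ghat g n w / n%:R^-1|] p.
  split => //; apply: mlt; apply: mnorm.
  by have := mAB n; rewrite /AB; under [X in _ -> measurable_fun _ X]eq_fun do rewrite invrK mulrC.
have E4 : small [set w | d1 < `|B_f O fhat f v n w / 1|] p.
  by split => //; apply: mlt; apply: mnorm; apply: measurable_funM.
have E5 : small [set w | d1 < `|B_g O ghat g u n w / 1|] p.
  by split => //; apply: mlt; apply: mnorm; apply: measurable_funM.
have E6 : small ([set w | B_f O fhat f v n w <= d1] `&` [set w | x1 <= `|cross_f n w|]) (C ^+ 2 * d1 / x1 ^+ 2).
  split; first by apply: measurableI; [exact: mle|apply: mge; exact: mnorm].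
  have H := noise_sum_prob iid mX mY ciXY cf.1 cg cv
    (fit := fun i w => fhat n w (zs O i w)) n0 mfitX (mwhat n) (whatC n) d10 x10; exact H.
have E7 : small ([set w | B_g O ghat g u n w <= d1] `&` [set w | x1 <= `|cross_g n w|]) (C ^+ 2 * d1 / x1 ^+ 2).
  split; first by apply: measurableI; [exact: mle|apply: mge; exact: mnorm].
  have H := noise_sum_prob iid mY mX ciYX cg.1 cf cu
    (fit := fun i w => ghat n w (zs O i w)) n0 mfitY (mwhat n) (whatC n) d10 x10; exact H.
have E8 : small ([set w | B_f O fhat f v n w <= d1] `&` [set w | x1 ^+ 2 <= cross_sqr_f n w]) (C ^+ 2 * d1 / x1 ^+ 2).
  split; first by apply: measurableI; [exact: mle|exact: mge].
  have H := noise_sqr_prob iid mX mY ciXY cf.1 cg cv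
    (fit := fun i w => fhat n w (zs O i w)) n0 mfitX (mwhat n) (whatC n) d10 x20; exact H.
have E9 : small ([set w | B_g O ghat g u n w <= d1] `&` [set w | x1 ^+ 2 <= cross_sqr_g n w]) (C ^+ 2 * d1 / x1 ^+ 2).
  split; first by apply: measurableI; [exact: mle|exact: mge].
  have H := noise_sqr_prob iid mY mX ciYX cg.1 cf cu
    (fit := fun i w => ghat n w (zs O i w)) n0 mfitY (mwhat n) (whatC n) d10 x20; exact H.
have E10 : small [set w | 3 * e <= `|mean_sqr n w - s2 n (A w)|]
    (C ^+ 2 * tau / e + ((C * K) ^+ 2) ^+ 2 / (n%:R * e ^+ 2)).
  split; first by apply: mge; apply: mnorm; exact: measurable_funB.
  exact: (weighted_lln mO mA indep mr (measurable_obs_weight n) C0 K0 WC ir2 tailE n0 e0 taue).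
have := smallU E1 (smallU E2 (smallU E3 (smallU E4 (smallU E5
  (smallU E6 (smallU E7 (smallU E8 (smallU E9 E10)))))))).
set Bad := (X in small X _); set b := (X in small _ X) => -[mBad pBad].
have -> : 4 * p + L ^- 2 + 4 * (C ^+ 2 * d1 / x1 ^+ 2) +
    (C ^+ 2 * tau / e + ((C * K) ^+ 2) ^+ 2 / (n%:R * e ^+ 2)) = b by rewrite /b; ring.
apply: (cdf_compare (mpre _ mgood) mBad (measurable_Tstat n) mS k0 pBad) => [w nBad|s]; last first.
  exact: (weighted_clt mO mA indep mr (measurable_obs_weight n) C0 K0 WC ir2 (mean0 n) tailE n0 c0).
move: nBad; rewrite /Bad.
move=> /not_orP[/contrapT B1] /not_orP[B2] /not_orP[B3] /not_orP[B4] /not_orP[B5].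
move=> /not_orP[B6] /not_orP[B7] /not_orP[B8] /not_orP[B9] B10; split => //.
have {}B2 : `|S n w| < L by rewrite ltNge; apply/negP => h; exact: B2.
(* With this threshold, the Cauchy-Schwarz term is at most [x1] in the numerator and [x1 ^+ 2] in
   the denominator, like the noise terms. *)
have {}B3 : AB n w <= (x1 / C) ^+ 2.
  apply: (le_trans (ler_norm _)); rewrite leNgt; apply/negP => h; apply: B3 => /=.
  by rewrite invrK [_ * n%:R]mulrC; exact: h.
have {}B4 : B_f O fhat f v n w <= d1.
  apply: (le_trans (ler_norm _)); rewrite leNgt; apply/negP => h; apply: B4 => /=.
  by rewrite divr1.
have {}B5 : B_g O ghat g u n w <= d1.
  apply: (le_trans (ler_norm _)); rewrite leNgt; apply/negP => h; apply: B5 => /=.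
  by rewrite divr1.
have {}B6 : `|cross_f n w| <= x1 by rewrite leNgt; apply/negP => h; apply: B6; split => //=; exact: ltW.
have {}B7 : `|cross_g n w| <= x1 by rewrite leNgt; apply/negP => h; apply: B7; split => //=; exact: ltW.
have {}B8 : cross_sqr_f n w <= x1 ^+ 2 by rewrite leNgt; apply/negP => h; apply: B8; split => //=; exact: ltW.
have {}B9 : cross_sqr_g n w <= x1 ^+ 2 by rewrite leNgt; apply/negP => h; apply: B9; split => //=; exact: ltW.
have {}B10 : `|mean_sqr n w - s2 n (A w)| <= 3 * e by rewrite leNgt; apply/negP => h; apply: B10; exact: ltW.
have Cx : C * (x1 / C) = x1 by field; exact: lt0r_neq0.
apply: (@statistic_close n w c L (x1 / C) x1 (x1 ^+ 2) (3 * e) Smax theta e2 kappa) => //; try exact: ltW.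
- exact: (cond_var_le mr (measurable_obs_weight n) C0 K0 WC ir2 tailE).
- by rewrite divr_ge0// ltW.
- by rewrite Cx.
- by rewrite -[leRHS](congr1 (fun z => z ^+ 2) Cx) exprMn ler_wpM2l ?sqr_ge0.
Qed.

End gcm_sample.

(** * Uniformity over the family: choice of the constants *)

Section uniform_cdf.
Context (R : realType) (d : nat) (dO : measure_display) (Omega : measurableType dO)
  (dA : measure_display) (TA : measurableType dA).
Variables (O : nat -> Omega -> Obs R d) (A : Omega -> TA).
Variables (Pr : probability (Obs R d) R -> probability Omega R).
Variables (fhat ghat : nat -> Omega -> Zsp R d -> R) (what : nat -> TA -> Zsp R d -> R) (C : R).
Hypothesis C0 : 0 < C.
Hypothesis whatC : forall n a z, `|what n a z| <= C.
Hypothesis mwhat : forall n, measurable_fun setT (fun p : TA * Zsp R d => what n p.1 p.2).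
Hypothesis regX : regression_XZ O fhat.
Hypothesis regY : regression_YZ O ghat.
Variables (fam : set (probability (Obs R d) R)).
Variables (f g u v : probability (Obs R d) R -> Zsp R d -> R).
Hypothesis famci : forall P, fam P -> cond_indep P.
Hypothesis famE : forall P, fam P ->
  [/\ cond_exp P Xo (f P), cond_exp P Yo (g P),
      cond_exp_nonneg P (fun o => (Xo o - f P (Zo o)) ^+ 2) (u P),
      cond_exp_nonneg P (fun o => (Yo o - g P (Zo o)) ^+ 2) (v P)
    & iid_indep O A (Pr P) P].

Let rarely (E : probability (Obs R d) R -> nat -> set Omega) := forall rho : R, 0 < rho ->
  \forall n \near \oo, forall P, fam P -> (Pr P (E P n) <= rho%:E)%E.

Hypothesis rareAB : forall delta : R, 0 < delta -> rarely (fun P n =>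
  [set w | delta < `|A_f O fhat (f P) n w * A_g O ghat (g P) n w / n%:R^-1|]).
Hypothesis rareBf : forall delta : R, 0 < delta -> rarely (fun P n =>
  [set w | delta < `|B_f O fhat (f P) (v P) n w / 1|]).
Hypothesis rareBg : forall delta : R, 0 < delta -> rarely (fun P n =>
  [set w | delta < `|B_g O ghat (g P) (u P) n w / 1|]).
Hypothesis unif_tail : forall tau : R, 0 < tau -> exists2 K : R, 0 < K & forall P, fam P ->
  P.-integrable setT (EFin \o (fun o => resid_prod (f P) (g P) o ^+ 2)) /\
  \int[P]_o (resid_prod (f P) (g P) o ^+ 2 * (K < `|resid_prod (f P) (g P) o|)%R%:R) <= tau.
Hypothesis var_low : forall rho : R, 0 < rho -> exists2 c : R, 0 < c & forall P n, fam P ->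
  (Pr P (A @^-1` (~` var_good P (resid_prod (f P) (g P)) (obs_weight what n) c)) <= rho%:E)%E.

Let near_le_nat (M eta : R) : 0 < eta -> \forall n \near \oo, M / n%:R <= eta.
Proof.
move=> eta0; near=> n.
have n0 : 0 < (n%:R : R) by rewrite ltr0n; near: n; exact: nbhs_infty_gt.
rewrite ler_pdivrMr// mulrC -ler_pdivrMr//; near: n; exact: nbhs_infty_ger.
Unshelve. all: by end_near. Qed.

Let near_le_sqrt (M eta : R) : 0 < eta -> \forall n \near \oo, M / Num.sqrt n%:R <= eta.
Proof.
move=> eta0; near=> n.
have n0 : 0 < (n%:R : R) by rewrite ltr0n; near: n; exact: nbhs_infty_gt.
rewrite ler_pdivrMr ?sqrtr_gt0// mulrC -ler_pdivrMr//.
have : (M / eta) ^+ 2 <= n%:R by near: n; exact: nbhs_infty_ger.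
move=> /ler_wsqrtr; rewrite sqrtr_sqr; apply: le_trans; exact: ler_norm.
Unshelve. all: by end_near. Qed.

(** The order of choice matters: [c] and [L] come from [p]; [kappa], [delta] and [e2] from the
    tolerance; then [tau], on which the level [K] depends; then [theta] and [x1], which depend on
    [K] through [Smax]; [n] comes last. No choice refers to a particular law. *)
Lemma uniform_cdf_close (eps : R) : 0 < eps -> \forall n \near \oo, forall P, fam P -> forall t,
  `|fine (Pr P [set w | Tstat O A fhat ghat what n w <= t]) - Phi t| <= eps.
Proof.
move=> eps0.
have pk0 : 0 <= normal_peak (1 : R) by exact: normal_peak_ge0.
have pk1 : 0 < normal_peak (1 : R) + 1 by lra.
(* The final total is at most [57 * p]: 10 for the smoothing width, 15 for the Lindeberg terms, 22
   for twice the bad events, 10 for the threshold shift [kappa]. *)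
pose p := eps / 100; have p0 : 0 < p by rewrite /p; lra.
have [c c0 Hc] := var_low p0.
(* As [L] is at least 1 and at least 1/p, so is its square; this avoids a square root. *)
pose L := p^-1 + 1; have pV0 : 0 < p^-1 by rewrite invr_gt0.
have L1 : 1 <= L by rewrite /L; lra.
have L0 : 0 < L by lra.
have Lp : L ^- 2 <= p.
  rewrite -[leRHS]invrK lef_pV2 ?posrE ?exprn_gt0//.
  by apply: (@le_trans _ _ L); [rewrite /L; lra|rewrite expr2 ler_peMl// ltW].
pose kappa := eps / (10 * (normal_peak 1 + 1)).
have k0 : 0 < kappa by rewrite divr_gt0// mulr_gt0.
have kE : normal_peak 1 * kappa <= eps / 10.
  rewrite /kappa mulrA ler_pdivrMr ?mulr_gt0//.
  by rewrite [leRHS](_ : _ = eps * (normal_peak 1 + 1)); [nra|field].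
pose delta := kappa / 3; have d0 : 0 < delta by rewrite divr_gt0.
have dE : 3 * delta * normal_peak 1 = normal_peak 1 * kappa by rewrite /delta; field.
(* Half of [kappa] is left to the denominator error, the other half to the numerator error. *)
pose e2 := Num.min (c / 2) (kappa * c / (4 * L)).
have e20 : 0 < e2 by rewrite lt_min; apply/andP; split; rewrite divr_gt0// mulr_gt0.
have e2c : e2 <= c / 2 by rewrite ge_min lexx.
have e2k : L * e2 * 2 / c <= kappa / 2.
  have : e2 <= kappa * c / (4 * L) by rewrite ge_min lexx orbT.
  rewrite ler_pdivlMr ?mulr_gt0// => H.
  by rewrite ler_pdivrMr//; lra.
(* [e2] is split into four quarters: the Young term, the mean squares of the errors, the law of
   large numbers [3 * e], and the squared mean. *)
pose e := e2 / 12; have e0 : 0 < e by rewrite divr_gt0.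
set M := smooth_cut_cst delta; have M0 : 0 < M by apply: lt_le_trans (smooth_cut_cst_ge1 d0).
have C2 : 0 < C ^+ 2 by rewrite exprn_gt0.
(* In order: the strict condition of the truncated law of large numbers, hence the half; its Markov
   bound; and the Lindeberg tail term multiplied by [M]. *)
pose tau0 := Num.min (Num.min (e / 2) (p * e)) (eps * c / (20 * M)).
have tau00 : 0 < tau0 by rewrite !lt_min -andbA; apply/and3P; split; rewrite ?divr_gt0// ?mulr_gt0.
pose tau := tau0 / C ^+ 2; have tau_gt0 : 0 < tau by rewrite divr_gt0.
have tauE : C ^+ 2 * tau = tau0 by rewrite /tau; field; exact: lt0r_neq0.
have [K K0 HK] := unif_tail tau_gt0.
pose Smax := C ^+ 2 * (K ^+ 2 + tau).
have S0 : 0 < Smax + 3 * e.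
  by rewrite addr_gt0 ?mulr_gt0// addr_gt0// exprn_gt0.
pose theta := e2 / (4 * (Smax + 3 * e)).
have th0 : 0 < theta by rewrite divr_gt0 ?mulr_gt0.
have thE : theta * (Smax + 3 * e) = e2 / 4.
  by rewrite /theta; field; exact: lt0r_neq0.
have thV : 0 < 1 + theta^-1 by rewrite addr_gt0 ?invr_gt0.
have sc0 : 0 < Num.sqrt (c / 2) by rewrite sqrtr_gt0 divr_gt0.
(* The bound by 1 gives that the square of [x1] is at most [x1], so linear conditions suffice. *)
pose x1 := Num.min (Num.min 1 (kappa * Num.sqrt (c / 2) / 6)) (e2 / (36 * (1 + theta^-1))).
have x10 : 0 < x1.
  rewrite !lt_min ltr01 /= -?andbA; apply/andP; split; first by rewrite divr_gt0// mulr_gt0.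
  by rewrite divr_gt0// mulr_gt0.
have x1k : 3 * x1 / Num.sqrt (c / 2) <= kappa / 2.
  have : x1 <= kappa * Num.sqrt (c / 2) / 6 by rewrite !ge_min lexx !orbT.
  by rewrite ler_pdivrMr//; lra.
have x1e : (1 + theta^-1) * (9 * x1 ^+ 2) <= e2 / 4.
  have h1 : x1 <= 1 by rewrite !ge_min lexx.
  have : x1 <= e2 / (36 * (1 + theta^-1)) by rewrite !ge_min lexx !orbT.
  rewrite ler_pdivlMr ?mulr_gt0// => h2.
  have h3 : x1 ^+ 2 <= x1 by rewrite expr2 ler_piMl// ltW.
  have h4 : (1 + theta^-1) * (9 * x1 ^+ 2) <= (1 + theta^-1) * (9 * x1).
    by rewrite ler_wpM2l ?(ltW thV)// ler_wpM2l.
  by lra.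
pose d1 := p * x1 ^+ 2 / C ^+ 2.
have x120 : 0 < x1 ^+ 2 by rewrite exprn_gt0.
have d10 : 0 < d1 by rewrite divr_gt0 ?mulr_gt0.
have d1E : C ^+ 2 * d1 / x1 ^+ 2 = p.
  by rewrite /d1; field; rewrite !lt0r_neq0.
have xC0 : 0 < (x1 / C) ^+ 2 by rewrite exprn_gt0 ?divr_gt0.
near=> n => P FP t.
have n0 : (0 < n)%N by near: n; exact: nbhs_infty_gt.
have rn0 : 0 < (n%:R : R) by rewrite ltr0n.
have [cf cg cu cv iid] := famE FP.
have [ir2 tailE] := HK _ FP.
have pAB : (Pr P [set w | ((x1 / C) ^+ 2 < `|A_f O fhat (f P) n w * A_g O ghat (g P) n w / n%:R^-1|)%R] <= p%:E)%E.
  (* The law is generalised again before [n] is released, so that the eventual bound is uniform over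
     the family. *)
  by move: P FP {cf cg cu cv iid ir2 tailE}; near: n; exact: rareAB.
have pBf : (Pr P [set w | (d1 < `|B_f O fhat (f P) (v P) n w / 1|)%R] <= p%:E)%E.
  by move: P FP {cf cg cu cv iid ir2 tailE pAB}; near: n; exact: rareBf.
have pBg : (Pr P [set w | (d1 < `|B_g O ghat (g P) (u P) n w / 1|)%R] <= p%:E)%E.
  by move: P FP {cf cg cu cv iid ir2 tailE pAB pBf}; near: n; exact: rareBg.
have tau1 : C ^+ 2 * tau < e.
  by rewrite tauE; apply: (@le_lt_trans _ _ (e / 2)); [rewrite !ge_min lexx|rewrite ltr_pdivrMr// ltr_pMr// ltr1n].
have tau2 : C ^+ 2 * tau / e <= p.
  by rewrite tauE ler_pdivrMr// !ge_min lexx !orbT.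
have tau3 : M * (C ^+ 2 * tau / c) <= eps / 20.
  have : tau0 <= eps * c / (20 * M) by rewrite !ge_min lexx !orbT.
  rewrite ler_pdivlMr ?mulr_gt0// => H.
  by rewrite tauE mulrA ler_pdivrMr// mulrAC ler_pdivlMr// -mulrA [M * _]mulrC -mulrA.
have n1 : 2 * (L ^+ 2 * Smax + 9 * x1 ^+ 2) / n%:R <= e2 / 4.
  by near: n; apply: near_le_nat; rewrite divr_gt0.
have n2 : ((C * K) ^+ 2) ^+ 2 / (n%:R * e ^+ 2) <= p.
  rewrite invfM [n%:R^-1 * _]mulrC mulrA.
  by near: n; exact: near_le_nat.
have n3 : M * (C * K / Num.sqrt (n%:R * c)) <= eps / 20.
  rewrite sqrtrM ?ler0n// invfM [_^-1 * _]mulrC !mulrA.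
  by near: n; apply: near_le_sqrt; rewrite divr_gt0.
have n4 : M * (4 * normal_pdf 0 1 0 / Num.sqrt n%:R) <= eps / 20.
  by rewrite mulrA; near: n; apply: near_le_sqrt; rewrite divr_gt0.
have e2H : theta * (Smax + 3 * e) + (1 + theta^-1) * (9 * x1 ^+ 2) + 3 * e
    + 2 * (L ^+ 2 * Smax + 9 * x1 ^+ 2) / n%:R <= e2.
  rewrite thE [leRHS](_ : _ = e2 / 4 + e2 / 4 + 3 * e + e2 / 4); last by rewrite /e; field.
  by rewrite !lerD.
have kH : 3 * x1 / Num.sqrt (c / 2) + L * e2 * 2 / c <= kappa.
  by rewrite [leRHS]splitr lerD.
have := statistic_cdf_bound C0 whatC mwhat regX regY iid cf cg cu cv (famci FP) ir2 n0 K0 tailE c0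
  (Hc P n FP) L0 x10 (ltW d10) e0 tau1 th0 (ltW k0) d0 pAB pBf pBg e2H e2c kH t.
move/le_trans; apply.
rewrite d1E dE -/M !mulrDr.
have -> : eps = 100 * p by rewrite /p; field.
have := kE; rewrite (_ : eps = 100 * p); last by rewrite /p; field.
move: tau3 n3 n4; rewrite (_ : eps = 100 * p); last by rewrite /p; field.
lra.
Unshelve. all: by end_near. Qed.

End uniform_cdf.

(** * Limits, moment bounds and the conditional variance *)

Section limits.
Context (R : realType).

Lemma cvg0_near_le (a : nat -> \bar R) : a @ \oo --> 0%E ->
  forall eps : R, 0 < eps -> \forall n \near \oo, (a n <= eps%:E)%E.
Proof.
move=> /fine_cvgP[afin /cvgr0Pnorm_le a0] eps eps0.
near=> n; have fn : a n \is a fin_num by near: n.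
rewrite -(fineK fn) lee_fin; apply: (le_trans (ler_norm _)).
by near: n; exact: a0.
Unshelve. all: by end_near. Qed.

(** Nonnegativity and one point of [S] keep the supremum above 0, so the uniform upper bounds
    decide. *)
Lemma ereal_sup_cvg0 (T : Type) (S : set T) (F : nat -> T -> \bar R) : S !=set0 ->
  (forall n t, S t -> (0 <= F n t)%E) ->
  (forall eps : R, 0 < eps -> \forall n \near \oo, forall t, S t -> (F n t <= eps%:E)%E) ->
  (fun n => ereal_sup [set F n t | t in S]) @ \oo --> 0%E.
Proof.
move=> [t0 St0] F0 H.
have sup0 n : (0 <= ereal_sup [set F n t | t in S])%E.
  by apply: (le_trans (F0 n t0 St0)); apply: ereal_sup_ubound; exists t0.
have sup_le (eps : R) : 0 < eps -> \forall n \near \oo, (ereal_sup [set F n t | t in S] <= eps%:E)%E.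
  move=> eps0; near=> n; apply: ge_ereal_sup => _ [t St <-].
  by move: t St; near: n; exact: H.
apply/fine_cvgP; split.
  near=> n; rewrite ge0_fin_numE//; apply: (@le_lt_trans _ _ 1%:E); last exact: ltry.
  by near: n; exact: sup_le.
apply/cvgr0Pnorm_le => eps eps0; near=> n.
rewrite ger0_norm /=; last exact: fine_ge0.
have le1 : (ereal_sup [set F n t | t in S] <= eps%:E)%E by near: n; exact: sup_le.
by apply: (fine_le _ _ le1) => //; rewrite ge0_fin_numE//; exact: le_lt_trans le1 (ltry _).
Unshelve. all: by end_near. Qed.

Lemma littleo_fam_near {I : Type} {dO : measure_display} {Omega : measurableType dO}
  (fam : set I) (Pr : I -> probability Omega R) (V : I -> nat -> Omega -> R) (W : nat -> R) :
  littleo_fam fam Pr V W -> forall delta rho : R, 0 < delta -> 0 < rho ->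
  \forall n \near \oo, forall P, fam P ->
    (Pr P [set w | (delta < `|V P n w / W n|)%R] <= rho%:E)%E.
Proof.
move=> lo delta rho delta0 rho0; near=> n => P FP.
have : (ereal_sup [set Pr P [set w | (delta < `|V P n w / W n|)%R] | P in fam] <= rho%:E)%E.
  by near: n; exact: cvg0_near_le (lo _ delta0) _ rho0.
by apply: le_trans; apply: ereal_sup_ubound; exists P.
Unshelve. all: by end_near. Qed.

(* [ereal_sup set0 = -oo], so the supremum over an empty family does not tend to 0. *)
Lemma littleo_fam_nonempty {I : Type} {dO : measure_display} {Omega : measurableType dO}
  (fam : set I) (Pr : I -> probability Omega R) (V : I -> nat -> Omega -> R) (W : nat -> R) :
  littleo_fam fam Pr V W -> fam !=set0.
Proof.
move=> lo; apply/set0P/eqP => fam0.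
have /fine_cvgP[+ _] := lo 1 ltr01.
by case=> N _ /(_ N (leqnn N)) /=; rewrite fam0 image_set0 ereal_sup0.
Qed.

End limits.

Section moment_tail.
Context d (T : measurableType d) (R : realType) (P : probability T R).

(** Above the level, r^2 K^eta is at most |r|^(2 + eta); everywhere, r^2 is at most 1 + |r|^(2 +
    eta), which gives integrability. *)
Lemma moment_tail (r : T -> R) (eta M K : R) : 0 < eta -> 0 < K -> measurable_fun setT r ->
  (\int[P]_o (`|r o| `^ (2 + eta))%:E <= M%:E)%E ->
  P.-integrable setT (EFin \o (fun o => r o ^+ 2)) /\
  \int[P]_o (r o ^+ 2 * (K < `|r o|)%R%:R) <= M / K `^ eta.
Proof.
move=> eta0 K0 mr HM.
have mp : measurable_fun setT (fun o => `|r o| `^ (2 + eta)).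
  apply: (measurableT_comp (f := fun x : R => x `^ (2 + eta))); first exact: measurable_powR.
  exact: measurableT_comp.
have mr2 : measurable_fun setT (fun o => r o ^+ 2).
  exact: (measurableT_comp (f := fun x : R => x ^+ 2)).
have ip : P.-integrable setT (EFin \o (fun o => `|r o| `^ (2 + eta))).
  apply/integrableP; split; first exact/measurable_EFinP.
  under eq_integral do rewrite /= ger0_norm ?powR_ge0//.
  exact: le_lt_trans HM (ltry _).
have i1 : P.-integrable setT (EFin \o (fun=> 1 : R)) by exact: finite_measure_integrable_cst.
have ip1 := integrableD measurableT i1 ip.
have ir2 : P.-integrable setT (EFin \o (fun o => r o ^+ 2)).
  apply: (le_integrable measurableT _ _ ip1); first exact/measurable_EFinP.
  move=> o _; rewrite lee_fin ger0_norm ?sqr_ge0// ger0_norm ?addr_ge0 ?powR_ge0//.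
  have [r1|r1] := leP `|r o| 1.
    have : r o ^+ 2 <= 1 by rewrite -real_normK ?num_real// expr_le1.
    by have := powR_ge0 `|r o| (2 + eta); lra.
  have : `|r o| `^ 2 <= `|r o| `^ (2 + eta) by apply: ler_powR; [exact: ltW|lra].
  by rewrite powR_mulrn// real_normK ?num_real//; lra.
split => //.
have Ke0 : 0 < K `^ eta by exact: powR_gt0.
have tail_le o : r o ^+ 2 * (K < `|r o|)%R%:R <= (K `^ eta)^-1 * `|r o| `^ (2 + eta).
  case: ltP => Kr; last by rewrite mulr0 mulr_ge0 ?invr_ge0 ?powR_ge0.
  have r0 : 0 < `|r o| by exact: lt_trans Kr.
  rewrite mulr1 powRD; last by rewrite (gt_eqF r0) implybT.
  rewrite powR_mulrn// real_normK ?num_real// mulrCA ler_peMr ?sqr_ge0//.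
  rewrite mulrC ler_pdivlMr// mul1r; apply: ge0_ler_powR; rewrite ?nnegrE ?normr_ge0//; exact: ltW.
have mt : measurable_fun setT (fun o => r o ^+ 2 * (K < `|r o|)%R%:R).
  apply: measurable_funM => //.
  rewrite (_ : (fun o => _) = (\1_(`]K, +oo[) : R -> R) \o (fun o => `|r o|)); last first.
    by apply/funext => o; rewrite /= indicE mem_setE in_itv/= andbT.
  by apply: (measurableT_comp (f := (\1_(`]K, +oo[) : R -> R))) => //; exact: measurableT_comp.
have iKp := integrableZl measurableT (K `^ eta)^-1 ip.
apply: (@le_trans _ _ (\int[P]_o ((K `^ eta)^-1 * `|r o| `^ (2 + eta)))).
  apply: le_Rintegral => //.
  apply: (le_integrable measurableT _ _ iKp); first exact/measurable_EFinP.
  move=> o _; rewrite lee_fin ger0_norm ?(mulr_ge0 (sqr_ge0 _) (ler0n _ _))//.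
  by apply: (le_trans (tail_le o)); exact: ler_norm.
have -> := RintegralZl (K `^ eta)^-1 measurableT ip; rewrite [leRHS]mulrC ler_wpM2l ?invr_ge0 ?(ltW Ke0)//.
rewrite -lee_fin /Rintegral fineK//; exact: integrable_fin_num ip.
Qed.

(* [K] depends on the law only through the moment bound [M]. *)
Lemma moment_tail_le (eta M tau : R) : 0 < eta -> 0 < tau ->
  exists2 K : R, 0 < K & M / K `^ eta <= tau.
Proof.
move=> eta0 tau0; have M0 : 0 < (`|M| + 1) / tau.
  by rewrite divr_gt0// ltr_wpDl.
exists (((`|M| + 1) / tau) `^ eta^-1); first exact: powR_gt0.
rewrite -powRrM mulVf ?lt0r_neq0// powRr1 ?(ltW M0)//.
rewrite ler_pdivrMr// mulrC divfK ?lt0r_neq0//.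
by have := ler_norm M; lra.
Qed.

End moment_tail.

Section variance_lower_bound.
Context (R : realType) (d : nat) (dO : measure_display) (Omega : measurableType dO)
  (dA : measure_display) (TA : measurableType dA).
Variables (A : Omega -> TA) (Pr : probability Omega R) (P : probability (Obs R d) R).
Variables (what : nat -> TA -> Zsp R d -> R) (C : R) (f g : Zsp R d -> R).
Hypothesis C0 : 0 < C.
Hypothesis whatC : forall n a z, `|what n a z| <= C.
Hypothesis mwhat : forall n, measurable_fun setT (fun p : TA * Zsp R d => what n p.1 p.2).
Hypothesis mA : measurable_fun setT A.
Hypothesis mr : measurable_fun setT (resid_prod f g).
Hypothesis ir2 : P.-integrable setT (EFin \o (fun o => resid_prod f g o ^+ 2)).

Local Notation s2 n := (cond_var P (resid_prod f g) (obs_weight what n)).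
Local Notation good n c := (var_good P (resid_prod f g) (obs_weight what n) c).

Let mW n : measurable_fun setT (obs_weight (d := d) what n).
Proof. exact: measurable_obs_weight. Qed.

(** Bounded weights and square integrability of eps xi make the extended integral finite, so nothing
    is lost in passing to a real number. *)
Lemma sigma2E n a : sigma2 what P f g n a = (s2 n a)%:E.
Proof.
have E o : what n a (Zo o) ^+ 2 * (Xo o - f (Zo o)) ^+ 2 * (Yo o - g (Zo o)) ^+ 2 =
    (resid_prod f g o * obs_weight what n (a, o)) ^+ 2.
  by rewrite /resid_prod /obs_weight /=; ring.
rewrite /sigma2 (eq_integral (fun o => ((resid_prod f g o * obs_weight what n (a, o)) ^+ 2)%:E)); last first.
  by move=> o _; rewrite E.
rewrite /cond_var /Rintegral fineK//.
have iC := integrableZl measurableT (C ^+ 2) ir2.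
apply: (integrable_fin_num measurableT); apply: (le_integrable measurableT _ _ iC).
  apply/measurable_EFinP.
  apply: (measurableT_comp (f := fun x : R => x ^+ 2)) => //.
  by apply: measurable_funM => //; exact: (measurableT_comp (mW n) (pair1_measurable a)).
move=> o _; rewrite lee_fin ger0_norm ?sqr_ge0// ger0_norm ?(mulr_ge0 (sqr_ge0 _) (sqr_ge0 _))//.
rewrite exprMn mulrC ler_wpM2r ?sqr_ge0// -real_normK ?num_real//.
by rewrite lerXn2r ?nnegrE ?(ltW C0)//; exact: whatC.
Qed.

Let mbad n c : measurable (A @^-1` (~` good n c)).
Proof.
rewrite -[X in measurable X]setTI; apply: mA => //.
by apply: measurableC; exact: measurable_var_good.
Qed.

Lemma ae_var_good c n : {ae Pr, forall w, forall n, (c%:E <= sigma2 what P f g n (A w))%E} ->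
  Pr (A @^-1` (~` good n c)) = 0%E.
Proof.
move=> [N [mN N0 sub]]; apply/eqP; rewrite eq_le measure_ge0 andbT -N0.
apply: le_measure; rewrite ?inE// => w /= nw; apply: sub => /= H; apply: nw.
by have := H n; rewrite sigma2E lee_fin.
Qed.

(** Here the lower bound is random. The events [F k], that some variance is below 1/(k + 1),
    decrease to a null event; by continuity from above, one deterministic constant works for all [n]
    outside an event of small probability. *)
Lemma ae_var_good_approx : {ae Pr, forall w, exists c : R, 0 < c /\
    forall n, (c%:E <= sigma2 what P f g n (A w))%E} ->
  forall rho : R, 0 < rho ->
  exists2 c : R, 0 < c & forall n, (Pr (A @^-1` (~` good n c)) <= rho%:E)%E.
Proof.
move=> [N [mN N0 sub]] rho rho0.
pose F k := \bigcup_n (A @^-1` (~` good n k.+1%:R^-1)).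
have mF k : measurable (F k) by apply: bigcup_measurable => n _; exact: mbad.
have mFI : measurable (\bigcap_k F k) by exact: bigcapT_measurable.
have F0 : Pr (\bigcap_k F k) = 0%E.
  apply/eqP; rewrite eq_le measure_ge0 andbT -N0.
  apply: le_measure; rewrite ?inE// => w Fw; apply: sub => /= -[c [c0 Hc]].
  have [k _ kc] := near_infty_natSinv_lt (PosNum c0).
  have [n _ /=] := Fw k I; apply; rewrite /var_good/=.
  have := Hc n; rewrite sigma2E lee_fin; apply: le_trans.
  by apply/ltW/(kc k) => /=.
have Fdec : {homo F : n m / (n <= m)%N >-> (m <= n)%O}.
  move=> k m km; apply/subsetPset => w [n _ /= H]; exists n => //= H2; apply: H.
  apply: le_trans H2; rewrite lef_pV2 ?posrE// ler_nat ltnS//.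
have Foo : (Pr (F 0%N) < +oo)%E by apply: le_lt_trans (ltry 1); exact: probability_le1.
have cvgF : (fun k => Pr (F k)) @ \oo --> 0%E.
  by rewrite -F0; exact: (nonincreasing_cvg_mu Foo mF mFI Fdec).
have [k _ Hk] := cvg0_near_le cvgF rho0.
exists k.+1%:R^-1 => [|n]; first by rewrite invr_gt0.
apply: le_trans (Hk k (leqnn k)); apply: le_measure; rewrite ?inE//.
by move=> w Hw; exists n.
Qed.

End variance_lower_bound.

(** Common core of the pointwise and uniform parts. The variance hypothesis has the form that both
    can supply, a constant [c] for each tolerated probability [rho], and the moment hypothesis is a
    common bound [M]. *)
Lemma gcm_asymptotic_normality (R : realType) (d : nat)
  (dO : measure_display) (Omega : measurableType dO)
  (dA : measure_display) (TA : measurableType dA)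
  (O : nat -> Omega -> Obs R d) (A : Omega -> TA)
  (Pr : probability (Obs R d) R -> probability Omega R)
  (fhat ghat : nat -> Omega -> Zsp R d -> R)
  (what : nat -> TA -> Zsp R d -> R) (C : R)
  (fam : set (probability (Obs R d) R)) (f g u v : probability (Obs R d) R -> Zsp R d -> R)
  (eta M : R) :
  0 < C -> (forall n a z, `|what n a z| <= C) ->
  (forall n, measurable_fun setT (fun p : TA * Zsp R d => what n p.1 p.2)) ->
  regression_XZ O fhat -> regression_YZ O ghat ->
  fam `<=` @P0 R d ->
  (forall P, fam P ->
     [/\ cond_exp P Xo (f P), cond_exp P Yo (g P),
         cond_exp_nonneg P (fun o => (Xo o - f P (Zo o)) ^+ 2) (u P),
         cond_exp_nonneg P (fun o => (Yo o - g P (Zo o)) ^+ 2) (v P)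
       & iid_indep O A (Pr P) P]) ->
  littleo_fam fam Pr
    (fun P n w => A_f O fhat (f P) n w * A_g O ghat (g P) n w) (fun n => n%:R^-1) ->
  littleo_fam fam Pr (fun P => B_f O fhat (f P) (v P)) (fun _ => 1) ->
  littleo_fam fam Pr (fun P => B_g O ghat (g P) (u P)) (fun _ => 1) ->
  0 < eta ->
  (forall P, fam P -> (\int[P]_o
     (`|(Xo o - f P (Zo o)) * (Yo o - g P (Zo o))| `^ (2 + eta))%:E <= M%:E)%E) ->
  (forall rho : R, 0 < rho -> exists2 c : R, 0 < c & forall P n, fam P ->
    (Pr P (A @^-1` (~` var_good P (resid_prod (f P) (g P)) (obs_weight what n) c)) <= rho%:E)%E) ->
  forall eps : R, 0 < eps -> \forall n \near \oo, forall P t, fam P ->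
    (`|Pr P [set w | (Tstat O A fhat ghat what n w <= t)%R] - (Phi t)%:E| <= eps%:E)%E.
Proof.
move=> C0 whatC mwhat regX regY famP famE oAB oBf oBg eta0 mom low eps eps0.
have tail (tau : R) : 0 < tau -> exists2 K : R, 0 < K & forall P, fam P ->
    P.-integrable setT (EFin \o (fun o => resid_prod (f P) (g P) o ^+ 2)) /\
    \int[P]_o (resid_prod (f P) (g P) o ^+ 2 * (K < `|resid_prod (f P) (g P) o|)%R%:R) <= tau.
  move=> tau0; have [K K0 HK] := moment_tail_le M eta0 tau0.
  exists K => // P FP; have [cf cg _ _ _] := famE _ FP.
  have [i2 le2] := moment_tail eta0 K0 (measurable_resid_prod cf cg) (mom _ FP).
  by split => //; apply: le_trans HK.
have := uniform_cdf_close C0 whatC mwhat regX regY (fun P FP => (famP P FP).2) famE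
  (fun delta delta0 rho => littleo_fam_near oAB delta0)
  (fun delta delta0 rho => littleo_fam_near oBf delta0)
  (fun delta delta0 rho => littleo_fam_near oBg delta0) tail low eps0.
apply: filterS => n H P t FP.
have [_ _ _ _ iid] := famE _ FP.
have mT := measurable_Tstat mwhat regX regY iid n.
have mTt : measurable [set w | Tstat O A fhat ghat what n w <= t].
  rewrite -[X in measurable X]setTI.
  by have := mT measurableT _ (measurable_itv `]-oo, t]); congr measurable;
    apply/seteqP; split => w /=; rewrite in_itv/=.
by rewrite -[Pr P _]fineK ?fin_num_measure// -EFinB abse_EFin lee_fin; exact: H.
Qed.

Theorem theorem3
 (R : realType) (d : nat)
  (dO : measure_display) (Omega : measurableType dO)
  (dA : measure_display) (TA : measurableType dA)
  (O : nat -> Omega -> Obs R d) (A : Omega -> TA)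
  (Pr : probability (Obs R d) R -> probability Omega R)
  (fhat ghat : nat -> Omega -> Zsp R d -> R)
  (what : nat -> TA -> Zsp R d -> R) (C : R) :
  0 < C ->
  (forall n a z, `|what n a z| <= C) ->
  (forall n, measurable_fun setT (fun p : TA * Zsp R d => what n p.1 p.2)) ->
  regression_XZ O fhat -> regression_YZ O ghat ->
  (* Part 1: pointwise *)
  (forall (P : probability (Obs R d) R) (f g u v : Zsp R d -> R),
     P0 P ->
     cond_exp P Xo f -> cond_exp P Yo g ->
     cond_exp_nonneg P (fun o => (Xo o - f (Zo o)) ^+ 2) u ->
     cond_exp_nonneg P (fun o => (Yo o - g (Zo o)) ^+ 2) v ->
     iid_indep O A (Pr P) P ->
     littleo_fam [set P] Pr
       (fun _ n w => A_f O fhat f n w * A_g O ghat g n w) (fun n => n%:R^-1) ->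
     littleo_fam [set P] Pr (fun _ => B_f O fhat f v) (fun _ => 1) ->
     littleo_fam [set P] Pr (fun _ => B_g O ghat g u) (fun _ => 1) ->
     (exists eta : R, 0 < eta /\
        (\int[P]_o (`|(Xo o - f (Zo o)) * (Yo o - g (Zo o))| `^ (2 + eta))%:E
           < +oo)%E) ->
     {ae Pr P, forall w, exists c : R, 0 < c /\
        forall n, (c%:E <= sigma2 what P f g n (A w))%E} ->
     (fun n => ereal_sup
        [set (`| Pr P [set w | (Tstat O A fhat ghat what n w <= t)%R] - (Phi t)%:E |)%E
        | t in [set: R]]) @ \oo --> 0%E)
  /\
  (* Part 2: uniform over a family *)
  (forall (fam : set (probability (Obs R d) R))
          (f g u v : probability (Obs R d) R -> Zsp R d -> R),
     fam `<=` @P0 R d ->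
     (forall P, fam P ->
        [/\ cond_exp P Xo (f P), cond_exp P Yo (g P),
            cond_exp_nonneg P (fun o => (Xo o - f P (Zo o)) ^+ 2) (u P),
            cond_exp_nonneg P (fun o => (Yo o - g P (Zo o)) ^+ 2) (v P)
          & iid_indep O A (Pr P) P]) ->
     littleo_fam fam Pr
       (fun P n w => A_f O fhat (f P) n w * A_g O ghat (g P) n w) (fun n => n%:R^-1) ->
     littleo_fam fam Pr (fun P => B_f O fhat (f P) (v P)) (fun _ => 1) ->
     littleo_fam fam Pr (fun P => B_g O ghat (g P) (u P)) (fun _ => 1) ->
     (exists eta : R, 0 < eta /\
        (ereal_sup [set \int[P]_o
            (`|(Xo o - f P (Zo o)) * (Yo o - g P (Zo o))| `^ (2 + eta))%:E
           | P in fam] < +oo)%E) ->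
     (exists c : R, 0 < c /\ forall P, fam P ->
        {ae Pr P, forall w, forall n, (c%:E <= sigma2 what P (f P) (g P) n (A w))%E}) ->
     (fun n => ereal_sup
        [set (`| Pr Pt.1 [set w | (Tstat O A fhat ghat what n w <= Pt.2)%R]
                 - (Phi Pt.2)%:E |)%E
        | Pt in [set Pt : probability (Obs R d) R * R | fam Pt.1]]) @ \oo --> 0%E).
Proof.
move=> C0 whatC mwhat regX regY; split.
  move=> P f g u v PP0 cf cg cu cv iid oAB oBf oBg [eta [eta0 mom]] low.
  set I := (\int[P]_o _)%E in mom.
  have I0 : (0 <= I)%E by apply: integral_ge0 => o _; rewrite lee_fin powR_ge0.
  have IE : I = (fine I)%:E by rewrite fineK// ge0_fin_numE.
  have mr := measurable_resid_prod cf cg.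
  (* Only integrability is kept, so the truncation level 1 is arbitrary. *)
  have [ir2 _] := moment_tail eta0 ltr01 mr (M := fine I) (eq_ind _ (fun z => z <= (fine I)%:E)%E (lexx _) _ (esym IE)).
  have low2 := ae_var_good_approx C0 whatC mwhat iid.2.1 mr ir2 low.
  apply: ereal_sup_cvg0; [by exists 0|by move=> n t _; exact: abse_ge0|].
  move=> eps eps0.
  have := @gcm_asymptotic_normality R d dO Omega dA TA O A Pr fhat ghat what C [set P]
    (fun=> f) (fun=> g) (fun=> u) (fun=> v) eta (fine I) C0 whatC mwhat regX regY.
  case/(_ _ _ oAB oBf oBg eta0 _ _ eps eps0).
  - by move=> _ ->.
  - by move=> _ ->; split.
  - by move=> _ ->; rewrite -IE.
  - move=> rho rho0; have [c c0 Hc] := low2 _ rho0.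
    by exists c => // _ n ->.
  by move=> N _ HN; exists N => // n Nn t _; exact: HN.
move=> fam f g u v famP famE oAB oBf oBg [eta [eta0 mom]] [c [c0 low]].
(* The little-o hypotheses exclude the empty family, for which the supremum in the conclusion would
   be -oo; a member also shows that the supremum of the moments is nonnegative, hence a real
   number. *)
have fam0 := littleo_fam_nonempty oBf.
have I0 (P : probability (Obs R d) R) : (0 <= \int[P]_o (`|(Xo o - f P (Zo o)) * (Yo o - g P (Zo o))| `^ (2 + eta))%:E)%E.
  by apply: integral_ge0 => o _; rewrite lee_fin powR_ge0.
set I := ereal_sup _ in mom.
have leI (P : probability (Obs R d) R) : fam P ->
    (\int[P]_o (`|(Xo o - f P (Zo o)) * (Yo o - g P (Zo o))| `^ (2 + eta))%:E <= I)%E.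
  by move=> FP; apply: ereal_sup_ubound; exists P.
have IE : I = (fine I)%:E.
  have [P FP] := fam0.
  by rewrite fineK// ge0_fin_numE//; exact: le_trans (I0 P) (leI P FP).
apply: ereal_sup_cvg0; last 2 first.
- by move=> n Pt _; exact: abse_ge0.
- move=> eps eps0.
  have := @gcm_asymptotic_normality R d dO Omega dA TA O A Pr fhat ghat what C fam
    f g u v eta (fine I) C0 whatC mwhat regX regY famP famE oAB oBf oBg eta0.
  case/(_ _ _ eps eps0).
  - by move=> P FP; rewrite -IE; exact: leI.
  (* With a constant lower bound the exceptional event is null, so one [c] serves every [rho]. *)
  - move=> rho rho0; exists c => // P n FP.
    have [cf cg _ _ iid] := famE _ FP.
    have mr := measurable_resid_prod cf cg.
    have momP := leI _ FP; rewrite IE in momP.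
    have [ir2 _] := moment_tail eta0 ltr01 mr momP.
    rewrite (ae_var_good C0 whatC mwhat iid.2.1 mr ir2 n (low _ FP)) lee_fin.
    exact: ltW.
  by move=> N _ HN; exists N => // n Nn Pt FPt; exact: HN.
by have [P FP] := fam0; exists (P, 0).
Qed.
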